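(* Let $n,N\ge 1$ and let $f_1,\dots,f_N,g_1,\dots,g_N\in\mathrm{Sym}(\mathbb{C}^n)\cap H(\mathbb{C}^n)$. For each $l$ let $s_l$ be the function $s_l(z)=g_l^*(\overline{z}-\partial_z)f_l(z)$ on $\mathbb{C}^n$. Then $$\sum_{l=1}^N T_{f_l}T_{\overline{g_l}}=\sum_{l=1}^N T_{s_l}.$$
   Context: $dV$ is Lebesgue measure on $\mathbb{C}^n$ and $d\mu(z)=\pi^{-n}e^{-|z|^2}dV(z)$. For $z,w\in\mathbb{C}^n$, $z\cdot w=\sum_k z_kw_k$ (bilinear) and $|z|^2=z\cdot\overline{z}$. $H(\mathbb{C}^n)$ is the space of entire functions and $F^2=L^2(\mathbb{C}^n,d\mu)\cap H(\mathbb{C}^n)$ is the Fock space, with reproducing kernel $K_z(w)=e^{w\cdot\overline{z}}$. $\mathrm{Sym}(\mathbb{C}^n)$ is the set of complex measurable functions $u$ such that for every $c>0$ the function $u(z)e^{-c|z|^2}$ is essentially bounded. Toeplitz operators: $T_\varphi=PM_\varphi$, where $M_\varphi$ is multiplication by $\varphi$ and $P$ is the orthogonal projection of $L^2(\mathbb{C}^n,d\mu)$ onto $F^2$; explicitly $T_\varphi F(z)=\int_{\mathbb{C}^n}\varphi(w)F(w)e^{z\cdot\overline{w}}\,d\mu(w)$. Such operators may be unbounded; identities between Toeplitz operators and their products are understood as identities on the (dense) linear span of the kernels $K_z$, $z\in\mathbb{C}^n$, where all the integrals involved converge. Notation $g^*(\overline{z}-\partial_z)f(z)$: for entire $g(z)=\sum_i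 a_iz^i$ (multi-indices $i$), $g^*(z)=\overline{g(\overline{z})}=\sum_i\overline{a_i}z^i$, and $$g^*(\overline{z}-\partial_z)f(z)=\sum_i\overline{a_i}\,(\overline{z}-\partial_z)^if(z),\qquad (\overline{z}-\partial_z)^if(z)=\sum_{l\le i}\binom{i}{l}(-1)^{|i-l|}\,\overline{z}^{\,l}\,\partial^{i-l}f(z),$$ where $\binom{i}{l}=\prod_k\binom{i_k}{l_k}$, $l\le i$ componentwise, $|i-l|=\sum_k(i_k-l_k)$, $\partial^j=\partial_1^{j_1}\cdots\partial_n^{j_n}$, $\partial_k=\partial/\partial z_k$. *)

(* Defs.v *)
(* MathComp / MathComp-Analysis, over an arbitrary [R : realType]; complex
   numbers are [R[i]] and C^n is ['rV[R[i]]_n]. *)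
From HB Require Import structures.
From mathcomp Require Import all_boot all_order all_algebra.
From mathcomp Require Import complex.
From mathcomp Require Import all_classical all_reals all_analysis.
From mathcomp Require Import ess_sup_inf summability.

Set Implicit Arguments.
Unset Strict Implicit.
Unset Printing Implicit Defensive.

Import Order.TTheory GRing.Theory Num.Theory.
Import numFieldNormedType.Exports.

Local Open Scope classical_set_scope.
Local Open Scope complex_scope.
Local Open Scope ring_scope.

(* [differentiable], ['D_v f] and limits at type [R[i]] are taken over the
   scalar field [R[i]] itself, i.e. in the complex sense. *)
Section complex_normed_module.
Variable R : realType.
HB.instance Definition _ := PseudoPointedMetric.copy R[i] R[i]^o.
HB.instance Definition _ := NormedModule.copy R[i] R[i]^o.
End complex_normed_module.

Definition reim (R : realType) (z : R[i]) :
    measurableTypeR R * measurableTypeR R :=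
  (complex.Re z, complex.Im z).

HB.instance Definition _ (R : realType) :=
  Measurable.copy R[i] (g_sigma_algebra_preimageType (@reim R)).

Definition row_display : measure_display -> measure_display.
Proof. exact. Qed.

Section measurable_row.
Context d (T : measurableType d) (n : nat).

Let coord (i : 'I_n) (v : 'rV[T]_n) : T := v ord0 i.

Let row_set0 : g_sigma_preimage coord set0.
Proof. exact: sigma_algebra0. Qed.

Let row_setC A : g_sigma_preimage coord A -> g_sigma_preimage coord (~` A).
Proof. exact: sigma_algebraC. Qed.

Let row_bigcup (F : (set 'rV[T]_n)^nat) :
  (forall i, g_sigma_preimage coord (F i)) ->
  g_sigma_preimage coord (\bigcup_i (F i)).
Proof. exact: sigma_algebra_bigcup. Qed.

HB.instance Definition _ := @isMeasurable.Build (row_display d)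
  'rV[T]_n (g_sigma_preimage coord) row_set0 row_setC row_bigcup.

Lemma measurable_row_coord (i : 'I_n) :
  measurable_fun [set: 'rV[T]_n] (fun v : 'rV[T]_n => v ord0 i).
Proof.
move=> _ Y mY; rewrite setTI; apply: sub_sigma_algebra => /=.
rewrite -bigcup_seq/=; exists i => /=; first by rewrite mem_index_enum.
by exists Y => //; rewrite setTI.
Qed.

Lemma measurable_fun_row d1 (T1 : measurableType d1) (f : T1 -> 'rV[T]_n) :
  (forall i, measurable_fun [set: T1] (fun x => f x ord0 i)) ->
  measurable_fun [set: T1] f.
Proof.
move=> mf.
have Gf : g_sigma_preimage (fun i x => f x ord0 i) `<=` measurable.
  apply: smallest_sub; first exact: sigma_algebra_measurable.
  case: n f mf => [|m] f mf; first by rewrite big_ord0.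
  rewrite -bigcup_mkord_ord; apply: bigcup_sub => i Ii.
  by move=> A [B mB <-]; exact: mf.
move=> _ A mA; apply: Gf.
rewrite (_ : (fun i x => f x ord0 i) = (fun i => coord i \o f))//.
by rewrite (g_sigma_preimage_comp coord); exists A.
Qed.

End measurable_row.

Section lebesgue_Cn.
Variable R : realType.

Definition cons_C n (p : 'rV[R[i]]_n * measurableTypeR R * measurableTypeR R) :
    'rV[R[i]]_n.+1 :=
  row_mx (p.1.2 +i* p.2)%:M p.1.1 : 'rV_(1 + n).

Lemma measurable_cons_C n : measurable_fun setT (@cons_C n).
Proof.
apply: measurable_fun_row => i.
case: (splitP (i : 'I_(1 + n))) => j ij.
  rewrite (_ : (fun p => _) = (fun p => p.1.2 +i* p.2)); last first.
    apply/funext => p; rewrite /cons_C.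
    have -> : i = lshift n j by exact/val_inj.
    by apply: etrans (row_mxEl _ _ _ _) _; rewrite !ord1 mxE eqxx mulr1n.
  move=> _ _ [B mB <-].
  pose h (p : 'rV[R[i]]_n * measurableTypeR R * measurableTypeR R) :=
    (p.1.2, p.2).
  have mh : measurable_fun setT h.
    apply: measurable_fun_pair => //.
    by apply: measurableT_comp => //; exact: measurable_snd.
  rewrite (_ : _ `&` _ = setT `&` h @^-1` B); first exact: mh.
  by apply/seteqP; split => -[[w x] y] /= [_]; rewrite ?setTI //; case.
rewrite (_ : (fun p => _) = (fun v : 'rV[R[i]]_n => v ord0 j) \o (fst \o fst)).
  apply: measurableT_comp; first exact: measurable_row_coord.
  by apply: measurableT_comp.
apply/funext => p; rewrite /cons_C.
have -> : i = rshift 1 j by exact/val_inj.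
exact: (etrans (row_mxEr _ _ _ _)).
Qed.

Section step.
Context n (m : {measure set 'rV[R[i]]_n -> \bar R}).

Definition lebesgue_cons : set 'rV[R[i]]_n.+1 -> \bar R :=
  pushforward (m \x @lebesgue_measure R \x @lebesgue_measure R)%E (@cons_C n).

Let lebesgue_cons0 : lebesgue_cons set0 = 0%E.
Proof. by rewrite /lebesgue_cons /pushforward preimage_set0 measure0. Qed.

Let lebesgue_cons_ge0 A : (0 <= lebesgue_cons A)%E.
Proof. by rewrite /lebesgue_cons /pushforward; exact: measure_ge0. Qed.

Let lebesgue_cons_sigma_additive : semi_sigma_additive lebesgue_cons.
Proof.
move=> F mF tF mUF; rewrite /lebesgue_cons /pushforward preimage_bigcup.
apply: measure_semi_sigma_additive.
- by move=> k; rewrite -[X in measurable X]setTI; exact: measurable_cons_C.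
- apply/trivIsetP => /= i j _ _ ij; rewrite -preimage_setI.
  by move/trivIsetP : tF => /(_ _ _ _ _ ij) ->//; rewrite preimage_set0.
- rewrite -preimage_bigcup -[X in measurable X]setTI.
  exact: measurable_cons_C.
Qed.

HB.instance Definition _ := isMeasure.Build _ _ _ lebesgue_cons
  lebesgue_cons0 lebesgue_cons_ge0 lebesgue_cons_sigma_additive.

End step.

(* Lebesgue measure dV on C^n = R^(2n), as an n-fold product. *)
Fixpoint lebesgue_Cn n : {measure set 'rV[R[i]]_n -> \bar R} :=
  match n with
  | 0 => \d_(0 : 'rV[R[i]]_0)
  | n'.+1 => lebesgue_cons (lebesgue_Cn n')
  end.

End lebesgue_Cn.

Section complex_integral.
Context (R : realType) (n : nat).
Local Notation C := R[i].
Local Notation Cn := 'rV[R[i]]_n.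
Local Notation dV := (lebesgue_Cn R n).

Definition cintegrable (u : Cn -> C) : Prop :=
  dV.-integrable setT (fun w => (complex.Re (u w))%:E) /\
  dV.-integrable setT (fun w => (complex.Im (u w))%:E).

(* Both parts are Rintegral, hence 0 when the integral is not finite: only
   meaningful together with [cintegrable]. *)
Definition cintegral (u : Cn -> C) : C :=
  (\int[dV]_w complex.Re (u w)) +i* (\int[dV]_w complex.Im (u w)).

End complex_integral.

Section fock.
Context (R : realType) (n : nat).
Local Notation C := R[i].
Local Notation Cn := 'rV[R[i]]_n.
Local Notation dV := (lebesgue_Cn R n).

Definition bdot (z w : Cn) : C := \sum_(k < n) z 0 k * w 0 k.

Definition conjv (z : Cn) : Cn := map_mx (@conjc R) z.

Definition sqnorm (z : Cn) : R := complex.Re (bdot z (conjv z)).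

Definition cexp (z : C) : C :=
  (expR (complex.Re z))%:C * (cos (complex.Im z) +i* sin (complex.Im z)).

(* The density of the Gaussian measure dmu with respect to dV: integrals
   against dmu are written below as integrals against dV. *)
Definition gauss_density (w : Cn) : R := pi ^- n * expR (- sqnorm w).

Definition entire (f : Cn -> C) : Prop := forall z, differentiable f z.

Definition Sym : set (Cn -> C) :=
  [set u : Cn -> C | measurable_fun setT u /\
    forall c : R, 0 < c ->
      (ess_sup dV (fun z => (Normc.normc (u z * (expR (- c * sqnorm z))%:C))%:E)
        < +oo)%E].

Definition fock_kernel (z w : Cn) : C := cexp (bdot w (conjv z)).

Definition kernel_span : set (Cn -> C) :=
  [set F : Cn -> C | exists (m : nat) (c : 'I_m -> C) (a : 'I_m -> Cn),
    F = (fun w => \sum_(j < m) c j * fock_kernel (a j) w)].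

(* T_phi F(z) is the integral of phi(w) F(w) e^(z . \bar w) dmu(w). *)
Definition toeplitz_integrand (phi F : Cn -> C) (z w : Cn) : C :=
  phi w * F w * cexp (bdot z (conjv w)) * (gauss_density w)%:C.

Definition toeplitz_converges (phi F : Cn -> C) : Prop :=
  forall z, cintegrable (toeplitz_integrand phi F z).

Definition toeplitz (phi F : Cn -> C) (z : Cn) : C :=
  cintegral (toeplitz_integrand phi F z).

Definition conjf (g : Cn -> C) (z : Cn) : C := conjc (g z).

Definition pderiv (k : 'I_n) (f : Cn -> C) (z : Cn) : C := 'D_('e_k) f z.

Definition mderiv (j : 'I_n -> nat) (f : Cn -> C) : Cn -> C :=
  foldr (fun k h => iter (j k) (pderiv k) h) f (enum 'I_n).

Definition mpow (z : Cn) (j : 'I_n -> nat) : C := \prod_(k < n) z 0 k ^+ j k.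

(* The coefficients a of the power series g(z) = \sum_i a_i z^i, convergent on
   all of C^n. [get] returns an arbitrary family if there is none, which does
   not occur for entire g. *)
Definition coefs (g : Cn -> C) : {ffun 'I_n -> nat} -> C :=
  get [set a : {ffun 'I_n -> nat} -> C |
        forall z, partial_sum (fun i => a i * mpow z i) @ totally --> g z].

(* (\bar z - \partial_z)^i f(z); the index l ranges over the multi-indices
   l <= i *)
Definition creation (i : {ffun 'I_n -> nat}) (f : Cn -> C) (z : Cn) : C :=
  \sum_(l : {dffun forall k : 'I_n, 'I_(i k).+1})
    (\prod_(k < n) 'C(i k, l k))%:R * (-1) ^+ (\sum_(k < n) (i k - l k))%N *
    mpow (conjv z) (fun k => l k) * mderiv (fun k => i k - l k)%N f z.

Definition wick_term (g f : Cn -> C) (z : Cn) (i : {ffun 'I_n -> nat}) : C :=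
  conjc (coefs g i) * creation i f z.

(* g^*(\bar z - \partial_z) f(z); [sum] is the limit over finite sets of
   multi-indices, i.e. the unconditional sum *)
Definition wick (g f : Cn -> C) (z : Cn) : C := sum (wick_term g f z).

Definition wick_converges (g f : Cn -> C) : Prop :=
  forall z, cvg (partial_sum (wick_term g f z) @ totally).

End fock.

(* Main.v *)
Require Import Defs.
From HB Require Import structures.
From mathcomp Require Import all_boot all_order all_algebra.
From mathcomp Require Import complex finmap.
From mathcomp Require Import all_classical all_reals all_analysis.
From mathcomp Require Import measurable_realfun ess_sup_inf summability.
From mathcomp Require Import ring lra.

Set Implicit Arguments.
Unset Strict Implicit.
Unset Printing Implicit Defensive.

Import Order.TTheory GRing.Theory Num.Theory.
Import numFieldNormedType.Exports.

Local Open Scope classical_set_scope.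
Local Open Scope ring_scope.

(* Differentiation under the integral sign in [f(z) = \int f(w) e^(z . \bar w) dmu(w)] turns
   [\bar z_k - \partial_k] into multiplication by [\bar z_k - \bar w_k]. The coefficients of
   [g] are Gaussian moments of [g], so that summing over multi-indices restores an exponential
   inside a double Gaussian integral, and
     [s(z) = \int f(w) \overline{g(z - w)} e^(z . \bar w) dmu(w)].
   By Fubini and the reproducing formula, [T_f T_{\bar g} K_a] and [T_s K_a] both equal
   [\overline{g(a)} f K_a]. The reproducing formula itself is the mean value property on
   circles, averaged against the Gaussian, one variable at a time. *)

(** * Goursat's lemma *)

(** [entire] gives complex differentiability at each point and nothing more: no continuous
    derivatives, no power series, no formula for derivatives. This shapes the proof. Goursat's
    bisection is needed before any mean value. The power series of g comes from the reproducing
    formula, by expanding e^(z . \bar w) under the integral; since [coefs] selects some family of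
    coefficients, uniqueness for unconditionally convergent series in several variables is needed as
    well. The derivatives of f are computed from the same formula, which writes f as an integral
    transform of f times the Gaussian. The tight point is the exchange of sum and double integral.
    The exponent is v . (\bar z - \bar w), of size |v||w|, while the weight is e^(-|v|^2 - |w|^2),
    which dominates e^(t|v||w|) only for t < 2. The tail of the exponential series is therefore
    bounded by a geometric factor times e^(3|x|/2); the growth of f and g can be made as slow as
    needed, so it fits into what remains of the weight. *)

Section rectangle.
Variable R : realType.
Notation leb := (@lebesgue_measure R).

Lemma continuous_integrable_itv (f : R -> R) (a b : R) :
  continuous f -> leb.-integrable `[a, b] (EFin \o f).
Proof.
move=> cf; apply: continuous_compact_integrable; first exact: segment_compact.
exact: continuous_subspaceT.
Qed.

Lemma Rintegral_itv_split (f : R -> R) (a b c : R) :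
  continuous f -> a <= b -> b <= c ->
  \int[leb]_(t in `[a, c]) f t =
  \int[leb]_(t in `[a, b]) f t + \int[leb]_(t in `[b, c]) f t.
Proof.
move=> cf ab bc.
have := @Rintegral_itvB _ f (BLeft a) (BRight c) b
  (continuous_integrable_itv a c cf).
rewrite !bnd_simp => /(_ ab bc).
rewrite Rintegral_itv_obnd_cbnd; last first.
  apply: integrableS (continuous_integrable_itv a c cf) => //.
  by apply: subset_itvr; rewrite bnd_simp.
by move=> <-; rewrite addrC subrK.
Qed.

Lemma Rintegral_itv_cst (a b c : R) : a <= b ->
  \int[leb]_(t in `[a, b]) c = c * (b - a).
Proof.
move=> ab; rewrite Rintegral_cst//; congr (_ * _).
apply: etrans (congr1 fine (@lebesgue_measure_itv R `[a, b])) _.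
rewrite /= lte_fin.
by case: ltgtP ab => //= -> _; rewrite subrr.
Qed.

Lemma normr_Rintegral_itv_le (f : R -> R) (a b M : R) : continuous f -> a <= b ->
  (forall t, a <= t <= b -> `|f t| <= M) ->
  `|\int[leb]_(t in `[a, b]) f t| <= M * (b - a).
Proof.
move=> cf ab fM.
have cnf : continuous (fun t => `|f t|).
  by move=> t; apply: continuous_comp; [exact: cf|exact: norm_continuous].
apply: le_trans (le_normr_Rintegral _ (continuous_integrable_itv _ _ cf)) _ => //.
rewrite -(Rintegral_itv_cst _ ab); apply: le_Rintegral => //.
  exact: continuous_integrable_itv.
by apply: continuous_integrable_itv => t; exact: cvg_cst.
Qed.

Variables P Q : R -> R -> R.

(* [P dx + Q dy] is differentiable with [dP/dy = dQ/dx = b]: a closed form, with no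
   continuity of the derivatives. *)
Hypothesis closed_form : forall x0 y0, exists a b d : R,
  forall e : R, 0 < e -> exists2 r : R, 0 < r & forall x y, `|x - x0| <= r -> `|y - y0| <= r ->
    `|P x y - P x0 y0 - a * (x - x0) - b * (y - y0)|
      <= e * (`|x - x0| + `|y - y0|) /\
    `|Q x y - Q x0 y0 - b * (x - x0) - d * (y - y0)|
      <= e * (`|x - x0| + `|y - y0|).

(** A first-order expansion with error at most |x - x0| already bounds the increment by (|a| + 1)|x
    - x0|. *)
Let lin_continuous (f : R -> R) (x0 a r : R) : 0 < r ->
  (forall x, `|x - x0| <= r -> `|f x - f x0 - a * (x - x0)| <= `|x - x0|) ->
  {for x0, continuous f}.
Proof.
move=> r0 H; apply/cvgrPdist_le => /= e e0.
have K0 : 0 < `|a| + 1 by rewrite ltr_wpDl.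
near=> x.
have xr : `|x - x0| <= r.
  rewrite distrC; near: x.
  by apply: (@cvgr_dist_le _ _ _ (nbhs x0) _ id x0) => //; exact: cvg_id.
have xe : `|x - x0| <= e / (`|a| + 1).
  rewrite distrC; near: x.
  apply: (@cvgr_dist_le _ _ _ (nbhs x0) _ id x0); first exact: cvg_id.
  by rewrite divr_gt0.
have {}H := H _ xr.
rewrite distrC (_ : f x - f x0 = (f x - f x0 - a * (x - x0)) + a * (x - x0)); last by ring.
apply: le_trans (ler_normD _ _) _; rewrite normrM.
rewrite ler_pdivlMr// in xe; nra.
Unshelve. all: by end_near. Qed.

Let contPx y : continuous (fun x => P x y).
Proof.
move=> x0; have [a [b [d /(_ _ ltr01)[r r0 H]]]] := closed_form x0 y.
apply: (lin_continuous (a:=a) r0) => x xr.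
have [|+ _] := H x y xr; first by rewrite subrr normr0 ltW.
by rewrite subrr normr0 mulr0 subr0 mul1r addr0.
Qed.

Let contQy x : continuous (fun y => Q x y).
Proof.
move=> y0; have [a [b [d /(_ _ ltr01)[r r0 H]]]] := closed_form x y0.
apply: (lin_continuous (a:=d) r0) => y yr.
have [|_ +] := H x y _ yr; first by rewrite subrr normr0 ltW.
by rewrite subrr normr0 mulr0 subr0 mul1r add0r.
Qed.

Lemma closed_form_continuousr x : continuous (Q x).
Proof. exact: contQy. Qed.

(* Circulation of P dx + Q dy along the boundary of [x, x+h] * [y, y+k]. *)
Definition circulation (x y h k : R) : R :=
  \int[leb]_(t in `[x, x + h]) (P t y - P t (y + k)) +
  \int[leb]_(t in `[y, y + k]) (Q (x + h) t - Q x t).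

Let contP2 y y' : continuous (fun t => P t y - P t y').
Proof. by move=> t; apply: cvgB; exact: contPx. Qed.

Let contQ2 x x' : continuous (fun t => Q x t - Q x' t).
Proof. by move=> t; apply: cvgB; exact: contQy. Qed.

Let IB (f g : R -> R) a b : continuous f -> continuous g ->
  \int[leb]_(t in `[a, b]) (f t - g t) =
  \int[leb]_(t in `[a, b]) f t - \int[leb]_(t in `[a, b]) g t.
Proof. by move=> cf cg; rewrite RintegralB//; exact: continuous_integrable_itv. Qed.

Let circulation_cut (x y h k : R) : 0 <= h -> 0 <= k ->
  circulation x y (h + h) (k + k) =
    circulation x y h k + circulation (x + h) y h k +
    circulation x (y + k) h k + circulation (x + h) (y + k) h k.
Proof.
move=> h0 k0; rewrite /circulation !addrA.
rewrite (@Rintegral_itv_split _ x (x + h) (x + h + h)) ?lerDl//.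
rewrite (@Rintegral_itv_split _ y (y + k) (y + k + k)) ?lerDl//.
by rewrite !IB//; lra.
Qed.

(** The affine parts of P and Q contribute (dQ/dx - dP/dy) h k = 0. On each pair of opposite sides
    the remainders add up to at most e (h + k), and the sides have lengths h and k. *)
Let circulation_small (x0 y0 : R) : forall e : R, 0 < e -> exists2 r : R, 0 < r &
  forall x y h k : R, 0 <= h -> 0 <= k -> h <= r -> k <= r ->
   x <= x0 <= x + h -> y <= y0 <= y + k ->
   `|circulation x y h k| <= e * (h + k) ^+ 2.
Proof.
move=> e e0; have [a [b [d H]]] := closed_form x0 y0.
have [|r r0 {}H] := H (e / 2); first by rewrite divr_gt0.
exists r => // x y h k h0 k0 hr kr /andP[xx0 x0x] /andP[yy0 y0y].
(* The two inserted constants integrate to b k h and - b h k, which cancel. *)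
have -> : circulation x y h k =
   \int[leb]_(t in `[x, x + h]) (P t y - P t (y + k) - - (b * k)) +
   \int[leb]_(t in `[y, y + k]) (Q (x + h) t - Q x t - b * h).
  rewrite [X in _ = X + _]IB// ?[X in _ = _ + X]IB//; try by move=> t; exact: cvg_cst.
  rewrite !Rintegral_itv_cst ?lerDl// /circulation; ring.
have E : e * (h + k) ^+ 2 = e * (h + k) * (x + h - x) + e * (h + k) * (y + k - y) by ring.
rewrite E; apply: le_trans (ler_normD _ _) _; apply: lerD.
  apply: normr_Rintegral_itv_le; rewrite ?lerDl//.
    by move=> t; apply: cvgB; [exact: contP2|exact: cvg_cst].
  move=> t /andP[xt tx].
  have tx0 : `|t - x0| <= h by rewrite ler_norml; lra.
  have yy : `|y - y0| <= k by rewrite ler_norml; lra.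
  have yk : `|y + k - y0| <= k by rewrite ler_norml; lra.
  have [+ _] := H t y (le_trans tx0 hr) (le_trans yy kr).
  have [+ _] := H t (y + k) (le_trans tx0 hr) (le_trans yk kr).
  set u := `|t - x0| in tx0 *; set v := `|y - y0| in yy *.
  set w := `|y + k - y0| in yk *.
  rewrite !ler_norml; nra.
apply: normr_Rintegral_itv_le; rewrite ?lerDl//.
  by move=> t; apply: cvgB; [exact: contQ2|exact: cvg_cst].
move=> t /andP[xt tx].
have tx0 : `|t - y0| <= k by rewrite ler_norml; lra.
have yy : `|x - x0| <= h by rewrite ler_norml; lra.
have yk : `|x + h - x0| <= h by rewrite ler_norml; lra.
have [_] := H x t (le_trans yy hr) (le_trans tx0 kr).
have [_] := H (x + h) t (le_trans yk hr) (le_trans tx0 kr).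
set u := `|t - y0| in tx0 *; set v := `|x - x0| in yy *.
set w := `|x + h - x0| in yk *.
rewrite !ler_norml; nra.
Qed.

(** Among the four quarters, one carries at least a fourth of the circulation; [p] is its lower left
    corner. *)
Let half_quarter (x y h k : R) : 0 <= h -> 0 <= k -> exists p : R * R,
  [/\ x <= p.1 <= x + h / 2, y <= p.2 <= y + k / 2 &
   `|circulation x y h k| <= 4 * `|circulation p.1 p.2 (h / 2) (k / 2)|].
Proof.
move=> h0 k0; have h20 : 0 <= h / 2 by lra. have k20 : 0 <= k / 2 by lra.
have := circulation_cut x y h20 k20; rewrite -!splitr => E.
set c1 := circulation x y (h / 2) _ in E.
set c2 := circulation (x + _) y _ _ in E.
set c3 := circulation x (y + _) _ _ in E.
set c4 := circulation (x + _) (y + _) _ _ in E.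
have : [|| `|circulation x y h k| <= 4 * `|c1|, `|circulation x y h k| <= 4 * `|c2|,
   `|circulation x y h k| <= 4 * `|c3| | `|circulation x y h k| <= 4 * `|c4|].
  rewrite E; apply/negPn/negP; rewrite !negb_or -!ltNge => /and4P[a1 a2 a3 a4].
  have := ler_normD (c1 + c2 + c3) c4; have := ler_normD (c1 + c2) c3.
  have := ler_normD c1 c2; lra.
case/or4P => H; [exists (x, y)|exists (x + h / 2, y)|exists (x, y + k / 2)|
  exists (x + h / 2, y + k / 2)]; split => //=; lra.
Qed.

(** The intervals [u n, u n + h / 2 ^ n] are nested; the common point is the supremum of their left
    ends. *)
Let nested_point (u : nat -> R) (h : R) : 0 <= h ->
  (forall n, u n <= u n.+1 <= u n + h / 2 ^+ n.+1) ->
  exists x0, forall n, u n <= x0 <= u n + h / 2 ^+ n.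
Proof.
move=> h0 H.
have ndu m n : u n <= u (n + m)%N.
  elim: m => [|m IH]; first by rewrite addn0.
  by rewrite addnS (le_trans IH)//; case/andP: (H (n + m)%N).
(* The subtracted term is what lets the induction close: it sums the geometric series of the
   steps. *)
have ubu m n : u (n + m)%N <= u n + h / 2 ^+ n - h / 2 ^+ (n + m).
  elim: m => [|m IH]; first by rewrite addn0 addrK.
  case/andP: (H (n + m)%N) => _; rewrite addnS => /le_trans; apply.
  have : h / 2 ^+ (n + m) = h / 2 ^+ (n + m).+1 + h / 2 ^+ (n + m).+1.
    by rewrite exprS invfM mulrCA; lra.
  by move=> E; rewrite E in IH; lra.
have ub m n : u m <= u n + h / 2 ^+ n.
  have e0 k : 0 <= h / 2 ^+ k by rewrite divr_ge0// exprn_ge0.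
  have [nm|mn] := leqP n m.
    by rewrite -(subnKC nm) (le_trans (ubu _ _))// lerBlDr lerDl.
  by rewrite (le_trans (ndu (n - m)%N m))// subnKC ?(ltnW mn)// lerDl.
have hs : has_sup (range u).
  split; first by exists (u 0%N), 0%N.
  by exists (u 0%N + h / 2 ^+ 0) => _ [m _ <-]; exact: ub.
exists (sup (range u)) => n; apply/andP; split.
  by apply: ub_le_sup; [case: hs|exists n].
by apply: ge_sup; [case: hs|move=> _ [m _ <-]; exact: ub].
Qed.

(** After n bisections the circulation is at most 4 ^ n times that of a rectangle around the limit
    point. By [circulation_small] the latter is at most e' (h + k)^2 / 4 ^ n, so the powers of 4
    cancel and e' is arbitrary. *)
Lemma circulation_eq0 (x y h k : R) : 0 <= h -> 0 <= k -> circulation x y h k = 0.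
Proof.
move=> h0 k0.
have [F HF] : {F : nat -> R * R -> R * R | forall n p,
    [/\ p.1 <= (F n p).1 <= p.1 + h / 2 ^+ n.+1,
        p.2 <= (F n p).2 <= p.2 + k / 2 ^+ n.+1 &
     `|circulation p.1 p.2 (h / 2 ^+ n) (k / 2 ^+ n)| <=
     4 * `|circulation (F n p).1 (F n p).2 (h / 2 ^+ n.+1) (k / 2 ^+ n.+1)|]}.
  have H n p : exists q : R * R, [/\ p.1 <= q.1 <= p.1 + h / 2 ^+ n.+1,
        p.2 <= q.2 <= p.2 + k / 2 ^+ n.+1 &
     `|circulation p.1 p.2 (h / 2 ^+ n) (k / 2 ^+ n)| <=
     4 * `|circulation q.1 q.2 (h / 2 ^+ n.+1) (k / 2 ^+ n.+1)|].
    have := @half_quarter p.1 p.2 (h / 2 ^+ n) (k / 2 ^+ n).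
    rewrite -!mulrA -!invfM -!exprSr; apply.
      by rewrite divr_ge0// exprn_ge0.
    by rewrite divr_ge0// exprn_ge0.
  exists (fun n p => sval (cid (H n p))) => n p; exact: (svalP (cid (H n p))).
pose v := fix v n := if n is m.+1 then F m (v m) else (x, y).
have [||x0 Hx0] := @nested_point (fun n => (v n).1) h => //.
  by move=> n /=; case: (HF n (v n)).
have [||y0 Hy0] := @nested_point (fun n => (v n).2) k => //.
  by move=> n /=; case: (HF n (v n)).
have big n : `|circulation x y h k| <=
    4 ^+ n * `|circulation (v n).1 (v n).2 (h / 2 ^+ n) (k / 2 ^+ n)|.
  elim: n => [|n IH]; first by rewrite mul1r /= expr0 !divr1.
  apply: le_trans IH _; rewrite exprSr -mulrA ler_pM2l ?exprn_gt0//.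
  by case: (HF n (v n)).
apply/eqP; rewrite -normr_le0; apply/ler_addgt0Pl => e e0; rewrite addr0.
have S0 : 0 < (h + k) ^+ 2 + 1 by rewrite ltr_wpDl// sqr_ge0.
have [|r r0 Hr] := @circulation_small x0 y0 (e / ((h + k) ^+ 2 + 1)).
  by rewrite divr_gt0.
have [n hn] : exists n, h + k <= r * 2 ^+ n.
  exists (Num.bound ((h + k) / r)); rewrite -ler_pdivrMl// mulrC.
  have q0 : 0 <= (h + k) / r by rewrite divr_ge0 ?addr_ge0 // ltW.
  apply: le_trans (ltW (archi_boundP q0)) _.
  by rewrite -natrX ler_nat ltnW// ltn_expl.
have p0 : 0 < 2 ^+ n :> R by rewrite exprn_gt0.
apply: le_trans (big n) _.
apply: le_trans (ler_wpM2l _ (Hr _ _ _ _ _ _ _ _ (Hx0 n) (Hy0 n))) _.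
- by rewrite exprn_ge0.
- by rewrite divr_ge0// ltW.
- by rewrite divr_ge0// ltW.
- by rewrite ler_pdivrMr//; lra.
- by rewrite ler_pdivrMr//; lra.
rewrite -mulrDl expr_div_n -exprM mulnC exprM.
rewrite (_ : (2 ^+ 2 : R) = 4); last by rewrite expr2; lra.
have q0 : 4 ^+ n != 0 :> R by rewrite expf_neq0// pnatr_eq0.
rewrite mulrCA [X in _ * X]mulrCA mulfV// mulr1 mulrAC ler_pdivrMr//.
by rewrite ler_pM2l// lerDl ler01.
Qed.

End rectangle.

(** * Modulus and exponential of complex numbers *)

Notation nm := Normc.normc.
Notation Re := complex.Re.
Notation Im := complex.Im.

Section complex_norm.
Variable R : realType.
Implicit Types (z w : R[i]) (x y : R).
Local Open Scope complex_scope.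

Lemma complex_eqP z w : Re z = Re w -> Im z = Im w -> z = w.
Proof. by case: z w => [a b] [c d] /= -> ->. Qed.

Lemma nmE z : `|z| = (nm z)%:C. Proof. by []. Qed.
Lemma nm_ge0 z : 0 <= nm z. Proof. by case: z => a b; exact: sqrtr_ge0. Qed.
Lemma nm0 : nm (0 : R[i]) = 0. Proof. exact: Normc.normc0. Qed.
Lemma nm1 : nm (1 : R[i]) = 1. Proof. exact: Normc.normc1. Qed.
Lemma nmM z w : nm (z * w) = nm z * nm w. Proof. exact: Normc.normcM. Qed.
Lemma nmN z : nm (- z) = nm z. Proof. exact: normcN. Qed.
Lemma nmD z w : nm (z + w) <= nm z + nm w. Proof. exact: le_normcD. Qed.
Lemma nmB z w : nm (z - w) <= nm z + nm w.
Proof. by rewrite -(nmN w) nmD. Qed.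
Lemma nm_distC z w : nm (z - w) = nm (w - z).
Proof. by rewrite -nmN opprB. Qed.
Lemma nm_eq0 z : nm z = 0 -> z = 0. Proof. exact: Normc.eq0_normc. Qed.
Lemma nmV z : nm z^-1 = (nm z)^-1. Proof. exact: Normc.normcV. Qed.
Lemma nmX z n : nm (z ^+ n) = nm z ^+ n.
Proof. by elim: n => [|n IH]; rewrite ?expr0 ?nm1// !exprS nmM IH. Qed.
Lemma nm_real x : nm x%:C = `|x|.
Proof. by rewrite /= expr0n addr0 sqrtr_sqr. Qed.
Lemma nm_conj z : nm (conjc z) = nm z.
Proof. by case: z => a b /=; rewrite sqrrN. Qed.
Lemma nm_nat n : nm (n%:R : R[i]) = n%:R.
Proof. by rewrite -(rmorph_nat (real_complex R)) nm_real normr_nat. Qed.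
Lemma nm_sqr z : nm z ^+ 2 = Re z ^+ 2 + Im z ^+ 2.
Proof. by case: z => a b /=; rewrite sqr_sqrtr// addr_ge0 ?sqr_ge0. Qed.
Lemma nm_sum (I : Type) (s : seq I) (P : pred I) (F : I -> R[i]) :
  nm (\sum_(i <- s | P i) F i) <= \sum_(i <- s | P i) nm (F i).
Proof.
elim/big_rec2: _ => [|i y x _ h]; first by rewrite nm0.
by rewrite (le_trans (nmD _ _))// lerD2l.
Qed.
Lemma nm_prod (I : Type) (s : seq I) (P : pred I) (F : I -> R[i]) :
  nm (\prod_(i <- s | P i) F i) = \prod_(i <- s | P i) nm (F i).
Proof. exact: (big_morph _ nmM nm1). Qed.

Lemma Re_le_nm z : `|Re z| <= nm z.
Proof.
by rewrite -[leLHS]sqrtr_sqr; case: z => a b /=; rewrite ler_wsqrtr// lerDl sqr_ge0.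
Qed.
Lemma Im_le_nm z : `|Im z| <= nm z.
Proof.
by rewrite -[leLHS]sqrtr_sqr; case: z => a b /=; rewrite ler_wsqrtr// lerDr sqr_ge0.
Qed.
Lemma nm_le z : nm z <= `|Re z| + `|Im z|.
Proof.
rewrite -(ler_pXn2r (n:=2)) ?nnegrE ?nm_ge0 ?addr_ge0//.
rewrite nm_sqr -[Re z ^+ 2]real_normK ?num_real// -[Im z ^+ 2]real_normK ?num_real//.
have := normr_ge0 (Re z); have := normr_ge0 (Im z); nra.
Qed.

Lemma ReD z w : Re (z + w) = Re z + Re w. Proof. by case: z w => ? ? []. Qed.
Lemma ImD z w : Im (z + w) = Im z + Im w. Proof. by case: z w => ? ? []. Qed.
Lemma ReN z : Re (- z) = - Re z. Proof. by case: z. Qed.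
Lemma ImN z : Im (- z) = - Im z. Proof. by case: z. Qed.
Lemma ReM z w : Re (z * w) = Re z * Re w - Im z * Im w.
Proof. by case: z w => ? ? []. Qed.
Lemma ImM z w : Im (z * w) = Re z * Im w + Im z * Re w.
Proof. by case: z w => ? ? []. Qed.
Lemma Re_conj z : Re (conjc z) = Re z. Proof. by case: z. Qed.
Lemma Im_conj z : Im (conjc z) = - Im z. Proof. by case: z. Qed.
Lemma Re_sum (I : Type) (s : seq I) (P : pred I) (F : I -> R[i]) :
  Re (\sum_(i <- s | P i) F i) = \sum_(i <- s | P i) Re (F i).
Proof. exact: (big_morph _ ReD (erefl _)). Qed.
Lemma Im_sum (I : Type) (s : seq I) (P : pred I) (F : I -> R[i]) :
  Im (\sum_(i <- s | P i) F i) = \sum_(i <- s | P i) Im (F i).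
Proof. exact: (big_morph _ ImD (erefl _)). Qed.

Lemma Re_real x : Re x%:C = x. Proof. by []. Qed.
Lemma Im_real x : Im x%:C = 0. Proof. by []. Qed.

Lemma Re_mk x y : Re (x +i* y) = x. Proof. by []. Qed.
Lemma Im_mk x y : Im (x +i* y) = y. Proof. by []. Qed.

Definition ReImE := (Re_mk, Im_mk, ReD, ImD, ReN, ImN, ReM, ImM, Re_conj, Im_conj, Re_real, Im_real).

Lemma cexpE z : cexp z = (expR (Re z) * cos (Im z)) +i* (expR (Re z) * sin (Im z)).
Proof. by apply: complex_eqP; rewrite !ReImE ?mul0r ?subr0 ?addr0. Qed.

Lemma cexp0 : cexp 0 = 1 :> R[i].
Proof. by rewrite cexpE/= expR0 cos0 sin0 mulr1 mulr0. Qed.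

Lemma cexpD z w : cexp (z + w) = cexp z * cexp w.
Proof.
by rewrite !cexpE; apply: complex_eqP; rewrite !ReImE expRD ?cosD ?sinD; ring.
Qed.

Lemma cexp_sum (I : Type) (s : seq I) (P : pred I) (F : I -> R[i]) :
  cexp (\sum_(i <- s | P i) F i) = \prod_(i <- s | P i) cexp (F i).
Proof. exact: (big_morph _ cexpD cexp0). Qed.

Lemma nm_cexp z : nm (cexp z) = expR (Re z).
Proof.
rewrite nmM nm_real ger0_norm ?expR_ge0//=.
by rewrite cos2Dsin2 sqrtr1 mulr1.
Qed.

Lemma nm_cexp_le z : nm (cexp z) <= expR (nm z).
Proof. by rewrite nm_cexp ler_expR (le_trans (ler_norm _))// Re_le_nm. Qed.

Lemma conj_cexp z : conjc (cexp z) = cexp (conjc z).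
Proof. by rewrite !cexpE; apply: complex_eqP; rewrite !ReImE ?cosN// sinN mulrN. Qed.

Lemma cexp_real x : cexp x%:C = (expR x)%:C.
Proof. by rewrite cexpE/= cos0 sin0 mulr1 mulr0. Qed.

Let is_derive_pow (m : nat) (t : R) :
  is_derive t (1 : R) (fun t : R => t ^+ m) (m%:R * t ^+ m.-1).
Proof.
have -> : (fun t : R => t ^+ m) = id ^+ m by apply/funext => u; rewrite exprfctE.
apply: is_derive_eq (is_deriveX _ (is_derive_id _ _)) _.
by rewrite /GRing.scale/= mulr1.
Qed.

(** For s = 1 and s = -1 the function M t^(m+1) / (m+1) - s phi(t) has a nonnegative derivative on
    [0, 1], and it vanishes at 0. *)
Let segment_bound (phi dphi : R -> R) (M : R) (m : nat) : 0 <= M -> phi 0 = 0 ->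
  (forall t : R, is_derive t (1 : R) phi (dphi t)) ->
  (forall t : R, 0 <= t <= 1 -> `|dphi t| <= M * t ^+ m) -> `|phi 1| <= M / m.+1%:R.
Proof.
move=> M0 phi0 Dphi Hb.
have m0 : m.+1%:R != 0 :> R by rewrite pnatr_eq0.
suff H (s : R) : `|s| = 1 -> s * phi 1 <= M / m.+1%:R.
  rewrite ler_norml; have := H 1 (normr1 _); have := H (-1) (normrN1 _).
  by rewrite mul1r mulN1r => ? ?; apply/andP; split; first rewrite lerNl.
move=> s1.
pose psi : R -> R := fun t => M / m.+1%:R * t ^+ m.+1 - s * phi t.
have Dpsi (t : R) : is_derive t (1 : R) psi (M * t ^+ m - s * dphi t).
  have DX := is_derive_pow m.+1 t.
  have DZ := is_deriveB (is_deriveZ (M / m.+1%:R) DX) (is_deriveZ s (Dphi t)).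
  apply: is_derive_eq DZ _; rewrite /GRing.scale/= mulrA.
  by rewrite -[M / _ * _]mulrA mulVf// mulr1.
suff : psi 0 <= psi 1.
  by rewrite /psi phi0 mulr0 expr0n/= mulr0 subr0 expr1n mulr1 subr_ge0.
have [|c c01 E] := @MVT_segment _ psi (fun t => M * t ^+ m - s * dphi t) 0 1 ler01.
  by apply: derivable_within_continuous => t _; have [] := Dpsi t.
rewrite -subr_ge0 E subr0 mulr1 subr_ge0.
have {}c01 : 0 <= c <= 1 by move: c01; rewrite in_itv.
by apply: le_trans (ler_norm _) _; rewrite normrM s1 mul1r; exact: Hb.
Qed.

Definition expc_tail (m : nat) z := cexp z - \sum_(k < m) z ^+ k / k`!%:R.

Let expc_tail0 z m : expc_tail m.+1 (0%:C * z) = 0.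
Proof.
rewrite mul0r /expc_tail cexp0 big_ord_recl/= expr0 fact0 divr1 big1 ?addr0 ?subrr//.
by move=> i _; rewrite expr0n/= mul0r.
Qed.

Let is_derive_cexp z (t : R) :
  is_derive t (1 : R) (fun t : R => Re (cexp (t%:C * z))) (Re (z * cexp (t%:C * z))) /\
  is_derive t (1 : R) (fun t : R => Im (cexp (t%:C * z))) (Im (z * cexp (t%:C * z))).
Proof.
have E s : cexp (s%:C * z) = (expR (s * Re z) * cos (s * Im z)) +i* (expR (s * Re z) * sin (s * Im z)).
  by rewrite cexpE !ReImE !mul0r subr0 addr0.
have L (a : R) : is_derive t (1 : R) ( *%R^~ a) a.
  have -> : *%R^~ a = a \*: (id : R -> R).
    by apply/funext => u; rewrite mulrC.
  by apply: is_derive_eq (is_deriveZ a (is_derive_id _ _)) _; rewrite /GRing.scale/= mulr1.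
split.
- rewrite (_ : (fun t => _) = (expR \o *%R^~ (Re z)) * (cos \o *%R^~ (Im z))).
    apply: is_derive_eq (is_deriveM (is_derive1_comp (is_derive_expR _) (L (Re z)))
      (is_derive1_comp (is_derive_cos _) (L (Im z)))) _.
    by rewrite E !ReImE /GRing.scale/=; ring.
  by apply/funext => s; rewrite E.
- rewrite (_ : (fun t => _) = (expR \o *%R^~ (Re z)) * (sin \o *%R^~ (Im z))).
    apply: is_derive_eq (is_deriveM (is_derive1_comp (is_derive_expR _) (L (Re z)))
      (is_derive1_comp (is_derive_sin _) (L (Im z)))) _.
    by rewrite E !ReImE /GRing.scale/=; ring.
  by apply/funext => s; rewrite E.
Qed.

(** Along t z, the derivative of the Taylor remainder of order m + 1 is z times the remainder of
    order m. [P] stands for Re or Im. *)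
Let is_derive_expc_tail (P : R[i] -> R) (m : nat) z (t : R) :
  {morph P : z w / z + w} -> (forall x z, P (x%:C * z) = x * P z) ->
  is_derive t (1 : R) (fun t : R => P (cexp (t%:C * z))) (P (z * cexp (t%:C * z))) ->
  is_derive t (1 : R) (fun t : R => P (expc_tail m.+1 (t%:C * z)))
    (P (z * expc_tail m (t%:C * z))).
Proof.
move=> PD PZ D1.
have P0 : P 0 = 0 by have := PZ 0 0; rewrite mulr0 mul0r.
have PN w : P (- w) = - P w.
  by have := PZ (-1) w; rewrite rmorphN1 !mulN1r.
have Psum n (F : 'I_n -> R[i]) : P (\sum_(k < n) F k) = \sum_(k < n) P (F k).
  exact: (big_morph _ PD P0).
pose c (k : nat) := P (z ^+ k / k`!%:R).
have cE (k : nat) s : P ((s%:C * z) ^+ k / k`!%:R) = c k * s ^+ k.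
  by rewrite exprMn -rmorphXn -mulrA PZ mulrC.
have D2 := @is_derive_sum _ _ _ _ (fun k : 'I_m.+1 => c k \*: (fun t : R => t ^+ k)) t 1
  _ (fun k => is_deriveZ (c k) (is_derive_pow k t)).
have D3 := is_deriveB D1 D2.
rewrite (_ : (fun t => _) = (fun t0 : R => P (cexp (t0%:C * z))) -
         \sum_(i < m.+1) c i \*: (fun t : R => t ^+ i)); last first.
  apply/funext => s; rewrite /expc_tail PD PN Psum.
  rewrite fctE/=; congr (_ - _); rewrite fct_sumE; apply: eq_bigr => k _.
  by rewrite cE.
apply: is_derive_eq D3 _.
rewrite /expc_tail mulrBr PD PN mulr_sumr Psum; congr (_ - _).
rewrite big_ord_recl/= mul0r scaler0 add0r; apply: eq_bigr => k _.
rewrite /bump/= add1n /GRing.scale/= mulrCA mulrA /c.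
have -> : z * ((t%:C * z) ^+ k / k`!%:R) = (t ^+ k * k.+1%:R)%:C * (z ^+ k.+1 / (k.+1)`!%:R).
  rewrite exprMn exprS factS natrM invfM !rmorphM rmorphXn/= rmorph_nat.
  have k0 : k.+1%:R != 0 :> R[i] by rewrite pnatr_eq0.
  have f0 : k`!%:R != 0 :> R[i] by rewrite pnatr_eq0 -lt0n fact_gt0.
  by move: k0 f0; move: (k.+1%:R) (k`!%:R) => a b a0 b0; field; rewrite a0 b0.
by rewrite PZ; ring.
Qed.

(** Induction through [segment_bound]. The real and imaginary parts are bounded separately, so each
    step costs a factor 2; hence 2 |z| in place of |z|. *)
Lemma nm_expc_tail (m : nat) z :
  nm (expc_tail m z) <= (2 * nm z) ^+ m / m`!%:R * expR (nm z).
Proof.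
elim: m z => [|m IH] z.
  by rewrite /expc_tail big_ord0 subr0 expr0 fact0 divr1 mul1r nm_cexp_le.
have f0 k : 0 < k`!%:R :> R by rewrite ltr0n fact_gt0.
pose M := nm z * ((2 * nm z) ^+ m / m`!%:R * expR (nm z)).
have M0 : 0 <= M.
  by rewrite !mulr_ge0 ?nm_ge0 ?expR_ge0 ?exprn_ge0 ?mulr_ge0 ?nm_ge0// invr_ge0 ltW.
have Mt (t : R) : 0 <= t <= 1 -> nm (z * expc_tail m (t%:C * z)) <= M * t ^+ m.
  move=> /andP[t0 t1]; rewrite nmM -mulrA ler_wpM2l ?nm_ge0//.
  apply: le_trans (IH _) _; rewrite nmM nm_real ger0_norm//.
  rewrite mulrCA exprMn.
  set a := (2 * nm z) ^+ m / m`!%:R.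
  rewrite (_ : t ^+ m * _ / _ * _ = a * t ^+ m * expR (t * nm z)); last by rewrite /a; ring.
  rewrite (_ : a * expR _ * _ = a * t ^+ m * expR (nm z)); last by ring.
  apply: ler_wpM2l; last by rewrite ler_expR ler_piMl ?nm_ge0.
  by rewrite mulr_ge0 ?exprn_ge0// divr_ge0 ?(ltW (f0 _))// exprn_ge0// mulr_ge0 ?nm_ge0.
have [D1 D2] : (forall t : R, is_derive t (1 : R) (fun t : R => Re (expc_tail m.+1 (t%:C * z)))
    (Re (z * expc_tail m (t%:C * z)))) /\
  (forall t : R, is_derive t (1 : R) (fun t : R => Im (expc_tail m.+1 (t%:C * z)))
    (Im (z * expc_tail m (t%:C * z)))).
  split=> t; apply: is_derive_expc_tail.
  - exact: ReD.
  - by move=> x w; rewrite !ReImE mul0r subr0.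
  - by case: (is_derive_cexp z t).
  - exact: ImD.
  - by move=> x w; rewrite !ReImE mul0r addr0.
  - by case: (is_derive_cexp z t).
have T0 : expc_tail m.+1 (0%:C * z) = 0 by exact: expc_tail0.
apply: le_trans (nm_le _) _.
have H1 : `|Re (expc_tail m.+1 z)| <= M / m.+1%:R.
  have := segment_bound M0 _ D1; rewrite rmorph1 mul1r; apply => //.
    by rewrite T0.
  by move=> t t01; rewrite (le_trans (Re_le_nm _))// Mt.
have H2 : `|Im (expc_tail m.+1 z)| <= M / m.+1%:R.
  have := segment_bound M0 _ D2; rewrite rmorph1 mul1r; apply => //.
    by rewrite T0.
  by move=> t t01; rewrite (le_trans (Im_le_nm _))// Mt.
apply: le_trans (lerD H1 H2) _.
rewrite /M factS natrM invfM exprS.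
by rewrite le_eqVlt; apply/orP; left; apply/eqP; move: (m.+1%:R^-1) => ?; ring.
Qed.

Lemma expc_taylor2 z : nm (cexp z - 1 - z) <= 2 * nm z ^+ 2 * expR (nm z).
Proof.
have := nm_expc_tail 2 z; rewrite /expc_tail !big_ord_recl big_ord0/=.
rewrite /bump/= expr0 expr1 !divr1 addr0 opprD addrA => /le_trans; apply.
rewrite exprMn le_eqVlt; apply/orP; left; apply/eqP.
by rewrite (_ : 2`! = 2)%N//; field.
Qed.

End complex_norm.

(** * Mean value property on circles *)

Section complex_differentiable.
Variable R : realType.
Local Open Scope complex_scope.

(** Complex differentiability at every point, with all estimates between real moduli. *)
Definition cdiff (H : R[i] -> R[i]) := forall p, exists D, forall e : R, 0 < e ->
  exists2 r : R, 0 < r & forall w, nm (w - p) <= r ->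
    nm (H w - H p - D * (w - p)) <= e * nm (w - p).

Lemma cdiff_continuous H p : cdiff H -> forall e : R, 0 < e ->
  exists2 r : R, 0 < r & forall w, nm (w - p) <= r -> nm (H w - H p) <= e.
Proof.
move=> dH e e0; have [D /(_ 1 ltr01)[r r0 Hr]] := dH p.
have K0 : 0 < nm D + 1 by rewrite ltr_wpDl ?nm_ge0.
exists (Num.min r (e / (nm D + 1))) => [|w]; first by rewrite lt_min r0 divr_gt0.
rewrite le_min => /andP[/Hr]; rewrite mul1r => H1.
rewrite ler_pdivlMr// => H2.
rewrite -(subrK (D * (w - p)) (H w - H p)).
apply: le_trans (nmD _ _) _; rewrite nmM; nra.
Qed.

Lemma cdiff_lipschitz H p : cdiff H -> exists K : R, 0 <= K /\
  exists2 r : R, 0 < r & forall w, nm (w - p) <= r -> nm (H w - H p) <= K * nm (w - p).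
Proof.
move=> dH; have [D /(_ 1 ltr01)[r r0 Hr]] := dH p.
exists (nm D + 1); split; first by rewrite addr_ge0 ?nm_ge0.
exists r => // w /Hr H1.
rewrite -(subrK (D * (w - p)) (H w - H p)).
apply: le_trans (nmD _ _) _; rewrite nmM; lra.
Qed.

Lemma cdiff_comp H G : cdiff H -> cdiff G -> cdiff (H \o G).
Proof.
move=> dH dG p; have [DG HG] := dG p; have [DH HH] := dH (G p).
have [K [K0 [r1 r10 HK]]] := cdiff_lipschitz p dG.
exists (DH * DG) => e e0.
have a0 : 0 < e / 2 / (K + 1) by rewrite !divr_gt0// ltr_wpDl.
have b0 : 0 < e / 2 / (nm DH + 1) by rewrite !divr_gt0// ltr_wpDl ?nm_ge0.
have [r2 r20 {}HH] := HH _ a0; have [r3 r30 {}HG] := HG _ b0.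
exists (Num.min r1 (Num.min r3 (r2 / (K + 1)))) => [|w].
  by rewrite !lt_min r10 r30 divr_gt0// ltr_wpDl.
rewrite !le_min => /and3P[/HK Hw1 /HG Hw3].
rewrite ler_pdivlMr ?ltr_wpDl// => Hw2 /=.
have n0 := nm_ge0 (w - p).
have {}HH := HH (G w) (le_trans Hw1 (le_trans (ltac:(nra) : K * nm (w - p) <= nm (w - p) * (K + 1)) Hw2)).
rewrite (_ : H (G w) - H (G p) - DH * DG * (w - p) =
  (H (G w) - H (G p) - DH * (G w - G p)) + DH * (G w - G p - DG * (w - p))); last by ring.
apply: le_trans (nmD _ _) _; rewrite nmM (splitr e) mulrDl; apply: lerD.
  apply: le_trans HH _.
  rewrite -{2}(@mulfVK _ (K + 1) _ (e / 2)) ?gt_eqF ?ltr_wpDl// -[leRHS]mulrA.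
  by apply: ler_wpM2l; [exact: ltW|nra].
apply: le_trans (ler_wpM2l (nm_ge0 _) Hw3) _.
rewrite mulrA ler_wpM2r// mulrCA ler_piMr ?divr_ge0 ?(ltW e0)//.
by rewrite ler_pdivrMr ?ltr_wpDl ?nm_ge0// mul1r lerDl.
Qed.

Lemma cdiffM H G : cdiff H -> cdiff G -> cdiff (fun w => H w * G w).
Proof.
move=> dH dG p; have [DG HG] := dG p; have [DH HH] := dH p.
have [K [K0 [r1 r10 HK]]] := cdiff_lipschitz p dH.
exists (DH * G p + H p * DG) => e e0.
(* A single constant that dominates the coefficients of the three error terms; each term is then at
   most e / 3 times |w - p|. *)
pose A := 1 + nm (H p) + nm (G p) + K * (nm DG + 1).
have A0 : 0 < A.
  rewrite /A -!addrA ltr_pwDl// !addr_ge0 ?nm_ge0// mulr_ge0// addr_ge0 ?nm_ge0//.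
have b0 : 0 < e / 3 / A by rewrite !divr_gt0.
have [r2 r20 {}HH] := HH _ b0; have [r3 r30 {}HG] := HG _ b0.
have [r4 r40 {}HC] := cdiff_continuous p dG b0.
exists (Num.min (Num.min r1 r4) (Num.min r2 r3)) => [|w].
  by rewrite !lt_min r10 r20 r30 r40.
rewrite !le_min => /andP[/andP[/HK H1 /HC H4] /andP[/HH H2 /HG H3]].
set d := e / 3 / A in H2 H3 H4 b0.
have dA : d * A = e / 3 by rewrite mulfVK// gt_eqF.
rewrite [X in nm X](_ : _ = (H w - H p - DH * (w - p)) * G p + H p * (G w - G p - DG * (w - p))
  + (H w - H p) * (G w - G p)); last by ring.
apply: le_trans (nmD _ _) _; rewrite nmM.
apply: le_trans (lerD (nmD _ _) (lexx _)) _; rewrite !nmM.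
have n0 := nm_ge0 (w - p); have n1 := nm_ge0 (H p); have n2 := nm_ge0 (G p).
have n3 := nm_ge0 DG; have n4 := nm_ge0 (G w - G p).
have -> : e * nm (w - p) = d * A * nm (w - p) * 3 by rewrite dA; field.
have KD : 0 <= K * nm DG by rewrite mulr_ge0.
have Ag : nm (G p) <= A by rewrite /A; lra.
have Ah : nm (H p) <= A by rewrite /A; lra.
have AK : K <= A by rewrite /A; lra.
have dm : 0 <= d * nm (w - p) by rewrite mulr_ge0// ltW.
have T1 : nm (H w - H p - DH * (w - p)) * nm (G p) <= d * A * nm (w - p).
  apply: le_trans (ler_wpM2r n2 H2) _.
  by rewrite [leRHS]mulrAC; apply: ler_wpM2l.
have T2 : nm (H p) * nm (G w - G p - DG * (w - p)) <= d * A * nm (w - p).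
  apply: le_trans (ler_wpM2l n1 H3) _.
  by rewrite [leRHS]mulrAC mulrC; apply: ler_wpM2l.
have T3 : nm (H w - H p) * nm (G w - G p) <= d * A * nm (w - p).
  apply: le_trans (ler_wpM2r n4 H1) _.
  apply: le_trans (ler_wpM2l _ H4) _; first by rewrite mulr_ge0.
  rewrite (_ : K * nm (w - p) * d = d * nm (w - p) * K); last by ring.
  by rewrite [leRHS]mulrAC; apply: ler_wpM2l.
lra.
Qed.

Lemma cdiff_affine (a b : R[i]) : cdiff (fun w => a * w + b).
Proof.
move=> p; exists a => e e0; exists 1 => // w _.
rewrite [X in nm X](_ : _ = 0); last by ring.
by rewrite nm0 mulr_ge0 ?nm_ge0 ?ltW.
Qed.

Lemma cdiff_cexp : cdiff (@cexp R).
Proof.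
move=> p; exists (cexp p) => e e0.
pose K := nm (cexp p) * (2 * expR 1) + 1.
have K0 : 0 < K by rewrite ltr_wpDl// !mulr_ge0 ?nm_ge0 ?expR_ge0.
exists (Num.min 1 (e / K)) => [|w]; first by rewrite lt_min ltr01 divr_gt0.
rewrite le_min => /andP[w1]; rewrite ler_pdivlMr// => we.
have n0 := nm_ge0 (w - p).
rewrite [X in nm X](_ : _ = cexp p * (cexp (w - p) - 1 - (w - p))); last first.
  by rewrite -{1}(subrK p w) cexpD; ring.
rewrite nmM; apply: le_trans (ler_wpM2l (nm_ge0 _) (expc_taylor2 _)) _.
have E1 : expR (nm (w - p)) <= expR 1 by rewrite ler_expR.
have N := nm_ge0 (cexp p).
apply: (@le_trans _ _ (nm (cexp p) * (2 * nm (w - p) ^+ 2 * expR 1))).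
  by apply: ler_wpM2l => //; apply: ler_wpM2l => //; rewrite mulr_ge0// sqr_ge0.
rewrite (_ : nm (cexp p) * _ = (K - 1) * nm (w - p) * nm (w - p)); last by rewrite /K; ring.
by apply: ler_wpM2r => //; apply: le_trans we; rewrite mulrC ler_wpM2l// lerBlDr lerDl.
Qed.

Lemma cdiff_scale_cexp H w : cdiff H -> cdiff (fun s => H (cexp s * w)).
Proof.
move=> dH; rewrite (_ : (fun s => _) = (H \o (fun u => w * u + 0)) \o @cexp R).
  by apply: cdiff_comp _ cdiff_cexp; apply: cdiff_comp dH (cdiff_affine _ _).
by apply/funext => s /=; rewrite addr0 mulrC.
Qed.

End complex_differentiable.

Section circle_mean.
Variable R : realType.
Local Open Scope complex_scope.
Notation leb := (@lebesgue_measure R).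

(** The form Im G dx + Re G dy is the imaginary part of G dz. The common value b = Re D is one of
    the Cauchy-Riemann equations. *)
Let cdiff_closed_form (G : R[i] -> R[i]) : cdiff G -> forall x0 y0 : R, exists a b d : R,
  forall e : R, 0 < e -> exists2 r : R, 0 < r & forall x y, `|x - x0| <= r -> `|y - y0| <= r ->
    `|Im (G (x +i* y)) - Im (G (x0 +i* y0)) - a * (x - x0) - b * (y - y0)|
      <= e * (`|x - x0| + `|y - y0|) /\
    `|Re (G (x +i* y)) - Re (G (x0 +i* y0)) - b * (x - x0) - d * (y - y0)|
      <= e * (`|x - x0| + `|y - y0|).
Proof.
move=> dG x0 y0; have [D HD] := dG (x0 +i* y0).
exists (Im D), (Re D), (- Im D) => e e0; have [r r0 {}HD] := HD _ e0.
exists (r / 2) => [|x y xr yr]; first by rewrite divr_gt0.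
have nl : nm (x +i* y - x0 +i* y0) <= `|x - x0| + `|y - y0| by exact: nm_le.
have sr : `|x - x0| + `|y - y0| <= r by rewrite (splitr r) lerD.
have {}HD := HD (x +i* y) (le_trans nl sr).
have {}HD := le_trans HD (ler_wpM2l (ltW e0) nl).
split.
  apply: le_trans HD; apply: le_trans (Im_le_nm _); rewrite !ReImE.
  by rewrite le_eqVlt; apply/orP; left; apply/eqP; congr `|_|; ring.
apply: le_trans HD; apply: le_trans (Re_le_nm _); rewrite !ReImE.
by rewrite le_eqVlt; apply/orP; left; apply/eqP; congr `|_|; ring.
Qed.

Lemma circle_continuous (H : R[i] -> R[i]) (w : R[i]) : cdiff H ->
  continuous (fun t : R => Re (H (cexp (0 +i* t) * w))).
Proof.
move=> dH; pose G s := H (cexp s * w).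
have dG : cdiff G := cdiff_scale_cexp w dH.
exact: (closed_form_continuousr (cdiff_closed_form dG)).
Qed.

(** The circulation around [x, x + h] * [0, T] vanishes, and by [per] the two horizontal sides
    cancel, so the vertical sides carry equal integrals. *)
Let periodic_integral (G : R[i] -> R[i]) (T : R) : cdiff G -> 0 <= T ->
  (forall t : R, Im (G (t +i* T)) = Im (G (t +i* 0))) ->
  forall x h : R, 0 <= h ->
  \int[leb]_(t in `[0, T]) Re (G ((x + h) +i* t)) =
  \int[leb]_(t in `[0, T]) Re (G (x +i* t)).
Proof.
move=> dG T0 per x h h0; have CF := cdiff_closed_form dG.
have cont y := closed_form_continuousr CF y.
have xh : x <= x + h by rewrite lerDl.
have := circulation_eq0 CF x 0 h0 T0; rewrite /circulation add0r.
under eq_Rintegral do rewrite per subrr.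
rewrite (Rintegral_itv_cst 0 xh) mul0r add0r RintegralB; first last.
- exact: continuous_integrable_itv (cont x).
- exact: continuous_integrable_itv (cont (x + h)).
- exact: measurable_itv.
by move/eqP; rewrite subr_eq0 => /eqP.
Qed.

(* In the coordinate [s], with [e^s w] in the plane, circles become vertical segments: the
   integral does not depend on the abscissa, which is then sent to minus infinity. *)
Lemma circle_mean_value (H : R[i] -> R[i]) (w : R[i]) : cdiff H ->
  \int[leb]_(t in `[0, 2 * pi]) Re (H (cexp (0 +i* t) * w)) = 2 * pi * Re (H 0).
Proof.
move=> dH; pose G s := H (cexp s * w).
have dG : cdiff G := cdiff_scale_cexp w dH.
have cont x := closed_form_continuousr (cdiff_closed_form dG) x.
have per (t : R) : Im (G (t +i* (2 * pi))) = Im (G (t +i* 0)).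
  by rewrite /G !cexpE !ReImE sin0 cos0 mulr_natl sin2pi cos2pi.
have : 0 <= 2 * pi :> R by rewrite mulr_ge0// pi_ge0.
move: (2 * pi) per => T per T0.
pose J (x : R) := \int[leb]_(t in `[0, T]) Re (G (x +i* t)).
have JE (x h : R) : 0 <= h -> J (x + h) = J x := @periodic_integral G T dG T0 per x h.
have J0 n : J 0 = J (- n%:R).
  by have := JE (- n%:R) n%:R (ler0n _ _); rewrite addNr.
rewrite -[LHS]/(J 0); apply/eqP; rewrite -subr_eq0 -normr_le0.
apply/ler_addgt0Pl => e e0; rewrite addr0.
have [|r r0 Hr] := cdiff_continuous 0 dH (e := e / (T + 1)).
  by rewrite divr_gt0// ltr_wpDl.
(* At abscissa -n the circle has radius e^(-n)|w|. The bound 1 + n <= e^n suffices to bring it below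
   r. *)
have [n hn] : exists n : nat, expR (- n%:R) * nm w <= r.
  exists (Num.bound (nm w / r)).
  have b0 : 0 <= nm w / r by rewrite divr_ge0 ?nm_ge0// ltW.
  have := archi_boundP b0; set m := Num.bound _ => hm.
  rewrite expRN mulrC ler_pdivrMr ?expR_gt0//.
  have : 1 + m%:R <= expR m%:R :> R by exact: expR_ge1Dx.
  by rewrite ltr_pdivrMr// in hm; nra.
have K0 : 0 < T + 1 by rewrite ltr_wpDl.
have cc : continuous (fun t : R => Re (G ((- n%:R) +i* t)) - Re (H 0)).
  by move=> t; apply: cvgB; [exact: cont|exact: cvg_cst].
have -> : J 0 - T * Re (H 0) =
    \int[leb]_(t in `[0, T]) (Re (G ((- n%:R) +i* t)) - Re (H 0)).
  rewrite (J0 n) RintegralB; first last.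
  - by apply: continuous_integrable_itv => t; exact: cvg_cst.
  - exact: continuous_integrable_itv (cont _).
  - exact: measurable_itv.
  by rewrite (Rintegral_itv_cst _ T0) subr0 mulrC.
apply: le_trans (normr_Rintegral_itv_le (M := e / (T + 1)) cc T0 _) _.
  move=> t _; rewrite -ReN -ReD; apply: le_trans (Re_le_nm _) _; apply: Hr.
  by rewrite subr0 nmM nm_cexp.
by rewrite subr0 mulrAC ler_pdivrMr// ler_pM2l// lerDl.
Qed.

End circle_mean.

(** * Measure-preserving maps and Gaussian averages *)

Section sigma_finite_product.
Context d1 d2 (T1 : measurableType d1) (T2 : measurableType d2) (R : realType).
Variable m1 : {sigma_finite_measure set T1 -> \bar R}.
Variable m2 : {sigma_finite_measure set T2 -> \bar R}.

Lemma product_sigma_finite : sigma_finite setT (m1 \x m2)%E.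
Proof.
have /sigma_finiteP[F [TF ndF Foo]] := sigma_finiteT m1.
have /sigma_finiteP[G [TG ndG Goo]] := sigma_finiteT m2.
exists (fun n => F n `*` G n) => [|n].
  rewrite eqEsubset; split=> // -[x y] _.
  have [i _ Fx] : (\bigcup_i F i) x by rewrite -TF.
  have [j _ Gy] : (\bigcup_i G i) y by rewrite -TG.
  exists (maxn i j) => //; split=> /=.
    by move: x Fx; exact/subsetPset/ndF/leq_maxl.
  by move: y Gy; exact/subsetPset/ndG/leq_maxr.
have [mF Fn] := Foo n; have [mG Gn] := Goo n.
split; first exact: measurableX.
by rewrite product_measure1E// lte_mul_pinfty// ge0_fin_numE.
Qed.

Let sigma_finite_mixin :=
  Measure_isSigmaFinite.Build _ _ _ (m1 \x m2)%E product_sigma_finite.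

(* The library's canonical sigma-finite structure on [m1 \x m2] is keyed on
   subprobabilities only. *)
Definition sf_product : {sigma_finite_measure set (T1 * T2)%type -> \bar R} :=
  HB.pack (m1 \x m2)%E sigma_finite_mixin.

End sigma_finite_product.

Section real_fubini.
Context d1 d2 (T1 : measurableType d1) (T2 : measurableType d2) (R : realType).
Variable m1 : {sigma_finite_measure set T1 -> \bar R}.
Variable m2 : {sigma_finite_measure set T2 -> \bar R}.
Variable f : T1 * T2 -> R.
Hypothesis intf : (m1 \x m2)%E.-integrable setT (EFin \o f).

(** Every section is assumed integrable, not only almost every one, so that [fine] loses nothing and
    the real iterated integral is the extended one at each point. *)
Let fubini_FE : (forall x, m2.-integrable setT (fun y => (f (x, y))%:E)) ->
  fubini_F m2 (EFin \o f) = EFin \o (fun x => \int[m2]_y f (x, y)).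
Proof.
by move=> i2; apply/funext => x; rewrite /= /Rintegral fineK//; exact: integrable_fin_num.
Qed.

Let fubini_GE : (forall y, m1.-integrable setT (fun x => (f (x, y))%:E)) ->
  fubini_G m1 (EFin \o f) = EFin \o (fun y => \int[m1]_x f (x, y)).
Proof.
by move=> i1; apply/funext => y; rewrite /= /Rintegral fineK//; exact: integrable_fin_num.
Qed.

Lemma integrable_Rfubini1 : (forall x, m2.-integrable setT (fun y => (f (x, y))%:E)) ->
  m1.-integrable setT (EFin \o (fun x => \int[m2]_y f (x, y))).
Proof. by move=> /fubini_FE <-; exact: integrable_fubini_F. Qed.

Lemma Rfubini1 : (forall x, m2.-integrable setT (fun y => (f (x, y))%:E)) ->
  \int[(m1 \x m2)%E]_z f z = \int[m1]_x \int[m2]_y f (x, y).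
Proof.
by move=> i2; rewrite /Rintegral -integral12_prod_meas1// fubini_FE.
Qed.

Lemma Rfubini2 : (forall y, m1.-integrable setT (fun x => (f (x, y))%:E)) ->
  \int[(m1 \x m2)%E]_z f z = \int[m2]_y \int[m1]_x f (x, y).
Proof.
by move=> i1; rewrite /Rintegral -integral21_prod_meas1// fubini_GE.
Qed.

End real_fubini.

Section measure_preserving.
Context d1 d2 (T1 : measurableType d1) (T2 : measurableType d2) (R : realType).
Variables (m1 : {measure set T1 -> \bar R}) (m2 : {measure set T2 -> \bar R}).

Definition preserves (phi : T1 -> T2) := measurable_fun setT phi /\
  forall A, measurable A -> m1 (phi @^-1` A) = m2 A.

Lemma ge0_integral_preserves (phi : T1 -> T2) (f : T2 -> \bar R) : preserves phi ->
  measurable_fun setT f -> (forall x, 0 <= f x)%E ->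
  (\int[m1]_x f (phi x) = \int[m2]_x f x)%E.
Proof.
move=> [mphi phiE] mf f0.
have := @ge0_integral_pushforward _ _ T1 T2 R phi mphi m1 setT f measurableT mf (fun y _ => f0 y).
rewrite preimage_setT => <-.
by apply: eq_measure_integral => A mA _; exact: phiE.
Qed.

Lemma integrable_preserves (phi : T1 -> T2) (f : T2 -> \bar R) : preserves phi ->
  m2.-integrable setT f -> m1.-integrable setT (fun x => f (phi x)).
Proof.
move=> pphi /integrableP[mf foo]; apply/integrableP; split.
  by apply: measurableT_comp => //; case: pphi.
rewrite (ge0_integral_preserves (f := fun x => `|f x|%E) pphi)//.
exact: measurableT_comp.
Qed.

Lemma integrable_of_preserves (phi : T1 -> T2) (f : T2 -> \bar R) : preserves phi ->
  measurable_fun setT f -> m1.-integrable setT (fun x => f (phi x)) ->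
  m2.-integrable setT f.
Proof.
move=> pphi mf /integrableP[_ foo]; apply/integrableP; split => //.
rewrite -(ge0_integral_preserves (f := fun x => `|f x|%E) pphi)//.
exact: measurableT_comp.
Qed.

Lemma integral_preserves (phi : T1 -> T2) (f : T2 -> \bar R) : preserves phi ->
  measurable_fun setT f -> (\int[m1]_x f (phi x) = \int[m2]_x f x)%E.
Proof.
move=> pphi mf; rewrite [LHS]integralE [RHS]integralE; congr (_ - _)%E.
  rewrite -[RHS](ge0_integral_preserves pphi)//; last exact: measurable_funepos.
  by under eq_integral do rewrite (funepos_comp f).
rewrite -[RHS](ge0_integral_preserves pphi)//; last exact: measurable_funeneg.
by under eq_integral do rewrite (funeneg_comp f).
Qed.

Lemma Rintegral_preserves (phi : T1 -> T2) (f : T2 -> R) : preserves phi ->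
  measurable_fun setT f -> \int[m1]_x f (phi x) = \int[m2]_x f x.
Proof.
move=> pphi mf; congr fine.
apply: (integral_preserves (f := EFin \o f)) => //.
exact/measurable_EFinP.
Qed.

End measure_preserving.

Lemma preserves_comp d1 d2 d3 (T1 : measurableType d1) (T2 : measurableType d2)
  (T3 : measurableType d3) (R : realType) (m1 : {measure set T1 -> \bar R})
  (m2 : {measure set T2 -> \bar R}) (m3 : {measure set T3 -> \bar R})
  (phi : T2 -> T3) (psi : T1 -> T2) :
  preserves m2 m3 phi -> preserves m1 m2 psi -> preserves m1 m3 (phi \o psi).
Proof.
move=> [mphi phiE] [mpsi psiE]; split; first exact: measurableT_comp.
move=> A mA; rewrite comp_preimage psiE ?phiE// -[X in measurable X]setTI.
exact: mphi.
Qed.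

Section plane.
Variable R : realType.
Notation leb := (@lebesgue_measure R).
Notation RT := (measurableTypeR R).
Notation leb2 := (leb \x leb)%E.

Lemma translation_preserves (a : R) : preserves leb leb (fun x : RT => (x + a : RT)).
Proof.
have mT : measurable_fun setT (fun x : RT => (x + a : RT)) by exact: measurable_funD.
split=> // A mA.
rewrite -[LHS]/(pushforward leb (fun x : RT => (x + a : RT)) A).
apply/esym/lebesgue_measure_unique => //= _ [[b c]] _ <-.
rewrite /pushforward (_ : _ @^-1` _ = `]b - a, c - a]%classic); last first.
  by apply/seteqP; split => x /=; rewrite !in_itv/= ltrBlDr lerBrDr.
rewrite !lebesgue_measure_itv/= !lte_fin ltrD2r; case: ifPn => // _.
by rewrite -!EFinB; congr EFin; ring.
Qed.

(** The product measure is defined through x-sections; maps that move the first coordinate are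
    handled on y-sections. *)
Let leb2E (B : set (RT * RT)) : measurable B ->
  leb2 B = (\int[leb]_y leb (ysection B y))%E.
Proof.
move=> mB; rewrite -[RHS]/((leb \x^ leb)%E B).
by apply: product_measure_unique => // X Y mX mY /=; rewrite product_measure2E.
Qed.

Let shear_measurable (a : R) :
  measurable_fun setT (fun p : RT * RT => (p.1 + a * p.2 : RT, p.2)).
Proof.
apply: measurable_fun_pair => //.
by apply: measurable_funD => //; apply: measurable_funM.
Qed.

Lemma shearl_preserves (a : R) :
  preserves leb2 leb2 (fun p : RT * RT => (p.1 + a * p.2 : RT, p.2)).
Proof.
split=> [|A mA]; first exact: shear_measurable.
have mB : measurable ((fun p : RT * RT => (p.1 + a * p.2 : RT, p.2)) @^-1` A).
  by rewrite -[X in measurable X]setTI; exact: shear_measurable.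
apply: etrans (leb2E mB) _; apply: etrans _ (esym (leb2E mA)).
apply: eq_integral => y _.
rewrite -[RHS]((translation_preserves (a * y)).2 _ (measurable_ysection _ mA)).
by congr (leb _); apply/seteqP; split=> x /=; rewrite !ysectionP.
Qed.

Lemma shearr_preserves (a : R) :
  preserves leb2 leb2 (fun p : RT * RT => (p.1, p.2 + a * p.1 : RT)).
Proof.
have mT : measurable_fun setT (fun p : RT * RT => (p.1, p.2 + a * p.1 : RT)).
  apply: measurable_fun_pair => //.
  by apply: measurable_funD => //; apply: measurable_funM.
split=> // A mA.
apply: eq_integral => x _ /=.
rewrite -[RHS]((translation_preserves (a * x)).2 _ (measurable_xsection _ mA)).
by congr (leb _); apply/seteqP; split=> y /=; rewrite !xsectionP.
Qed.

Lemma translation2_preserves (a b : R) :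
  preserves leb2 leb2 (fun p : RT * RT => (p.1 + a : RT, p.2 + b : RT)).
Proof.
have mT : measurable_fun setT (fun p : RT * RT => (p.1 + a : RT, p.2 + b : RT)).
  by apply: measurable_fun_pair => //; exact: measurable_funD.
split=> // A mA.
have m2 : measurable_fun setT (fun p : RT * RT => (p.1, p.2 + b : RT)).
  by apply: measurable_fun_pair => //; exact: measurable_funD.
have m1 : measurable_fun setT (fun p : RT * RT => (p.1 + a : RT, p.2)).
  by apply: measurable_fun_pair => //; exact: measurable_funD.
have mA1 : measurable ((fun p : RT * RT => (p.1 + a : RT, p.2)) @^-1` A).
  by rewrite -[X in measurable X]setTI; exact: m1.
transitivity (leb2 ((fun p : RT * RT => (p.1 + a : RT, p.2)) @^-1` A)).
  apply: eq_integral => x _ /=.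
  rewrite -[RHS]((translation_preserves b).2 _ (measurable_xsection _ mA1)).
  by congr (leb _); apply/seteqP; split=> y /=; rewrite !xsectionP.
apply: etrans (leb2E mA1) _; apply: etrans _ (esym (leb2E mA)).
apply: eq_integral => y _.
rewrite -[RHS]((translation_preserves a).2 _ (measurable_ysection _ mA)).
by congr (leb _); apply/seteqP; split=> x /=; rewrite !ysectionP.
Qed.

(** For s <> 0 a rotation is a product of three shears, the outer two with coefficient (c - 1) / s,
    minus the tangent of the half angle. For s = 0 it is a product of two quarter turns, to which
    the first case applies. *)
Lemma rotation_preserves (c s : R) : c ^+ 2 + s ^+ 2 = 1 ->
  preserves leb2 leb2 (fun p : RT * RT => (c * p.1 - s * p.2 : RT, s * p.1 + c * p.2 : RT)).
Proof.
have H (c' s' : R) : s' != 0 -> c' ^+ 2 + s' ^+ 2 = 1 ->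
    preserves leb2 leb2 (fun p : RT * RT => (c' * p.1 - s' * p.2 : RT, s' * p.1 + c' * p.2 : RT)).
  move=> s0 cs.
  pose q := (c' - 1) / s'.
  have qs : q * s' = c' - 1 by rewrite /q mulfVK.
  have := preserves_comp (shearl_preserves q)
    (preserves_comp (shearr_preserves s') (shearl_preserves q)).
  congr preserves; apply/funext => -[x y] /=; congr pair.
    rewrite (_ : x + _ + _ = x + q * s' * x + q * (2 + q * s') * y); last by ring.
    rewrite qs; congr (_ + _); first by ring.
    rewrite -mulNr; congr (_ * _); apply: (mulIf s0).
    rewrite mulrAC qs; lra.
  by rewrite (_ : y + _ = s' * x + (1 + q * s') * y); [rewrite qs; ring|ring].
have [->|s0] := eqVneq s 0; last exact: H.
rewrite expr0n/= addr0 => c2.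
have c0 : - c != 0.
  by rewrite oppr_eq0; apply/eqP => c0; move: c2; rewrite c0 expr0n/= => /eqP; rewrite eq_sym oner_eq0.
have := preserves_comp (H 0 1 (oner_neq0 _) _) (H 0 (- c) c0 _).
rewrite expr1n expr0n/= add0r sqrrN add0r => /(_ erefl c2).
congr preserves; apply/funext => -[x y] /=.
by congr pair; ring.
Qed.

Lemma integrable_gauss2 :
  leb2.-integrable setT (fun p => (expR (- (p.1 ^+ 2 + p.2 ^+ 2)))%:E) /\
  \int[leb2]_p expR (- (p.1 ^+ 2 + p.2 ^+ 2)) = pi :> R.
Proof.
have mg : measurable_fun setT (fun p : RT * RT => (expR (- (p.1 ^+ 2 + p.2 ^+ 2)))%:E).
  apply/measurable_EFinP; apply: measurableT_comp => //; apply: measurableT_comp => //.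
  by apply: measurable_funD; apply: measurable_funX.
have gi : (\int[leb]_y (expR (- y ^+ 2))%:E = (Num.sqrt pi : R)%:E)%E := integralT_gauss.
have E : (\int[leb2]_p (expR (- (p.1 ^+ 2 + p.2 ^+ 2)))%:E = (pi : R)%:E)%E.
  rewrite fubini_tonelli1//.
  rewrite /fubini_F/=.
  have H (x : R) : (\int[leb]_y (expR (- (x ^+ 2 + y ^+ 2)))%:E =
      (Num.sqrt pi * expR (- x ^+ 2))%:E)%E.
    under eq_integral do rewrite opprD expRD EFinM.
    rewrite ge0_integralZl//.
    - by rewrite gi -EFinM mulrC.
    - by apply/measurable_EFinP; exact: measurable_gauss_fun.

  under eq_integral do rewrite H EFinM.
  rewrite ge0_integralZl//.
  - by rewrite gi -EFinM -expr2 sqr_sqrtr ?pi_ge0.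
  - by apply/measurable_EFinP; exact: measurable_gauss_fun.
split; last by rewrite /Rintegral E.
apply/integrableP; split => //.
under eq_integral do rewrite gee0_abs ?lee_fin ?expR_ge0//.
by rewrite E ltry.
Qed.

End plane.

Section averaging.
Context d (T : measurableType d) (R : realType).
Variable m : {sigma_finite_measure set T -> \bar R}.
Notation leb := (@lebesgue_measure R).
Notation RT := (measurableTypeR R).
Variables (rot : RT -> T -> T) (F : T -> R) (a : R).
Hypothesis a0 : 0 <= a.
Hypothesis mrot : measurable_fun setT (fun q : RT * T => rot q.1 q.2).
Hypothesis prot : forall t, preserves m m (rot t).
Hypothesis intF : m.-integrable setT (EFin \o F).
Hypothesis intFr : forall p, leb.-integrable `[0, a] (fun t => (F (rot t p))%:E).

Let I : set RT := `[0, a]%classic.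
Let mI : measurable I. Proof. exact: measurable_itv. Qed.
Let lebI : leb I = a%:E.
Proof.
apply: etrans (@lebesgue_measure_itv R `[0, a]) _; rewrite /= lte_fin oppr0 adde0.
by case: ltgtP a0 => //= <-.
Qed.

Let G (q : RT * T) : R := \1_I q.1 * F (rot q.1 q.2).

Let mF : measurable_fun setT F.
Proof. by apply/measurable_EFinP; exact: measurable_int intF. Qed.

Let mG : measurable_fun setT G.
Proof.
apply: measurable_funM; last exact: measurableT_comp mF mrot.
by apply: measurableT_comp (measurable_indic mI) _.
Qed.

Let intGp t : m.-integrable setT (fun p => (G (t, p))%:E).
Proof.
apply: (eq_integrable measurableT (fun p => (\1_I t)%:E * (F (rot t p))%:E)%E) => //.
by apply: integrableZl => //; exact: (integrable_preserves (prot t) intF).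
Qed.

Let Gt_patch p : (fun t : RT => (G (t, p))%:E) = (fun t => (F (rot t p))%:E) \_ I.
Proof. by apply/funext => t; rewrite epatch_indic /G/= EFinM muleC. Qed.

Let intGt p : leb.-integrable setT (fun t => (G (t, p))%:E).
Proof. by rewrite Gt_patch -integrable_mkcond. Qed.

Let intG : (leb \x m)%E.-integrable setT (EFin \o G).
Proof.
apply/integrable12ltyP; first exact/measurable_EFinP.
have E (t : RT) : (\int[m]_p `|(EFin \o G) (t, p)| = \int[m]_p `|(F p)%:E| * (\1_I t)%:E)%E.
  rewrite muleC -ge0_integralZl//; last first.
    by apply: measurableT_comp => //; exact/measurable_EFinP.
  rewrite -(ge0_integral_preserves (prot t)); first last.
  - by move=> x; rewrite mule_ge0// lee_fin.
  - by apply: measurable_funeM; apply: measurableT_comp => //; exact/measurable_EFinP.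
  apply: eq_integral => p _; rewrite /= -EFinM normrM; congr (_ * _)%:E.
  by rewrite ger0_norm.
under eq_integral do rewrite E.
rewrite ge0_integralZl//; first last.
- by apply: integral_ge0.
- by apply/measurable_EFinP; exact: measurable_indic.
rewrite integral_indic// setIT lte_mul_pinfty//.
- by apply: integral_ge0.
- by have /integrableP[_] := intF; rewrite ge0_fin_numE// integral_ge0.
by apply: le_lt_trans (ltry a); rewrite -lebI.
Qed.

(** Fubini for \1_I(t) F(rot t p) on the product: for fixed t, invariance makes the integral over p
    that of F. *)
Lemma average_integral :
  a * \int[m]_p F p = \int[m]_p \int[leb]_(t in `[0, a]) F (rot t p).
Proof.
have := Rfubini2 intG intGt; rewrite (Rfubini1 intG intGp).
rewrite (_ : \int[leb]_x _ = a * \int[m]_p F p) => [->|].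
  apply: eq_Rintegral => p _; rewrite [RHS]Rintegral_mkcond; apply: eq_Rintegral => t _.
  by rewrite patch_indic /G mulrC.
under eq_Rintegral.
  move=> t _; rewrite (_ : \int[m]_y _ = \1_I t * \int[m]_p F p); first over.
  rewrite /G/= RintegralZl//; last exact: (integrable_preserves (prot t) intF).
  by rewrite (Rintegral_preserves (prot t)).
rewrite RintegralZr//; last exact: integrable_indic_itv.
by congr (_ * _); rewrite /Rintegral integral_indic// setIT; exact: (congr1 fine lebI).
Qed.

End averaging.

Section gauss_mean_value.
Variable R : realType.
Local Open Scope complex_scope.
Notation leb := (@lebesgue_measure R).
Notation RT := (measurableTypeR R).
Notation leb2 := (leb \x leb)%E.

Let rot (t : R) (p : RT * RT) : RT * RT :=
  (cos t * p.1 - sin t * p.2 : RT, sin t * p.1 + cos t * p.2 : RT).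

Let rotE t p : (rot t p).1 +i* (rot t p).2 = cexp (0 +i* t) * (p.1 +i* p.2).
Proof.
rewrite cexpE; apply: complex_eqP; rewrite !ReImE expR0 !mul1r//.
by rewrite addrC.
Qed.

Let rot_preserves t : preserves leb2 leb2 (rot t).
Proof. by apply: rotation_preserves; rewrite cos2Dsin2. Qed.

Let rot_norm t p : (rot t p).1 ^+ 2 + (rot t p).2 ^+ 2 = p.1 ^+ 2 + p.2 ^+ 2 :> R.
Proof.
rewrite /rot/= -[RHS]mul1r -(cos2Dsin2 t); ring.
Qed.

(* Averaging over all rotations replaces polar coordinates. *)
Lemma gauss_mean_value (H : R[i] -> R[i]) : cdiff H ->
  measurable_fun setT (fun p : RT * RT => Re (H (p.1 +i* p.2))) ->
  leb2.-integrable setT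
    (fun p => (Re (H (p.1 +i* p.2)) * expR (- (p.1 ^+ 2 + p.2 ^+ 2)))%:E) ->
  \int[leb2]_p (Re (H (p.1 +i* p.2)) * expR (- (p.1 ^+ 2 + p.2 ^+ 2))) = pi * Re (H 0).
Proof.
move=> dH mH iH.
pose F (p : RT * RT) := Re (H (p.1 +i* p.2)) * expR (- (p.1 ^+ 2 + p.2 ^+ 2)).
have mg : measurable_fun setT (fun p : RT * RT => expR (- (p.1 ^+ 2 + p.2 ^+ 2)) : R).
  apply: measurableT_comp => //; apply: measurableT_comp => //.
  by apply: measurable_funD; apply: measurable_funX.
have mF : measurable_fun setT F by exact: measurable_funM.
have mrot : measurable_fun setT (fun q : RT * (RT * RT) => rot q.1 q.2).
  have mc : measurable_fun setT (fun q : RT * (RT * RT) => cos q.1 : R).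
    by apply: measurableT_comp => //; apply: continuous_measurable_fun; exact: continuous_cos.
  have ms : measurable_fun setT (fun q : RT * (RT * RT) => sin q.1 : R).
    by apply: measurableT_comp => //; apply: continuous_measurable_fun; exact: continuous_sin.
  have m1 : measurable_fun setT (fun q : RT * (RT * RT) => q.2.1).
    by apply: measurableT_comp => //.
  have m2 : measurable_fun setT (fun q : RT * (RT * RT) => q.2.2).
    by apply: measurableT_comp => //; exact: measurable_snd.
  apply: measurable_fun_pair.
    by apply: measurable_funB; apply: measurable_funM.
  by apply: measurable_funD; apply: measurable_funM.
have pi20 : 0 <= 2 * pi :> R by rewrite mulr_ge0// pi_ge0.
have FE t p : F (rot t p) = Re (H (cexp (0 +i* t) * (p.1 +i* p.2))) * expR (- (p.1 ^+ 2 + p.2 ^+ 2)).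
  by rewrite /F rot_norm rotE.
have iFr p : leb.-integrable `[0, 2 * pi] (fun t => (F (rot t p))%:E).
  pose g (t : R) := Re (H (cexp (0 +i* t) * (p.1 +i* p.2))) * expR (- (p.1 ^+ 2 + p.2 ^+ 2)).
  rewrite (_ : (fun t => _) = EFin \o g); last by apply/funext => t; rewrite FE.
  apply: (@continuous_integrable_itv R) => t; apply: cvgM; last exact: cvg_cst.
  exact: circle_continuous.
have := @average_integral _ (RT * RT)%type R (sf_product leb leb) rot F _ pi20 mrot
  rot_preserves iH iFr.
rewrite (_ : \int[leb2]_p \int[leb]_(t in `[0, (2 * pi)]) F (rot t p) =
   2 * pi * Re (H 0) * pi).
  move=> E; have p0 : 2 * pi != 0 :> R by rewrite gt_eqF// mulr_gt0// pi_gt0.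
  by apply: (mulfI p0); apply: etrans E _; ring.
(* The Gaussian weight is constant on each circle, so only the mean of Re H is left. *)
have EF p : \int[leb]_(t in `[0, (2 * pi)]) F (rot t p) =
    2 * pi * Re (H 0) * expR (- (p.1 ^+ 2 + p.2 ^+ 2)).
  rewrite -(circle_mean_value (p.1 +i* p.2) dH) -RintegralZr.
  - by apply: eq_Rintegral => t _; rewrite FE.
  - exact: measurable_itv.
  - by apply: (@continuous_integrable_itv R); exact: circle_continuous.
transitivity (\int[leb2]_p (2 * pi * Re (H 0) * expR (- (p.1 ^+ 2 + p.2 ^+ 2)))).
  by apply: eq_Rintegral => p _; exact: EF.
have [ig Eg] := integrable_gauss2 R.
by rewrite (RintegralZl _ measurableT ig) Eg.
Qed.

End gauss_mean_value.

(** * Complex-valued integrals *)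

Section complex_measurable.
Context d (T : measurableType d) (R : realType).
Implicit Types (u v : T -> R[i]).
Local Open Scope complex_scope.

Lemma cmeasP u : measurable_fun setT u <->
  measurable_fun setT (fun x => Re (u x)) /\ measurable_fun setT (fun x => Im (u x)).
Proof.
split=> [mu|[mr mi]].
  have mreim : measurable_fun setT (@reim R).
    by move=> _ B mB; rewrite setTI; exists B => //; rewrite setTI.
  have mru : measurable_fun setT (@reim R \o u) by exact: measurableT_comp mreim mu.
  split; first exact: (measurableT_comp measurable_fst mru).
  exact: (measurableT_comp measurable_snd mru).
move=> _ _ [B mB <-]; rewrite setTI.
have mp := measurable_fun_pair mr mi.
have := mp measurableT B mB; rewrite setTI.
by rewrite setTI.
Qed.

Lemma cmeas_Re u : measurable_fun setT u -> measurable_fun setT (fun x => Re (u x)).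
Proof. by case/cmeasP. Qed.

Lemma cmeas_Im u : measurable_fun setT u -> measurable_fun setT (fun x => Im (u x)).
Proof. by case/cmeasP. Qed.

Lemma cmeas_cst (c : R[i]) : measurable_fun setT (fun _ : T => c).
Proof. by apply/cmeasP; split; exact: measurable_cst. Qed.

Lemma cmeasD u v : measurable_fun setT u -> measurable_fun setT v ->
  measurable_fun setT (fun x => u x + v x).
Proof.
move=> /cmeasP[ur ui] /cmeasP[vr vi]; apply/cmeasP; split.
  by under eq_fun do rewrite ReD; exact: measurable_funD.
by under eq_fun do rewrite ImD; exact: measurable_funD.
Qed.

Lemma cmeasM u v : measurable_fun setT u -> measurable_fun setT v ->
  measurable_fun setT (fun x => u x * v x).
Proof.
move=> /cmeasP[ur ui] /cmeasP[vr vi]; apply/cmeasP; split.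
  by under eq_fun do rewrite ReM; apply: measurable_funB; exact: measurable_funM.
by under eq_fun do rewrite ImM; apply: measurable_funD; exact: measurable_funM.
Qed.

Lemma cmeasN u : measurable_fun setT u -> measurable_fun setT (fun x => - u x).
Proof.
move=> mu; under eq_fun do rewrite -mulN1r.
by apply: cmeasM => //; exact: cmeas_cst.
Qed.

Lemma cmeasB u v : measurable_fun setT u -> measurable_fun setT v ->
  measurable_fun setT (fun x => u x - v x).
Proof. by move=> mu mv; apply: cmeasD => //; exact: cmeasN. Qed.

Lemma cmeas_sum (I : Type) (s : seq I) (F : I -> T -> R[i]) :
  (forall i, measurable_fun setT (F i)) ->
  measurable_fun setT (fun x => \sum_(i <- s) F i x).
Proof.
move=> mF; elim: s => [|i s IH].
  by under eq_fun do rewrite big_nil; exact: cmeas_cst.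
by under eq_fun do rewrite big_cons; exact: cmeasD.
Qed.

Lemma cmeas_prod (I : Type) (s : seq I) (F : I -> T -> R[i]) :
  (forall i, measurable_fun setT (F i)) ->
  measurable_fun setT (fun x => \prod_(i <- s) F i x).
Proof.
move=> mF; elim: s => [|i s IH].
  by under eq_fun do rewrite big_nil; exact: cmeas_cst.
by under eq_fun do rewrite big_cons; exact: cmeasM.
Qed.

Lemma cmeasX u n : measurable_fun setT u -> measurable_fun setT (fun x => u x ^+ n).
Proof.
move=> mu; elim: n => [|n IH]; first by under eq_fun do rewrite expr0; exact: cmeas_cst.
by under eq_fun do rewrite exprS; exact: cmeasM.
Qed.

Lemma cmeas_conj u : measurable_fun setT u -> measurable_fun setT (fun x => conjc (u x)).
Proof.
move=> /cmeasP[ur ui]; apply/cmeasP; split.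
  by under eq_fun do rewrite Re_conj.
by under eq_fun do rewrite Im_conj; exact: measurableT_comp.
Qed.

Lemma cmeas_real (r : T -> R) : measurable_fun setT r ->
  measurable_fun setT (fun x => (r x)%:C).
Proof. by move=> mr; apply/cmeasP; split => //=; exact: measurable_cst. Qed.

Lemma cmeas_cexp u : measurable_fun setT u -> measurable_fun setT (fun x => cexp (u x)).
Proof.
move=> /cmeasP[ur ui]; apply/cmeasP; split.
  under eq_fun do rewrite cexpE Re_mk.
  apply: measurable_funM; first exact: measurableT_comp.
  by apply: measurableT_comp ui; apply: continuous_measurable_fun; exact: continuous_cos.
under eq_fun do rewrite cexpE Im_mk.
apply: measurable_funM; first exact: measurableT_comp.
by apply: measurableT_comp ui; apply: continuous_measurable_fun; exact: continuous_sin.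
Qed.

Lemma cmeas_nm u : measurable_fun setT u -> measurable_fun setT (fun x => nm (u x)).
Proof.
move=> /cmeasP[ur ui].
rewrite (_ : (fun x => _) = (fun x => Num.sqrt (Re (u x) ^+ 2 + Im (u x) ^+ 2))); last first.
  by apply/funext => x; case: (u x).
apply: measurableT_comp; first by apply: continuous_measurable_fun; exact: sqrt_continuous.
by apply: measurable_funD; exact: measurable_funX.
Qed.

End complex_measurable.

Section complex_integral.
Context d (T : measurableType d) (R : realType).
Variable m : {measure set T -> \bar R}.
Implicit Types (u v : T -> R[i]) (g : T -> R).
Local Open Scope complex_scope.

(** [cintegrable] and [cintegral] for an arbitrary measure, since the plane and product spaces also
    occur. *)
Definition cintble u := m.-integrable setT (fun x => (Re (u x))%:E) /\
  m.-integrable setT (fun x => (Im (u x))%:E).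

Definition cint u : R[i] := (\int[m]_x Re (u x)) +i* (\int[m]_x Im (u x)).

Lemma cintble_meas u : cintble u -> measurable_fun setT u.
Proof.
by move=> [ir ii]; apply/cmeasP; split;
  apply/measurable_EFinP; [exact: measurable_int ir|exact: measurable_int ii].
Qed.

Lemma cintble_dom u g : measurable_fun setT u -> (forall x, nm (u x) <= g x) ->
  m.-integrable setT (EFin \o g) -> cintble u.
Proof.
move=> /cmeasP[mr mi] ug ig.
have g0 x : 0 <= g x by rewrite (le_trans (nm_ge0 (u x))).
split; apply: le_integrable ig => //.
- exact/measurable_EFinP.
- by move=> x _ /=; rewrite lee_fin [ `|g x|]ger0_norm// (le_trans (Re_le_nm _)).
- exact/measurable_EFinP.
- by move=> x _ /=; rewrite lee_fin [ `|g x|]ger0_norm// (le_trans (Im_le_nm _)).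
Qed.

Lemma cintbleD u v : cintble u -> cintble v -> cintble (fun x => u x + v x).
Proof.
move=> [ur ui] [vr vi]; split.
  by under eq_fun do rewrite ReD EFinD; exact: integrableD.
by under eq_fun do rewrite ImD EFinD; exact: integrableD.
Qed.

Lemma cintD u v : cintble u -> cintble v ->
  cint (fun x => u x + v x) = cint u + cint v.
Proof.
move=> [ur ui] [vr vi]; rewrite /cint; apply: complex_eqP; rewrite !ReImE.
  by under eq_Rintegral do rewrite ReD; rewrite RintegralD.
by under eq_Rintegral do rewrite ImD; rewrite RintegralD.
Qed.

Lemma cintbleZ (c : R[i]) u : cintble u -> cintble (fun x => c * u x).
Proof.
move=> [ur ui]; split.
  under eq_fun do rewrite ReM EFinB 2!EFinM.
  by apply: integrableB => //; exact: integrableZl.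
under eq_fun do rewrite ImM EFinD 2!EFinM.
by apply: integrableD => //; exact: integrableZl.
Qed.

Lemma cintZ (c : R[i]) u : cintble u -> cint (fun x => c * u x) = c * cint u.
Proof.
move=> [ur ui].
have Zr (a : R) (h : T -> R) : m.-integrable setT (EFin \o h) ->
    m.-integrable setT (EFin \o (fun x => a * h x)).
  by move=> ih; exact: (integrableZl measurableT a ih).
rewrite /cint; apply: complex_eqP; rewrite !ReImE.
  under eq_Rintegral do rewrite ReM.
  by rewrite RintegralB ?RintegralZl//; exact: Zr.
under eq_Rintegral do rewrite ImM.
by rewrite RintegralD ?RintegralZl//; exact: Zr.
Qed.

Lemma eq_cint u v : u =1 v -> cint u = cint v.
Proof. by move=> /funext ->. Qed.

Lemma cint0 : cint (fun=> 0) = 0.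
Proof. by rewrite /cint /= /Rintegral integral0. Qed.

Lemma cintble0 : cintble (fun=> 0).
Proof. by split; exact: integrable0. Qed.

Lemma cintble_sum (I : Type) (s : seq I) (F : I -> T -> R[i]) :
  (forall i, cintble (F i)) -> cintble (fun x => \sum_(i <- s) F i x).
Proof.
move=> iF; elim: s => [|i s IH].
  by under eq_fun do rewrite big_nil; exact: cintble0.
by under eq_fun do rewrite big_cons; exact: cintbleD.
Qed.

Lemma cint_sum (I : Type) (s : seq I) (F : I -> T -> R[i]) :
  (forall i, cintble (F i)) ->
  cint (fun x => \sum_(i <- s) F i x) = \sum_(i <- s) cint (F i).
Proof.
move=> iF; elim: s => [|i s IH].
  by under eq_fun do rewrite big_nil; rewrite big_nil cint0.
under eq_fun do rewrite big_cons.
by rewrite big_cons cintD ?IH//; exact: cintble_sum.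
Qed.

Lemma cintble_conj u : cintble u -> cintble (fun x => conjc (u x)).
Proof.
move=> [ur ui]; split; first by under eq_fun do rewrite Re_conj.
by under eq_fun do rewrite Im_conj EFinN; exact: integrableN.
Qed.

Lemma cint_conj u : cintble u -> cint (fun x => conjc (u x)) = conjc (cint u).
Proof.
move=> [ur ui]; rewrite /cint; apply: complex_eqP; rewrite !ReImE.
  by under eq_Rintegral do rewrite Re_conj.
under eq_Rintegral do rewrite Im_conj -mulN1r.
by rewrite RintegralZl// mulN1r.
Qed.

Lemma cintB u v : cintble u -> cintble v ->
  cint (fun x => u x - v x) = cint u - cint v.
Proof.
move=> iu iv; under eq_fun do rewrite -mulN1r.
by rewrite cintD ?cintZ ?mulN1r//; exact: cintbleZ.
Qed.

Lemma cintbleB u v : cintble u -> cintble v -> cintble (fun x => u x - v x).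
Proof.
move=> iu iv; under eq_fun do rewrite -mulN1r.
by apply: cintbleD => //; exact: cintbleZ.
Qed.

(** The factor 2 comes from bounding the two parts separately; it is harmless because the lemma is
    applied to errors that tend to 0. *)
Lemma nm_cint_le u g : cintble u -> (forall x, nm (u x) <= g x) ->
  m.-integrable setT (EFin \o g) -> nm (cint u) <= 2 * \int[m]_x g x.
Proof.
move=> [ur ui] ug ig; apply: le_trans (nm_le _) _; rewrite mulr2n mulrDl !mul1r.
have H (h : T -> R) : m.-integrable setT (EFin \o h) -> (forall x, `|h x| <= g x) ->
    `|\int[m]_x h x| <= \int[m]_x g x.
  move=> ih hg; apply: le_trans (le_normr_Rintegral measurableT ih) _.
  by apply: le_Rintegral => //; exact: (integrable_abse ih).
apply: lerD; apply: H => // x; first exact: le_trans (Re_le_nm _) (ug x).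
exact: le_trans (Im_le_nm _) (ug x).
Qed.

End complex_integral.

Section complex_fubini.
Context d1 d2 (T1 : measurableType d1) (T2 : measurableType d2) (R : realType).
Variable m1 : {sigma_finite_measure set T1 -> \bar R}.
Variable m2 : {sigma_finite_measure set T2 -> \bar R}.
Variable f : T1 * T2 -> R[i].
Hypothesis intf : cintble (m1 \x m2)%E f.

Lemma cintble_fubini1 : (forall x, cintble m2 (fun y => f (x, y))) ->
  cintble m1 (fun x => cint m2 (fun y => f (x, y))).
Proof.
move=> i2; have [fr fi] := intf; split.
  by apply: (integrable_Rfubini1 fr) => x; case: (i2 x).
by apply: (integrable_Rfubini1 fi) => x; case: (i2 x).
Qed.

Lemma cfubini1 : (forall x, cintble m2 (fun y => f (x, y))) ->
  cint (m1 \x m2)%E f = cint m1 (fun x => cint m2 (fun y => f (x, y))).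
Proof.
move=> i2; have [fr fi] := intf; rewrite /cint /=.
by rewrite (Rfubini1 fr) ?(Rfubini1 fi)// => x; case: (i2 x).
Qed.

Lemma cfubini2 : (forall y, cintble m1 (fun x => f (x, y))) ->
  cint (m1 \x m2)%E f = cint m2 (fun y => cint m1 (fun x => f (x, y))).
Proof.
move=> i1; have [fr fi] := intf; rewrite /cint /=.
by rewrite (Rfubini2 fr) ?(Rfubini2 fi)// => y; case: (i1 y).
Qed.

End complex_fubini.

Section complex_integral_preserves.
Context d1 d2 (T1 : measurableType d1) (T2 : measurableType d2) (R : realType).
Variables (m1 : {measure set T1 -> \bar R}) (m2 : {measure set T2 -> \bar R}).
Variables (phi : T1 -> T2) (u : T2 -> R[i]).
Hypothesis pphi : preserves m1 m2 phi.

Lemma cintble_preserves : cintble m2 u -> cintble m1 (fun x => u (phi x)).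
Proof.
by move=> [ir ii]; split;
  [exact: (integrable_preserves pphi ir)|exact: (integrable_preserves pphi ii)].
Qed.

Lemma cint_preserves : measurable_fun setT u -> cint m1 (fun x => u (phi x)) = cint m2 u.
Proof.
move=> /cmeasP[mr mi]; rewrite /cint.
by rewrite -(Rintegral_preserves pphi mr) -(Rintegral_preserves pphi mi).
Qed.

End complex_integral_preserves.

(** * Lebesgue measure on C^n by recursion *)

Section sigma_finite_copy.
Context d (T : measurableType d) (R : realType).
Variable m : {measure set T -> \bar R}.
Hypothesis mT : sigma_finite setT m.

(** An alias of [m] that records the proof of sigma-finiteness, so that the structure can be
    attached to it. *)
Definition sf_copy of sigma_finite setT m : set T -> \bar R := m.

HB.instance Definition _ := isMeasure.Build _ _ _ (sf_copy mT)
  (measure0 m) (measure_ge0 m) (@measure_semi_sigma_additive _ _ _ m).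

HB.instance Definition _ :=
  Measure_isSigmaFinite.Build _ _ _ (sf_copy mT) mT.

Definition sf_measure : {sigma_finite_measure set T -> \bar R} := sf_copy mT.

End sigma_finite_copy.

Section lebesgue_Cn_recursion.
Variable R : realType.
Local Open Scope complex_scope.
Notation leb := (@lebesgue_measure R).
Notation RT := (measurableTypeR R).
Notation leb2 := (leb \x leb)%E.

(** [cons_C] with the two real coordinates bracketed together, so that the plane is one factor in
    Fubini's theorem. *)
Definition cons2 n (q : 'rV[R[i]]_n * (RT * RT)) : 'rV[R[i]]_n.+1 :=
  cons_C (q.1, q.2.1, q.2.2).

Lemma cons_C0 n (p : 'rV[R[i]]_n * RT * RT) : cons_C p 0 ord0 = p.1.2 +i* p.2.
Proof.
have -> : (ord0 : 'I_n.+1) = lshift n (ord0 : 'I_1) by exact/val_inj.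
by apply: etrans (row_mxEl _ _ _ _) _; rewrite mxE eqxx mulr1n.
Qed.

Lemma cons_CS n (p : 'rV[R[i]]_n * RT * RT) (i : 'I_n) :
  cons_C p 0 (lift ord0 i) = p.1.1 0 i.
Proof.
have -> : lift ord0 i = rshift 1 i by exact/val_inj.
exact: (etrans (row_mxEr _ _ _ _)).
Qed.

Lemma cons2_0 n (q : 'rV[R[i]]_n * (RT * RT)) : cons2 q 0 ord0 = q.2.1 +i* q.2.2.
Proof. exact: cons_C0. Qed.

Lemma cons2_S n (q : 'rV[R[i]]_n * (RT * RT)) (i : 'I_n) :
  cons2 q 0 (lift ord0 i) = q.1 0 i.
Proof. exact: cons_CS. Qed.

Let uncons n (v : 'rV[R[i]]_n.+1) : 'rV[R[i]]_n * RT * RT :=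
  (\row_j v 0 (lift ord0 j), Re (v 0 ord0) : RT, Im (v 0 ord0) : RT).

Let measurable_uncons n : measurable_fun setT (@uncons n).
Proof.
apply: measurable_fun_pair; first apply: measurable_fun_pair.
- apply: measurable_fun_row => i.
  by under eq_fun do rewrite mxE; exact: measurable_row_coord.
- by apply: cmeas_Re; exact: measurable_row_coord.
- by apply: cmeas_Im; exact: measurable_row_coord.
Qed.

Let cons_CK n : cancel (@cons_C R n) (@uncons n).
Proof.
move=> [[w x] y]; rewrite /uncons cons_C0; congr (_, _, _).
by apply/rowP => j; rewrite mxE cons_CS.
Qed.

Lemma lebesgue_Cn_sigma_finite n : sigma_finite setT (lebesgue_Cn R n).
Proof.
elim: n => [|n IH].
  exists (fun=> setT) => [|k]; first by apply/seteqP; split => // x _; exists 0%N.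
  by split => //=; rewrite diracT ltry.
have [F TF HF] := product_sigma_finite (sf_product (sf_measure IH) leb) leb.
exists (fun k => @uncons n @^-1` F k) => [|k].
  by rewrite -preimage_bigcup -TF preimage_setT.
have [mF Foo] := HF k; split.
  by rewrite -[X in measurable X]setTI; exact: measurable_uncons.
rewrite /= /lebesgue_cons /pushforward -comp_preimage.
rewrite (_ : @uncons n \o @cons_C R n = id)//.
by apply/funext => p /=; rewrite cons_CK.
Qed.

Definition dV_ n : {sigma_finite_measure set 'rV[R[i]]_n -> \bar R} :=
  sf_measure (lebesgue_Cn_sigma_finite n).

Lemma measurable_cons2 n : measurable_fun setT (@cons2 n).
Proof.
apply: measurableT_comp; first exact: measurable_cons_C.
apply: measurable_fun_pair; first apply: measurable_fun_pair => //.
- by apply: measurableT_comp => //.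
- by apply: measurableT_comp => //; exact: measurable_snd.
Qed.

Lemma dV_integrableE n (u : 'rV[R[i]]_n -> R[i]) : cintegrable u = cintble (dV_ n) u.
Proof. by []. Qed.

Lemma dV_integralE n (u : 'rV[R[i]]_n -> R[i]) : cintegral u = cint (dV_ n) u.
Proof. by []. Qed.

Let assoc n (q : 'rV[R[i]]_n * (RT * RT)) : 'rV[R[i]]_n * RT * RT := (q.1, q.2.1, q.2.2).

Let measurable_assoc n : measurable_fun setT (@assoc n).
Proof.
apply: measurable_fun_pair; first apply: measurable_fun_pair => //.
- by apply: measurableT_comp => //.
- by apply: measurableT_comp => //; exact: measurable_snd.
Qed.

(** Associativity of products of measures: by uniqueness of the product measure it is enough to
    compare on A * B, with A measurable in C^n x R. *)
Let assoc_preserves n : preserves (dV_ n \x sf_product leb leb)%E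
  (sf_product (dV_ n) leb \x leb)%E (@assoc n).
Proof.
split=> [|X mX]; first exact: measurable_assoc.
pose m' := pushforward (dV_ n \x sf_product leb leb)%E (@assoc n).
apply/esym.
apply: (@product_measure_unique _ _ _ _ R (sf_product (dV_ n) leb) leb m');
  [exact: measurable_assoc| |exact: mX] => ma A B mA mB.
rewrite /= /m' /pushforward /=.
transitivity (\int[dV_ n]_w (leb (xsection A w) * leb B))%E.
  apply: eq_integral => w _ /=.
  rewrite -(product_measure1E leb leb (measurable_xsection w mA) mB).
  congr (_ _); apply/seteqP; split => -[x y] /=; rewrite !xsectionP//=.
rewrite ge0_integralZr//.
exact: measurable_fun_xsection.
Qed.

Lemma cons2_preserves n : preserves (dV_ n \x sf_product leb leb)%E (dV_ n.+1) (@cons2 n).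
Proof.
have pc : preserves (sf_product (dV_ n) leb \x leb)%E (dV_ n.+1) (@cons_C R n).
  by split=> [|A mA]; [exact: measurable_cons_C|].
exact: preserves_comp pc (assoc_preserves n).
Qed.

End lebesgue_Cn_recursion.

(** * Gaussian integrability on C^n *)

Section product_integrable.
Context d1 d2 (T1 : measurableType d1) (T2 : measurableType d2) (R : realType).
Variable m1 : {sigma_finite_measure set T1 -> \bar R}.
Variable m2 : {sigma_finite_measure set T2 -> \bar R}.

Lemma integrable_prod (f : T1 -> R) (g : T2 -> R) :
  m1.-integrable setT (EFin \o f) -> m2.-integrable setT (EFin \o g) ->
  (m1 \x m2)%E.-integrable setT (fun p => (f p.1 * g p.2)%:E).
Proof.
move=> intf intg.
have mf : measurable_fun setT f by apply/measurable_EFinP; exact: measurable_int intf.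
have mg : measurable_fun setT g by apply/measurable_EFinP; exact: measurable_int intg.
apply/integrable12ltyP => /=.
  apply/measurable_EFinP; apply: measurable_funM.
    exact: measurableT_comp mf measurable_fst.
  exact: measurableT_comp mg measurable_snd.
have E x : (\int[m2]_y `|(f x * g y)%:E| = `|(f x)%:E| * \int[m2]_y `|(g y)%:E|)%E.
  rewrite -ge0_integralZl//; last by apply: measurableT_comp => //; exact/measurable_EFinP.
  by apply: eq_integral => y _; rewrite /= normrM EFinM.
under eq_integral do rewrite E.
have /integrableP[_ fi] := intf; have /integrableP[_ gi] := intg.
rewrite ge0_integralZr//; last by exact: integral_ge0.
  rewrite lte_mul_pinfty//; first exact: integral_ge0.
  by rewrite ge0_fin_numE// integral_ge0.
by apply: measurableT_comp => //; exact/measurable_EFinP.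
Qed.

End product_integrable.

Section Cn_norms.
Variables (R : realType) (n : nat).
Local Open Scope complex_scope.
Notation Cn := 'rV[R[i]]_n.
Implicit Types (z w : Cn).

(** A majorant of |z . w| that is additive in the moduli |z_k|: a factor e^|w_k| is absorbed by
    raising |z_k| by 1. *)
Definition adot z w : R := \sum_(k < n) nm (z 0 k) * nm (w 0 k).

Lemma conjvE z k : conjv z 0 k = conjc (z 0 k).
Proof. by rewrite mxE. Qed.

Lemma sqnormE z : sqnorm z = \sum_(k < n) nm (z 0 k) ^+ 2.
Proof.
rewrite /sqnorm /bdot Re_sum; apply: eq_bigr => k _.
by rewrite conjvE !ReImE nm_sqr; ring.
Qed.

Lemma sqnorm_ge0 z : 0 <= sqnorm z.
Proof. by rewrite sqnormE sumr_ge0// => k _; rewrite sqr_ge0. Qed.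

Lemma nm_bdot_le z w : nm (bdot z w) <= adot z w.
Proof.
by apply: le_trans (nm_sum _ _ _) _; apply: ler_sum => k _; rewrite nmM.
Qed.

Lemma adot_conjv z w : adot z (conjv w) = adot z w.
Proof. by apply: eq_bigr => k _; rewrite conjvE nm_conj. Qed.

Lemma adotC z w : adot z w = adot w z.
Proof. by apply: eq_bigr => k _; rewrite mulrC. Qed.

(** Young's inequality in each coordinate. The free weight [e] decides which share of the Gaussian
    in w is spent. *)
Lemma adot_le (e : R) z w : 0 < e ->
  adot z w <= e * sqnorm w + (4 * e)^-1 * sqnorm z.
Proof.
move=> e0; rewrite !sqnormE !mulr_sumr -big_split/=; apply: ler_sum => k _.
have e1 : 4 * e * (4 * e)^-1 = 1 by rewrite mulfV// mulf_neq0// gt_eqF.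
set a := nm _; set b := nm (w 0 k); set d := (4 * e)^-1 in e1 *.
have d0 : 0 <= d by rewrite invr_ge0 mulr_ge0// ltW.
have : 0 <= d * (a - 2 * e * b) ^+ 2 by rewrite mulr_ge0// sqr_ge0.
rewrite (_ : d * _ = d * a ^+ 2 - (4 * e * d) * (a * b) + (4 * e * d) * (e * b ^+ 2)); last by ring.
by rewrite e1; lra.
Qed.

Lemma sqnormD z w : sqnorm (z + w) <= 2 * sqnorm z + 2 * sqnorm w.
Proof.
rewrite !sqnormE !mulr_sumr -big_split/=; apply: ler_sum => k _.
rewrite mxE; have := nmD (z 0 k) (w 0 k); have := nm_ge0 (z 0 k + w 0 k).
set a := nm (z 0 k); set b := nm (w 0 k); set c := nm _ => c0 cab.
have : c ^+ 2 <= (a + b) ^+ 2 by rewrite ler_pXn2r ?nnegrE// (le_trans c0).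
have : 0 <= (a - b) ^+ 2 by rewrite sqr_ge0.
rewrite !expr2; lra.
Qed.

Lemma sqnormN z : sqnorm (- z) = sqnorm z.
Proof. by rewrite !sqnormE; apply: eq_bigr => k _; rewrite mxE nmN. Qed.

Lemma sqnormB z w : sqnorm (z - w) <= 2 * sqnorm z + 2 * sqnorm w.
Proof. by rewrite -(sqnormN w) sqnormD. Qed.

Lemma bdotC z w : bdot z w = bdot w z.
Proof. by apply: eq_bigr => k _; rewrite mulrC. Qed.

Lemma bdotDl z w u : bdot (z + w) u = bdot z u + bdot w u.
Proof. by rewrite /bdot -big_split/=; apply: eq_bigr => k _; rewrite mxE mulrDl. Qed.

Lemma bdotZl (a : R[i]) z u : bdot (a *: z) u = a * bdot z u.
Proof. by rewrite /bdot mulr_sumr; apply: eq_bigr => k _; rewrite mxE mulrA. Qed.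

Lemma bdotDr z w u : bdot u (z + w) = bdot u z + bdot u w.
Proof. by rewrite bdotC bdotDl !(bdotC u). Qed.

Lemma conj_bdot z w : conjc (bdot z w) = bdot (conjv z) (conjv w).
Proof.
rewrite /bdot rmorph_sum; apply: eq_bigr => k _.
by rewrite rmorphM !conjvE.
Qed.

Lemma conjvK z : conjv (conjv z) = z.
Proof. by apply/rowP => k; rewrite !conjvE conjcK. Qed.

Lemma conjvD z w : conjv (z + w) = conjv z + conjv w.
Proof. by apply/rowP => k; rewrite !mxE rmorphD. Qed.

End Cn_norms.

Section Cn_measurable.
Variables (R : realType) (n : nat).
Local Open Scope complex_scope.
Notation Cn := 'rV[R[i]]_n.
Context d (T : measurableType d).
Implicit Types (u v : T -> Cn).

Lemma cmeas_coord u k : measurable_fun setT u -> measurable_fun setT (fun x => u x 0 k).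
Proof. by move=> mu; exact: (measurableT_comp (@measurable_row_coord _ _ n k) mu). Qed.

Lemma cmeas_conjv u : measurable_fun setT u -> measurable_fun setT (fun x => conjv (u x)).
Proof.
move=> mu; apply: measurable_fun_row => k.
by under eq_fun do rewrite conjvE; apply: cmeas_conj; exact: cmeas_coord.
Qed.

Lemma cmeas_rowB u v : measurable_fun setT u -> measurable_fun setT v ->
  measurable_fun setT (fun x => u x - v x).
Proof.
move=> mu mv; apply: measurable_fun_row => k.
by under eq_fun do rewrite !mxE; apply: cmeasB; exact: cmeas_coord.
Qed.

Lemma cmeas_bdot u v : measurable_fun setT u -> measurable_fun setT v ->
  measurable_fun setT (fun x => bdot (u x) (v x)).
Proof.
by move=> mu mv; apply: cmeas_sum => k; apply: cmeasM; exact: cmeas_coord.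
Qed.

Lemma cmeas_sqnorm u : measurable_fun setT u -> measurable_fun setT (fun x => sqnorm (u x)).
Proof. by move=> mu; apply: cmeas_Re; apply: cmeas_bdot => //; exact: cmeas_conjv. Qed.

Lemma cmeas_gauss (a : R) u : measurable_fun setT u ->
  measurable_fun setT (fun x => expR (a * sqnorm (u x)) : R).
Proof.
by move=> mu; apply: measurableT_comp => //; apply: measurable_funM => //; exact: cmeas_sqnorm.
Qed.

Lemma cmeas_gauss_density u : measurable_fun setT u ->
  measurable_fun setT (fun x => gauss_density (u x)).
Proof.
move=> mu; apply: measurable_funM => //; apply: measurableT_comp => //.
by apply: measurableT_comp => //; exact: cmeas_sqnorm.
Qed.

End Cn_measurable.

Section gauss_Cn.
Variable R : realType.
Local Open Scope complex_scope.
Notation leb := (@lebesgue_measure R).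
Notation RT := (measurableTypeR R).

Lemma integrable_gauss (a : R) : 0 < a ->
  leb.-integrable setT (fun x : RT => (expR (- a * x ^+ 2))%:E).
Proof.
(* With variance 1 / (2a) the normal density is a multiple of the integrand. *)
move=> a0; pose s := Num.sqrt (2 * a)^-1.
have s2 : s ^+ 2 = (2 * a)^-1 by rewrite sqr_sqrtr// invr_ge0 mulr_ge0// ltW.
have s0 : s != 0 by rewrite sqrtr_eq0 -ltNge invr_gt0 mulr_gt0.
have := integrableZl measurableT (normal_peak s)^-1 (integrable_normal_pdf 0 s).
apply: eq_integrable => // x _ /=.
rewrite -EFinM normal_pdfE// mulrA mulVf ?gt_eqF ?normal_peak_gt0// mul1r.
rewrite /normal_fun subr0 s2; congr (expR _)%:E.
have a1 : a != 0 by rewrite gt_eqF.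
rewrite -mulr_natr; field.
by rewrite a1.
Qed.

Lemma sqnorm_cons2 n (q : 'rV[R[i]]_n * (RT * RT)) :
  sqnorm (cons2 q) = sqnorm q.1 + (q.2.1 ^+ 2 + q.2.2 ^+ 2).
Proof.
rewrite !sqnormE big_ord_recl cons2_0 nm_sqr /= addrC; congr (_ + _).
by apply: eq_bigr => k _; rewrite cons2_S.
Qed.

Lemma integrable_gauss_Cn n (a : R) : 0 < a ->
  (dV_ R n).-integrable setT (fun w => (expR (- a * sqnorm w))%:E).
Proof.
move=> a0; elim: n => [|n IH].
  apply/integrableP; split; first by apply/measurable_EFinP; exact: cmeas_gauss.
  under eq_integral.
    move=> w _; rewrite sqnormE big_ord0 mulr0 expR0 abse1; over.
  by rewrite integral_cst//= mul1e /sf_copy/= diracT ltry.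
apply: (integrable_of_preserves (cons2_preserves R n)).
  by apply/measurable_EFinP; exact: cmeas_gauss.
have i2 := integrable_prod (integrable_gauss a0) (integrable_gauss a0).
have := @integrable_prod _ _ _ _ _ (dV_ R n) (sf_product leb leb) _ _ IH i2.
apply: eq_integrable => // q _ /=.
by rewrite sqnorm_cons2 !mulrDr !expRD.
Qed.

End gauss_Cn.

(** * Growth of entire functions in Sym *)

Section entire_functions.
Variables (R : realType) (n : nat).
Local Open Scope complex_scope.
Notation Cn := 'rV[R[i]]_n.
Implicit Types (z w u v : Cn).

Lemma gt0_complexE (r : R[i]) : 0 < r -> r = (Re r)%:C /\ 0 < Re r.
Proof. by rewrite ltcE => /andP[/eqP i0 r0]; split => //; apply: complex_eqP. Qed.

Lemma gt0_real (e : R) : 0 < e -> 0 < e%:C.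
Proof. by rewrite ltcR. Qed.

Lemma entire_continuous (f : Cn -> R[i]) z (e : R) : entire f -> 0 < e ->
  exists2 r : R, 0 < r & forall w, (forall k, nm (w 0 k - z 0 k) < r) -> nm (f w - f z) <= e.
Proof.
move=> ef e0; have /differentiable_continuous cf := ef z.
move/cvgrPdist_le : cf => /(_ _ (gt0_real e0)) /nbhs_ballP[r /= r0 H].
have [rE r1] := gt0_complexE r0.
exists (Re r) => // w wz.
have : ball z r w.
  split=> // i j; rewrite /= /ball/= (ord1 i) rE nmE ltcR nm_distC; exact: wz.
by move=> /H; rewrite nmE lecR nm_distC.
Qed.

(** Holomorphy on every complex line. This is what the one-variable arguments use, and it passes to
    slices with a frozen coordinate. *)
Definition holo (f : Cn -> R[i]) := forall u v, cdiff (fun t => f (u + t *: v)).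

Lemma entire_holo (f : Cn -> R[i]) : entire f -> holo f.
Proof.
move=> ef u v p; have /(@diff_derivable _ _ _ _ _ v) := ef (u + p *: v).
move=> df; exists ('D_v f (u + p *: v)) => e e0.
have {}df : h^-1 *: ((f \o shift (u + p *: v)) (h *: v) - f (u + p *: v))
    @[h --> (0 : R[i])^'] --> 'D_v f (u + p *: v) := df.
move/cvgrPdist_le : df => /(_ _ (gt0_real e0)) /nbhs_ballP[r /= r0 H].
have [rE r1] := gt0_complexE r0.
exists (Re r / 2) => [|w wp]; first by rewrite divr_gt0.
have [->|wp0] := eqVneq w p; first by rewrite !subrr mulr0 subr0 nm0 mulr0.
have b : ball 0 r (w - p).
  rewrite /ball/= sub0r normrN rE nmE ltcR (le_lt_trans wp)//.
  by rewrite ltr_pdivrMr// mulr_natr mulr2n ltrDl.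
have wp1 : w - p != 0 by rewrite subr_eq0.
have := H _ b wp1; rewrite nmE lecR /= => {}H.
have -> : f (u + w *: v) - f (u + p *: v) - 'D_v f (u + p *: v) * (w - p) =
   - (w - p) * ('D_v f (u + p *: v) -
     (w - p)^-1 *: (f ((w - p) *: v + (u + p *: v)) - f (u + p *: v))).
  have -> : (w - p) *: v + (u + p *: v) = u + w *: v.
    by rewrite scalerBl addrCA subrK.
  move: wp1; move: (w - p) ('D_v f _) (f (u + w *: v) - _) => h D A h0.
  by rewrite /GRing.scale/=; field.
by rewrite nmM nmN mulrC ler_wpM2r ?nm_ge0.
Qed.

Lemma holoM (f g : Cn -> R[i]) : holo f -> holo g -> holo (fun w => f w * g w).
Proof. by move=> hf hg u v; apply: cdiffM. Qed.

Lemma holo_shift (f : Cn -> R[i]) w : holo f -> holo (fun z => f (z - w)).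
Proof.
move=> hf u v; have := hf (u - w) v; congr cdiff; apply/funext => t.
by congr f; rewrite addrAC.
Qed.

Lemma holo_cexp_bdot a : holo (fun z => cexp (bdot z a)).
Proof.
move=> u v; rewrite (_ : (fun t => _) = @cexp R \o (fun t => bdot v a * t + bdot u a)).
  exact: cdiff_comp (@cdiff_cexp R) (cdiff_affine _ _).
by apply/funext => t /=; rewrite bdotDl bdotZl addrC mulrC.
Qed.

End entire_functions.

Section positive_boxes.
Variable R : realType.
Local Open Scope complex_scope.
Notation leb := (@lebesgue_measure R).
Notation RT := (measurableTypeR R).

(** A cube in the real coordinates, which [cons2] splits into a product; its measure is then seen to
    be positive by induction. *)
Definition box n (z : 'rV[R[i]]_n) (r : R) : set 'rV[R[i]]_n :=
  [set w | forall k, `|Re (w 0 k) - Re (z 0 k)| <= r /\ `|Im (w 0 k) - Im (z 0 k)| <= r].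

Let itv_preimage (c r : R) : [set x : RT | `|x - c| <= r] = `[c - r, c + r]%classic.
Proof. by apply/seteqP; split => x /=; rewrite in_itv/= ler_distl. Qed.

Let box_cons2 n (z : 'rV[R[i]]_n.+1) r : @cons2 R n @^-1` box z r =
  box (\row_k z 0 (lift ord0 k)) r `*`
  ([set x : RT | `|x - Re (z 0 ord0)| <= r] `*` [set x : RT | `|x - Im (z 0 ord0)| <= r]).
Proof.
apply/seteqP; split => [[w [x y]] /= H|[w [x y]] /= [H [H1 H2]] k].
  split; last by have := H ord0; rewrite cons2_0.
  by move=> k; have := H (lift ord0 k); rewrite cons2_S mxE.
case: (unliftP ord0 k) => [j ->|->]; last by rewrite cons2_0.
by have := H j; rewrite cons2_S mxE.
Qed.

Lemma measurable_box n (z : 'rV[R[i]]_n) r : measurable (box z r).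
Proof.
have -> : box z r = \bigcap_(k : 'I_n)
   [set w : 'rV[R[i]]_n | `|Re (w 0 k) - Re (z 0 k)| <= r /\ `|Im (w 0 k) - Im (z 0 k)| <= r].
  by apply/seteqP; split => w /= H k; [move=> _; exact: H|exact: H].
apply: fin_bigcap_measurable => // k _.
have mk : measurable_fun setT (fun w : 'rV[R[i]]_n => w 0 k) by exact: measurable_row_coord.
have H (g : 'rV[R[i]]_n -> R) (c : R) : measurable_fun setT g ->
    measurable [set w | `|g w - c| <= r].
  move=> mg; rewrite -[X in measurable X]setTI.
  have := mg measurableT _ (measurable_itv `[c - r, c + r]).
  by congr measurable; apply/seteqP; split => w /=; rewrite in_itv/= ler_distl.
apply: measurableI; apply: H; [exact: cmeas_Re|exact: cmeas_Im].
Qed.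

Lemma box_gt0 n (z : 'rV[R[i]]_n) (r : R) : 0 < r -> (0 < dV_ R n (box z r))%E.
Proof.
move=> r0; elim: n z => [|n IH] z.
  rewrite /= /sf_copy /= diracE mem_set ?lte01//.
  by move=> [].
have [_ <-] := cons2_preserves R n; last exact: measurable_box.
rewrite box_cons2 !itv_preimage.
have mI (c : R) : measurable (`[c - r, c + r]%classic : set RT) by exact: measurable_itv.
have lI (c : R) : (0 < leb `[(c - r)%R, (c + r)%R]%classic)%E.
  have E : leb `[(c - r)%R, (c + r)%R]%classic = (2 * r)%:E.
    apply: etrans (@lebesgue_measure_itv R `[c - r, c + r]) _.
    have cr : c - r < c + r by lra.
    by rewrite /= lte_fin cr -EFinB; congr EFin; ring.
  by apply: (eq_ind_r (fun x => (0 < x)%E) _ E); rewrite lte_fin mulr_gt0.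
have E1 := product_measure1E (dV_ R n) (sf_product leb leb)
  (measurable_box (\row_k z 0 (lift ord0 k)) r)
  (measurableX (mI (Re (z 0 ord0))) (mI (Im (z 0 ord0)))).
have E2 := product_measure1E leb leb (mI (Re (z 0 ord0))) (mI (Im (z 0 ord0))).
apply: (eq_ind_r (fun x => (0 < x)%E) _ E1); apply: mule_gt0; first exact: IH.
by apply: (eq_ind_r (fun x => (0 < x)%E) _ E2); apply: mule_gt0; exact: lI.
Qed.

(** Otherwise a null set would contain the box of half-width r / 4, all of whose points are within r
    / 2 of z in each coordinate. *)
Lemma ae_dense n (P : 'rV[R[i]]_n -> Prop) (z : 'rV[R[i]]_n) (r : R) : 0 < r ->
  {ae dV_ R n, forall w, P w} -> exists2 w, P w & forall k, nm (w 0 k - z 0 k) < r.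
Proof.
move=> r0 [N [mN N0 PN]]; apply: contrapT => H.
have r40 : 0 < r / 4 by rewrite divr_gt0.
have := box_gt0 z r40; rewrite ltNge => /negP; apply.
rewrite -N0; apply: le_measure; rewrite ?inE//; first exact: measurable_box.
move=> w bw; apply: PN => /= Pw; apply: H; exists w => // k.
apply: le_lt_trans (nm_le _) _; rewrite !ReImE.
by have [? ?] := bw k; lra.
Qed.

End positive_boxes.

Section growth.
Variables (R : realType) (n : nat).
Local Open Scope complex_scope.
Notation Cn := 'rV[R[i]]_n.

(* The bound holds almost everywhere, hence on a dense set, and [f] is continuous. *)
Lemma Sym_growth (f : Cn -> R[i]) : Sym f -> entire f -> forall c : R, 0 < c ->
  exists K : R, 0 <= K /\ forall w, nm (f w) <= K * expR (c * sqnorm w).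
Proof.
move=> [mf bf] ef c c0; have c20 : 0 < c / 2 by rewrite divr_gt0.
have [M HM] := ess_supr_bounded (bf _ c20).
have {}HM : {ae dV_ R n, forall w,
  nm (f w * (expR (- (c / 2) * sqnorm w))%:C) <= M} := HM.
(* A nearby point w has |w|^2 <= 2|z|^2 + 2n, so the exponent c/2 at w becomes c at z with an extra
   factor e^(c n). The summand 1 pays for |f w - f z| <= 1. *)
pose K := (Num.max M 0 + 1) * expR (c * n%:R).
have M0 : 0 <= Num.max M 0 by rewrite le_max lexx orbT.
have MM : M <= Num.max M 0 by rewrite le_max lexx.
have K0 : 0 <= K by rewrite mulr_ge0 ?expR_ge0// addr_ge0.
exists K; split=> // z.
have [r r0 Hr] := entire_continuous z ef ltr01.
have r10 : 0 < Num.min r 1 by rewrite lt_min r0 ltr01.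
have [w Pw wz] := ae_dense z r10 HM.
have wr k : nm (w 0 k - z 0 k) < r.
  by rewrite (lt_le_trans (wz k))// ge_min lexx.
have {}Hr := Hr w wr.
have sw : sqnorm (w - z) <= n%:R.
  rewrite sqnormE (_ : n%:R = \sum_(k < n) 1 :> R); last by rewrite sumr_const card_ord.
  apply: ler_sum => k _; rewrite !mxE expr_le1 ?nm_ge0//.
  by rewrite (le_trans (ltW (wz k)))// ge_min lexx orbT.
have sw2 : sqnorm w <= 2 * sqnorm z + 2 * n%:R.
  rewrite -(subrK z w); apply: le_trans (sqnormD _ _) _.
  by have := sqnorm_ge0 z; lra.
have fw : nm (f w) <= Num.max M 0 * expR (c * n%:R) * expR (c * sqnorm z).
  move: Pw; rewrite nmM nm_real ger0_norm ?expR_ge0// mulNr expRN.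
  rewrite ler_pdivrMr ?expR_gt0// => Pw.
  apply: le_trans Pw _; rewrite -mulrA -expRD.
  apply: le_trans (ler_wpM2r (expR_ge0 _) MM) _.
  by apply: ler_wpM2l => //; rewrite ler_expR; nra.
have e1 : 1 <= expR (c * n%:R) * expR (c * sqnorm z).
  by rewrite -expRD -expR0 ler_expR addr_ge0// mulr_ge0 ?sqnorm_ge0 ?ler0n// ltW.
rewrite /K mulrDl mul1r mulrDl.
have := nmB (f w) (f w - f z); rewrite opprB addrC subrK; lra.
Qed.

End growth.

(** * The reproducing formula *)

Section reproducing_plane.
Variable R : realType.
Local Open Scope complex_scope.
Notation leb := (@lebesgue_measure R).
Notation RT := (measurableTypeR R).
Notation leb2 := (sf_product leb leb).

Definition plane_gauss (p : RT * RT) : R := expR (- (p.1 ^+ 2 + p.2 ^+ 2)).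

Let plane_gauss_meas : measurable_fun setT plane_gauss.
Proof.
apply: measurableT_comp => //; apply: measurableT_comp => //.
by apply: measurable_funD; apply: measurable_funX.
Qed.

(** The imaginary part of H is the real part of -i H, which is again holomorphic. *)
Lemma gauss_mean_valueC (H : R[i] -> R[i]) : cdiff H ->
  measurable_fun setT (fun p : RT * RT => H (p.1 +i* p.2)) ->
  cintble leb2 (fun p => H (p.1 +i* p.2) * (plane_gauss p)%:C) ->
  cint leb2 (fun p => H (p.1 +i* p.2) * (plane_gauss p)%:C) = pi%:C * H 0.
Proof.
move=> dH mH [ir ii].
have dH' : cdiff (fun w => (0 -i* 1) * H w).
  rewrite (_ : (fun w => _) = (fun w => (0 -i* 1) * w + 0) \o H).
    exact: cdiff_comp (cdiff_affine _ _) dH.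
  by apply/funext => w /=; rewrite addr0.
have E1 p : Re (H (p.1 +i* p.2) * (plane_gauss p)%:C) = Re (H (p.1 +i* p.2)) * plane_gauss p.
  by rewrite !ReImE mulr0 subr0.
have E2 p : Im (H (p.1 +i* p.2) * (plane_gauss p)%:C) =
    Re ((0 -i* 1) * H (p.1 +i* p.2)) * plane_gauss p.
  by rewrite !ReImE mulr0 add0r mul0r sub0r mulN1r opprK.
rewrite /cint; apply: complex_eqP; rewrite !ReImE mul0r ?subr0 ?addr0.
  rewrite -(gauss_mean_value dH (cmeas_Re mH)).
    by apply: eq_Rintegral => p _; rewrite E1.
  by apply: eq_integrable ir => // p _; rewrite E1.
transitivity (pi * Re ((0 -i* 1) * H 0)); last first.
  by rewrite !ReImE mul0r sub0r mulN1r opprK.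
rewrite -(gauss_mean_value dH').
- by apply: eq_Rintegral => p _; rewrite E2.
- by apply: cmeas_Re; apply: cmeasM => //; exact: cmeas_cst.
- by apply: eq_integrable ii => // p _; rewrite E2.
Qed.

Lemma cintble_plane (u : RT * RT -> R[i]) (a K : R) : 0 < a ->
  measurable_fun setT u ->
  (forall p, nm (u p) <= K * expR (- a * (p.1 ^+ 2 + p.2 ^+ 2))) -> cintble leb2 u.
Proof.
move=> a0 mu uK; apply: (cintble_dom mu uK).
have i2 := integrable_prod (integrable_gauss a0) (integrable_gauss a0).
have := integrableZl measurableT K i2.
by apply: eq_integrable => // p _ /=; rewrite -EFinM mulrDr expRD.
Qed.

Definition rep_integrand1 (h : R[i] -> R[i]) (z : R[i]) (p : RT * RT) : R[i] :=
  h (p.1 +i* p.2) * cexp (z * conjc (p.1 +i* p.2)) * (pi^-1 * plane_gauss p)%:C.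

Variables (h : R[i] -> R[i]) (K : R).
Hypothesis dh : cdiff h.
Hypothesis mh : measurable_fun setT (fun p : RT * RT => h (p.1 +i* p.2)).
Hypothesis hK : forall w, nm (h w) <= K * expR (nm w ^+ 2 / 4).

Let mpt : measurable_fun setT (fun p : RT * RT => p.1 +i* p.2).
Proof. by apply/cmeasP; split; [exact: measurable_fst|exact: measurable_snd]. Qed.

(** Of the exponent |w|^2 of the weight, a quarter pays for the growth of h and a quarter for e^(z
    \bar w); half of it remains. *)
Lemma cintble_rep1 z : cintble leb2 (rep_integrand1 h z).
Proof.
apply: (@cintble_plane _ (2^-1) (K * expR (nm z ^+ 2) * pi^-1)) => // [|p].
  apply: cmeasM; last by apply: cmeas_real; exact: measurable_funM.
  apply: cmeasM => //; apply: cmeas_cexp; apply: cmeasM; first exact: cmeas_cst.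
  exact: cmeas_conj.
rewrite /rep_integrand1; set w := p.1 +i* p.2.
have Ew : p.1 ^+ 2 + p.2 ^+ 2 = nm w ^+ 2 by rewrite nm_sqr.
rewrite 2!nmM nm_real ger0_norm ?mulr_ge0 ?invr_ge0 ?pi_ge0 ?expR_ge0//.
have H1 : nm (cexp (z * conjc w)) <= expR (nm w ^+ 2 / 4 + nm z ^+ 2).
  apply: le_trans (nm_cexp_le _) _; rewrite ler_expR nmM nm_conj.
  have : 0 <= (nm w / 2 - nm z) ^+ 2 by rewrite sqr_ge0.
  rewrite sqrrB expr_div_n; lra.
have H2 := ler_pM (nm_ge0 _) (nm_ge0 _) (hK w) H1.
have pg : 0 <= pi^-1 * plane_gauss p by rewrite mulr_ge0 ?expR_ge0 ?invr_ge0 ?pi_ge0.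
apply: le_trans (ler_wpM2r pg H2) _.
rewrite le_eqVlt; apply/orP; left; apply/eqP.
rewrite /plane_gauss Ew expRD.
have -> : expR (- 2^-1 * nm w ^+ 2) =
   expR (nm w ^+ 2 / 4) * expR (nm w ^+ 2 / 4) * expR (- nm w ^+ 2).
  by rewrite -!expRD; congr expR; lra.
ring.
Qed.

(** Substitute w = v + z. Since z \bar w - |w|^2 = - \bar z v - |v|^2, the integrand becomes the
    holomorphic function h(v + z) e^(- \bar z v) times the centred Gaussian, and the mean value at v
    = 0 is h(z). *)
Lemma reproducing_plane z : cint leb2 (rep_integrand1 h z) = h z.
Proof.
pose H v := h (v + z) * cexp (- conjc z * v).
have dH : cdiff H.
  apply: cdiffM.
    rewrite (_ : (fun w => _) = h \o (fun v => 1 * v + z)).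
      exact: cdiff_comp dh (cdiff_affine _ _).
    by apply/funext => v /=; rewrite mul1r.
  rewrite (_ : (fun w => _) = @cexp R \o (fun v => - conjc z * v + 0)).
    exact: cdiff_comp (@cdiff_cexp R) (cdiff_affine _ _).
  by apply/funext => v /=; rewrite addr0.
have tp := translation2_preserves (Re z) (Im z).
have addE (p : RT * RT) : (p.1 + Re z) +i* (p.2 + Im z) = p.1 +i* p.2 + z.
  by apply: complex_eqP; rewrite !ReImE.
have gE (p : RT * RT) : (plane_gauss p)%:C = cexp (- ((p.1 +i* p.2) * conjc (p.1 +i* p.2))).
  rewrite -cexp_real; congr cexp; apply: complex_eqP; rewrite !ReImE; ring.
have shiftE p : rep_integrand1 h z (p.1 + Re z, p.2 + Im z) =
    pi^-1%:C * (H (p.1 +i* p.2) * (plane_gauss p)%:C).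
  have R1 (q : RT * RT) v : q.1 +i* q.2 = v ->
      rep_integrand1 h z q = h v * cexp (z * conjc v) * (pi^-1%:C * cexp (- (v * conjc v))).
    by move=> <-; rewrite /rep_integrand1 -gE -rmorphM.
  rewrite (R1 (p.1 + Re z : RT, p.2 + Im z : RT) _ (addE p)) gE /H; set v := p.1 +i* p.2.
  rewrite (_ : cexp (- ((v + z) * conjc (v + z))) =
    cexp (- (z * conjc (v + z))) * cexp (- conjc z * v) * cexp (- (v * conjc v))).
    have e1 : cexp (z * conjc (v + z)) * cexp (- (z * conjc (v + z))) = 1.
      by rewrite -cexpD subrr cexp0.
    transitivity (h (v + z) * (pi^-1)%:C * cexp (- conjc z * v) * cexp (- (v * conjc v)) *
      (cexp (z * conjc (v + z)) * cexp (- (z * conjc (v + z))))); first by ring.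
    by rewrite e1; ring.
  by rewrite -!cexpD rmorphD; congr cexp; ring.
have iH : cintble leb2 (fun p => H (p.1 +i* p.2) * (plane_gauss p)%:C).
  have := cintbleZ (pi%:C) (cintble_preserves tp (cintble_rep1 z)).
  rewrite (_ : (fun p => _) = fun p : RT * RT => H (p.1 +i* p.2) * (plane_gauss p)%:C)//.
  apply/funext => p; rewrite shiftE mulrA -rmorphM/= mulfV ?mul1r//.
  by rewrite gt_eqF// pi_gt0.
have mH : measurable_fun setT (fun p : RT * RT => H (p.1 +i* p.2)).
  have mhs := measurableT_comp mh (proj1 tp).
  apply: cmeasM.
    by move: mhs; congr measurable_fun; apply/funext => p /=; rewrite addE.
  by apply: cmeas_cexp; apply: cmeasM => //; exact: cmeas_cst.
rewrite -(cint_preserves tp (cintble_meas (cintble_rep1 z))).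
under eq_cint do rewrite shiftE.
rewrite cintZ// gauss_mean_valueC// mulrA -rmorphM/= mulVf ?gt_eqF ?pi_gt0//.
by rewrite rmorph1 mul1r /H mulr0 cexp0 mulr1 add0r.
Qed.

End reproducing_plane.

Section reproducing_Cn.
Variable R : realType.
Local Open Scope complex_scope.
Notation leb := (@lebesgue_measure R).
Notation RT := (measurableTypeR R).
Notation leb2 := (sf_product leb leb).

Lemma cintble_Cn n (u : 'rV[R[i]]_n -> R[i]) (a K : R) : 0 < a ->
  measurable_fun setT u ->
  (forall w, nm (u w) <= K * expR (- a * sqnorm w)) -> cintble (dV_ R n) u.
Proof.
move=> a0 mu uK; apply: (cintble_dom mu uK).
exact: (integrableZl measurableT K (integrable_gauss_Cn n a0)).
Qed.

Definition rep_integrand n (h : 'rV[R[i]]_n -> R[i]) (z w : 'rV[R[i]]_n) : R[i] :=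
  h w * cexp (bdot z (conjv w)) * (gauss_density w)%:C.

Lemma gauss_density_ge0 n (w : 'rV[R[i]]_n) : 0 <= gauss_density w.
Proof. by rewrite mulr_ge0 ?expR_ge0// invr_ge0 exprn_ge0// pi_ge0. Qed.

Lemma cintble_rep n (h : 'rV[R[i]]_n -> R[i]) K z : measurable_fun setT h ->
  (forall w, nm (h w) <= K * expR (4^-1 * sqnorm w)) -> cintble (dV_ R n) (rep_integrand h z).
Proof.
move=> mh hK.
apply: (@cintble_Cn _ _ (2^-1) (K * expR (sqnorm z) * pi ^- n)) => // [|w].
  apply: cmeasM; last by apply: cmeas_real; exact: cmeas_gauss_density.
  apply: cmeasM => //; apply: cmeas_cexp; apply: cmeas_bdot; first exact: measurable_cst.
  exact: cmeas_conjv.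
rewrite /rep_integrand 2!nmM nm_real ger0_norm ?gauss_density_ge0//.
have H1 : nm (cexp (bdot z (conjv w))) <= expR (4^-1 * sqnorm w + sqnorm z).
  apply: le_trans (nm_cexp_le _) _; rewrite ler_expR.
  apply: le_trans (nm_bdot_le _ _) _; rewrite adot_conjv.
  have e0 : 0 < 4^-1 :> R by rewrite invr_gt0.
  by apply: le_trans (adot_le z w e0) _; rewrite mulfV// invr1 mul1r.
have H2 := ler_pM (nm_ge0 _) (nm_ge0 _) (hK w) H1.
apply: le_trans (ler_wpM2r (gauss_density_ge0 _) H2) _.
rewrite le_eqVlt; apply/orP; left; apply/eqP.
rewrite /gauss_density expRD.
have -> : expR (- 2^-1 * sqnorm w) =
   expR (4^-1 * sqnorm w) * expR (4^-1 * sqnorm w) * expR (- sqnorm w).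
  by rewrite -!expRD; congr expR; lra.
ring.
Qed.

Let rowDZ m (u v : 'rV[R[i]]_m) (t : R[i]) k : (u + t *: v) 0 k = u 0 k + t * v 0 k.
Proof. by rewrite !mxE. Qed.

(** This and the next lemma exhibit the two kinds of slices of C^(n+1) as complex lines, so that
    [holo] restricts to them. *)
Lemma cons2D n (u v : 'rV[R[i]]_n) (t : R[i]) (p : RT * RT) :
  cons2 (u + t *: v, p) = cons2 (u, p) + t *: cons2 (v, (0 : RT, 0 : RT)).
Proof.
apply/rowP => k; rewrite rowDZ; case: (unliftP ord0 k) => [j ->|->].
  by rewrite !cons2_S rowDZ.
by rewrite !cons2_0 mulr0 addr0.
Qed.

Lemma cons2_line n (w : 'rV[R[i]]_n) (t : R[i]) :
  cons2 (w, (Re t : RT, Im t : RT)) = cons2 (w, (0 : RT, 0 : RT)) + t *: cons2 (0, (1 : RT, 0 : RT)).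
Proof.
apply/rowP => k; rewrite rowDZ; case: (unliftP ord0 k) => [j ->|->].
  by rewrite !cons2_S mxE mulr0 addr0.
by rewrite !cons2_0; apply: complex_eqP; rewrite !ReImE/= ?(mulr0, mulr1, add0r, subr0, addr0).
Qed.

Lemma bdot_cons2 n (z : 'rV[R[i]]_n.+1) (q : 'rV[R[i]]_n * (RT * RT)) :
  bdot z (conjv (cons2 q)) = z 0 ord0 * conjc (q.2.1 +i* q.2.2) +
    bdot (\row_k z 0 (lift ord0 k)) (conjv q.1).
Proof.
rewrite /bdot big_ord_recl conjvE cons2_0; congr (_ + _).
by apply: eq_bigr => k _; rewrite !conjvE cons2_S mxE.
Qed.

Lemma gauss_density_cons2 n (q : 'rV[R[i]]_n * (RT * RT)) :
  gauss_density (cons2 q) = gauss_density q.1 * (pi^-1 * plane_gauss q.2).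
Proof.
by rewrite /gauss_density sqnorm_cons2 opprD expRD exprS invfM /plane_gauss; ring.
Qed.

Theorem reproducing n (h : 'rV[R[i]]_n -> R[i]) K z : measurable_fun setT h -> holo h ->
  (forall w, nm (h w) <= K * expR (4^-1 * sqnorm w)) ->
  cint (dV_ R n) (rep_integrand h z) = h z.
Proof.
elim: n h K z => [|n IH] h K z mh hh hK.
  have z0 w : w = z by apply/rowP => -[].
  rewrite (_ : rep_integrand h z = fun=> h z); last first.
    apply/funext => w; rewrite /rep_integrand (z0 w) /bdot big_ord0 cexp0 mulr1.
    by rewrite /gauss_density sqnormE big_ord0 oppr0 expR0 expr0 invr1 mulr1 mulr1.
  have /(congr1 fine) F : (dV_ R 0 setT = 1)%E by rewrite /= /sf_copy /= diracT.
  rewrite /cint !(Rintegral_cst _ measurableT) (_ : fine _ = 1); last exact: F.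
  by rewrite !mulr1; exact: complex_eqP.
have hK0 (q : 'rV[R[i]]_n * (RT * RT)) :
    nm (h (cons2 q)) <= K * expR (4^-1 * sqnorm q.1) * expR (4^-1 * (q.2.1 ^+ 2 + q.2.2 ^+ 2)).
  by rewrite -mulrA -expRD -mulrDr -sqnorm_cons2.
have mcons2 := @measurable_cons2 R n.
have mhc : measurable_fun setT (h \o @cons2 R n) := measurableT_comp mh mcons2.
pose h1 (w : 'rV[R[i]]_n) (t : R[i]) := h (cons2 (w, (Re t : RT, Im t : RT))).
have dh1 w : cdiff (h1 w).
  have := hh (cons2 (w, (0 : RT, 0 : RT))) (cons2 (0, (1 : RT, 0 : RT))).
  by congr cdiff; apply/funext => t; rewrite /h1 cons2_line.
have mh1 w : measurable_fun setT (fun p : RT * RT => h1 w (p.1 +i* p.2)).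
  have := measurableT_comp mhc (measurable_pair1 w).
  by congr measurable_fun; apply/funext => -[x y].
have h1K w t : nm (h1 w t) <= K * expR (4^-1 * sqnorm w) * expR (nm t ^+ 2 / 4).
  by have := hK0 (w, (Re t : RT, Im t : RT)); rewrite /= -nm_sqr mulrC [_ / 4]mulrC [X in _ <= X]mulrC.
pose z' : 'rV[R[i]]_n := \row_k z 0 (lift ord0 k).
have repE q : rep_integrand h z (cons2 q) =
    cexp (bdot z' (conjv q.1)) * (gauss_density q.1)%:C * rep_integrand1 (h1 q.1) (z 0 ord0) q.2.
  rewrite /rep_integrand bdot_cons2 cexpD gauss_density_cons2 rmorphM /rep_integrand1 /h1 /=.
  by case: q => w [x y] /=; ring.
have ir : cintble (dV_ R n.+1) (rep_integrand h z) := cintble_rep z mh hK.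
rewrite -(cint_preserves (cons2_preserves R n) (cintble_meas ir)).
have iinner w : cintble leb2 (fun p => rep_integrand h z (cons2 (w, p))).
  have X := cintbleZ (cexp (bdot z' (conjv w)) * (gauss_density w)%:C) (cintble_rep1 (mh1 w) (h1K w) (z 0 ord0)).
  by move: X; congr cintble; apply/funext => p; rewrite (repE (w, p)).
rewrite (cfubini1 (m2 := leb2) (cintble_preserves (cons2_preserves R n) ir) iinner).
(* The plane integral replaces the first coordinate by that of z; the induction hypothesis then
   treats the remaining ones. *)
transitivity (cint (dV_ R n) (rep_integrand (fun w => h1 w (z 0 ord0)) z')).
  apply: eq_cint => w; apply: etrans (eq_cint _ (fun p => repE (w, p))) _.
  have X := cintble_rep1 (mh1 w) (h1K w) (z 0 ord0).
  apply: etrans (cintZ (cexp (bdot z' (conjv w)) * (gauss_density w)%:C) X) _.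
  by rewrite (reproducing_plane (dh1 w) (mh1 w) (h1K w)) /rep_integrand; ring.
rewrite (IH _ (K * expR (nm (z 0 ord0) ^+ 2 / 4))).
- rewrite /h1; congr h; apply/rowP => k; case: (unliftP ord0 k) => [j ->|->].
    by rewrite cons2_S mxE.
  by rewrite cons2_0; apply: complex_eqP.
- have := measurableT_comp mhc (measurable_pair2 (Re (z 0 ord0) : RT, Im (z 0 ord0) : RT)).
  exact.
- move=> u v; have := hh (cons2 (u, (Re (z 0 ord0) : RT, Im (z 0 ord0) : RT))) (cons2 (v, (0 : RT, 0 : RT))).
  by congr cdiff; apply/funext => t; rewrite /h1 cons2D.
- by move=> w; rewrite mulrAC; exact: h1K.
Qed.

End reproducing_Cn.

(** * Expansion of the exponential under the integral *)

Lemma geometric_small (R : realType) (q c e : R) : 0 <= q < 1 -> 0 < e ->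
  exists N, q ^+ N * c < e.
Proof.
move=> /andP[q0 q1] e0.
have : (geometric c q) @ \oo --> (0 : R) by apply: cvg_geometric; rewrite ger0_norm.
move/cvgrPdist_lt => /(_ _ e0) [N _ /(_ N (leqnn _))]; rewrite sub0r normrN => H.
by exists N; apply: le_lt_trans H; rewrite mulrC ler_norm.
Qed.

Section unconditional_sums.
Variables (R : realType) (I : choiceType).
Implicit Types (x y : I -> R[i]) (l : R[i]) (A B : {fset I}).

Lemma partial_sumE x A : partial_sum x A = \sum_(i <- A) x i.
Proof. by rewrite big_seq_fsetE. Qed.

Lemma cvg_totallyP x l : partial_sum x @ totally --> l <->
  forall e : R, 0 < e -> exists A : {fset I}, forall B : {fset I}, (A `<=` B)%fset ->
    nm (l - \sum_(i <- B) x i) < e.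
Proof.
have F := @totally_filter I.
split=> [/cvgrPdist_lt cl e e0|H].
  have [A _ AP] := cl e%:C%C (gt0_real e0); exists A => B AB.
  by have := AP B AB; rewrite partial_sumE nmE ltcR.
apply/cvgrPdist_lt => e /gt0_complexE[-> e0].
have [A AP] := H _ e0; exists A => // B /= AB.
by rewrite partial_sumE nmE ltcR; exact: AP.
Qed.

Lemma ler_sum_fset (u : I -> R) A B : (forall i, 0 <= u i) -> (A `<=` B)%fset ->
  \sum_(i <- A) u i <= \sum_(i <- B) u i.
Proof.
move=> u0 AB; rewrite [leRHS](big_fsetID _ (mem A))/=.
have -> : [fset i in B | i \in A]%fset = A.
  by apply/fsetP => i; rewrite !inE/= andb_idl// => /(fsubsetP AB).
by rewrite lerDl; exact: sumr_ge0.
Qed.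

Lemma sum_fsetB (V : zmodType) (u : I -> V) A B : (A `<=` B)%fset ->
  \sum_(i <- B) u i - \sum_(i <- A) u i = \sum_(i <- [fset i in B | i \notin A]%fset) u i.
Proof.
move=> AB; rewrite (big_fsetID _ (mem A) B)/=.
have -> : [fset i in B | i \in A]%fset = A.
  by apply/fsetP => i; rewrite !inE/= andb_idl// => /(fsubsetP AB).
by rewrite addrAC subrr add0r.
Qed.

End unconditional_sums.

Section exp_exchange.
Variable R : realType.

Let P (m : nat) (z : R[i]) := \sum_(k < m) z ^+ k / k`!%:R.

Let sum_exp_le (x : R) m : 0 <= x -> \sum_(k < m) x ^+ k / k`!%:R <= expR x.
Proof.
move=> x0.
have nd : nondecreasing_seq (series (exp_coeff x)).
  apply/nondecreasing_seqP => k; rewrite -subr_ge0 /series/= big_nat_recr//= addrAC subrr add0r.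
  exact: exp_coeff_ge0.
have := nondecreasing_cvgn_le nd (is_cvg_series_exp_coeff x) m.
by rewrite /series/= big_mkord.
Qed.

Let pow_exp_le (x : R) m : 0 <= x -> x ^+ m / m`!%:R <= expR x.
Proof.
move=> x0; apply: le_trans (sum_exp_le m.+1 x0); rewrite big_ord_recr/= lerDr.
by apply: sumr_ge0 => j _; rewrite divr_ge0 ?exprn_ge0 ?ler0n.
Qed.

Let nmP m z : nm (P m z) <= expR (3 / 2 * nm z).
Proof.
apply: le_trans (nm_sum _ _ _) _.
apply: (@le_trans _ _ (expR (nm z))); last by rewrite ler_expR; have := nm_ge0 z; lra.
apply: le_trans (sum_exp_le m (nm_ge0 z)).
by apply: ler_sum => k _; rewrite nmM nmX nmV nm_nat.
Qed.

(** The exponent 5 is too large to be integrated later. For fixed z the bound still shows that the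
    tail tends to 0, which [nm_tail] needs. *)
Let rough_tail m z : nm (cexp z - P m z) <= 2^-1 ^+ m * expR (5 * nm z).
Proof.
apply: le_trans (nm_expc_tail m z) _.
have x0 := nm_ge0 z; set x := nm z in x0 *.
have H : (4 * x) ^+ m / m`!%:R <= expR (4 * x) by apply: pow_exp_le; lra.
have -> : (2 * x) ^+ m / m`!%:R = 2^-1 ^+ m * ((4 * x) ^+ m / m`!%:R).
  by rewrite mulrA -exprMn; congr (_ ^+ _ / _); lra.
have -> : expR (5 * x) = expR (4 * x) * expR x by rewrite -expRD; congr expR; lra.
rewrite -mulrA; apply: ler_wpM2l; first by rewrite exprn_ge0.
by apply: ler_wpM2r => //; exact: expR_ge0.
Qed.

(* The constant 3/2 has to stay below 2: the expansion is later applied to terms of size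
   [e^(|v||w|)], integrated against the product of two Gaussians. *)
Let nm_tail m z : nm (cexp z - P m z) <= (2 / 3) ^+ m * expR (3 / 2 * nm z).
Proof.
apply/ler_addgt0Pl => e e0.
have h01 : 0 <= (2^-1 : R) < 1 by rewrite invr_ge0 ler0n invf_lt1// ltr1n.
have [N Ne] := geometric_small (expR (5 * nm z)) h01 e0.
(* In degree k >= m the factor (2/3)^m (3/2)^k is at least 1, so the block is dominated by (2/3)^m
   times a partial sum of e^(3|z|/2). *)
have main M : nm (P (m + M) z - P m z) <= (2 / 3) ^+ m * expR (3 / 2 * nm z).
  rewrite /P big_split_ord/= addrAC subrr add0r; apply: le_trans (nm_sum _ _ _) _.
  have x0 : 0 <= 3 / 2 * nm z by rewrite mulr_ge0 ?nm_ge0.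
  have q0 k : 0 <= (2 / 3 : R) ^+ k by rewrite exprn_ge0.
  have X := ler_wpM2l (q0 m) (sum_exp_le (m + M) x0).
  apply: le_trans _ X; rewrite big_split_ord/= mulrDr -[leLHS]add0r; apply: lerD.
    apply: mulr_ge0; first exact: q0.
    by apply: sumr_ge0 => k _; rewrite divr_ge0 ?exprn_ge0.
  rewrite mulr_sumr; apply: ler_sum => k _; rewrite nmM nmX nmV nm_nat.
  rewrite mulrA; apply: ler_wpM2r; first by rewrite invr_ge0.
  rewrite [(3 / 2 * _) ^+ _]exprMn mulrA -[leLHS]mul1r; apply: ler_wpM2r.
    by rewrite exprn_ge0 ?nm_ge0.
  rewrite exprD mulrA -exprMn (_ : 2 / 3 * (3 / 2) = 1 :> R); last by lra.
  by rewrite expr1n mul1r; apply: exprn_ege1; lra.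
rewrite (_ : cexp z - P m z = (cexp z - P (m + N) z) + (P (m + N) z - P m z)); last by ring.
apply: le_trans (nmD _ _) _; apply: lerD (main N).
apply: le_trans (rough_tail _ _) _; apply/ltW; apply: le_lt_trans Ne.
apply: ler_wpM2r; first exact: expR_ge0.
by apply: ler_wiXn2l; rewrite ?leq_addl//; lra.
Qed.

(** Telescoping: the factors are exchanged one at a time, each at cost d times the product of the
    bounds. *)
Let prod_dist (I : Type) (s : seq I) (a b : I -> R[i]) (E : I -> R) (d : R) : 0 <= d ->
  (forall k, nm (a k) <= E k) -> (forall k, nm (b k) <= E k) ->
  (forall k, nm (a k - b k) <= d * E k) ->
  nm (\prod_(k <- s) a k - \prod_(k <- s) b k) <= (size s)%:R * d * \prod_(k <- s) E k.
Proof.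
move=> d0 aE bE abE.
elim: s => [|k s IH]; first by rewrite !big_nil subrr nm0 !mul0r.
rewrite !big_cons /=.
set pa := \prod_(j <- s) a j; set pb := \prod_(j <- s) b j; set pE := \prod_(j <- s) E j.
have pbE : nm pb <= pE.
  by rewrite nm_prod; apply: ler_prod => j _; rewrite nm_ge0 bE.
rewrite (_ : a k * pa - b k * pb = a k * (pa - pb) + (a k - b k) * pb); last by ring.
apply: le_trans (nmD _ _) _; rewrite 2!nmM.
rewrite -natr1 (_ : _ * _ = E k * ((size s)%:R * d * pE) + d * E k * pE); last by ring.
by apply: lerD; apply: ler_pM; rewrite ?nm_ge0.
Qed.

Variable n : nat.
Local Notation idx := {ffun 'I_n -> nat}.

Definition expterm (X : 'I_n -> R[i]) (i : idx) : R[i] :=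
  \prod_k (X k ^+ i k / (i k)`!%:R).

(** The multi-indices with all entries below m. Over such a cube the partial sum factorizes into
    one-variable Taylor polynomials, and every finite set lies in a cube. *)
Definition idxbox (m : nat) : {fset idx} :=
  [fset [ffun k => nat_of_ord (h k)] | h : {ffun 'I_n -> 'I_m} in predT]%fset.

Let sum_idxbox m (V : nmodType) (F : idx -> V) :
  \sum_(i <- idxbox m) F i = \sum_(h : {ffun 'I_n -> 'I_m}) F [ffun k => nat_of_ord (h k)].
Proof.
rewrite big_imfset /=.
  by rewrite big_enum/=; apply: eq_bigl => h; rewrite !inE.
by move=> h h' _ _ /ffunP E; apply/ffunP => k; apply/val_inj; have := E k; rewrite !ffunE.
Qed.

Let sum_expterm_box m X : \sum_(i <- idxbox m) expterm X i = \prod_k P m (X k).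
Proof.
rewrite sum_idxbox /P bigA_distr_bigA/=; apply: eq_bigr => h _.
by apply: eq_bigr => k _; rewrite ffunE.
Qed.

Let sub_idxbox (A : {fset idx}) m : exists2 M, (m <= M)%N & (A `<=` idxbox M)%fset.
Proof.
exists (m + (\max_(i <- A) \max_k i k).+1)%N; first exact: leq_addr.
apply/fsubsetP => i iA.
have ik k : (i k < m + (\max_(i <- A) \max_k i k).+1)%N.
  rewrite ltn_addl// ltnS.
  apply: leq_trans (leq_bigmax_seq _ iA _) => //.
  by rewrite (bigD1 k)//= leq_maxl.
apply/imfsetP => /=; exists [ffun k => Ordinal (ik k)]; first by rewrite !inE.
by apply/ffunP => k; rewrite !ffunE.
Qed.

Definition nmsum (X : 'I_n -> R[i]) : R := \sum_k nm (X k).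

Let box_error m X : nm (cexp (\sum_k X k) - \prod_k P m (X k)) <=
  n%:R * (2 / 3) ^+ m * expR (3 / 2 * nmsum X).
Proof.
have := @prod_dist _ (index_enum 'I_n) (fun k => cexp (X k)) (fun k => P m (X k))
  (fun k => expR (3 / 2 * nm (X k))) ((2 / 3) ^+ m).
rewrite cexp_sum mulr_sumr expR_sum => /(_ _ _ _ _).
rewrite /index_enum -enumT size_enum_ord; apply => [|k|k|k] //.
apply: le_trans (nm_cexp_le _) _; rewrite ler_expR; have := nm_ge0 (X k); lra.
Qed.

(** The cube itself gives one error term. The terms of A outside it are bounded in modulus by those
    of a larger cube, hence by the same error for the moduli |X_k|; this accounts for the factor
    2. *)
Lemma expterm_error m X (A : {fset idx}) : (idxbox m `<=` A)%fset ->
  nm (cexp (\sum_k X k) - \sum_(i <- A) expterm X i) <=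
  n%:R * (2 / 3) ^+ m * 2 * expR (3 / 2 * nmsum X).
Proof.
move=> mA.
have [M mM AM] := sub_idxbox A m.
pose Y k : R[i] := (nm (X k))%:C%C.
have nmY i : nm (expterm X i) = \prod_k (nm (X k) ^+ i k / (i k)`!%:R).
  by rewrite nm_prod; apply: eq_bigr => k _; rewrite nmM nmX nmV nm_nat.
have YE i : expterm Y i = (nm (expterm X i))%:C%C.
  rewrite nmY rmorph_prod; apply: eq_bigr => k _.
  by rewrite rmorphM/= rmorphXn/= fmorphV/= rmorph_nat.
have sumY : nmsum Y = nmsum X.
  by apply: eq_bigr => k _; rewrite nm_real ger0_norm ?nm_ge0.
have tail : \sum_(i <- A) nm (expterm X i) - \sum_(i <- idxbox m) nm (expterm X i) <=
    n%:R * (2 / 3) ^+ m * expR (3 / 2 * nmsum X).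
  apply: (@le_trans _ _ (\sum_(i <- idxbox M) nm (expterm X i) - \sum_(i <- idxbox m) nm (expterm X i))).
    by rewrite lerD2r; apply: ler_sum_fset => // i; exact: nm_ge0.
  have := box_error m Y; rewrite sumY -sum_expterm_box.
  rewrite (_ : cexp _ - _ = (expR (\sum_k nm (X k)) -
    \sum_(i <- idxbox m) nm (expterm X i))%:C%C); last first.
    rewrite (eq_bigr _ (fun i _ => YE i)) -rmorph_sum /Y -rmorph_sum cexp_real.
    exact/esym/rmorphB.
  rewrite nm_real.
  apply: le_trans; apply: le_trans (ler_norm _); rewrite lerD2r.
  under eq_bigr do rewrite nmY.
  have E : \sum_(i <- idxbox M) \prod_k (nm (X k) ^+ i k / (i k)`!%:R) =
      \prod_k \sum_(j < M) nm (X k) ^+ j / j`!%:R.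
    rewrite sum_idxbox bigA_distr_bigA/=; apply: eq_bigr => h _.
    by apply: eq_bigr => k _; rewrite ffunE.
  rewrite E expR_sum; apply: ler_prod => k _; rewrite sum_exp_le ?nm_ge0// andbT.
  by apply: sumr_ge0 => j _; rewrite divr_ge0 ?exprn_ge0 ?nm_ge0 ?ler0n.
rewrite (_ : cexp _ - _ = (cexp (\sum_k X k) - \sum_(i <- idxbox m) expterm X i) -
   (\sum_(i <- A) expterm X i - \sum_(i <- idxbox m) expterm X i)); last by ring.
apply: le_trans (nmB _ _) _; rewrite mulrAC mulr2n mulrDr mulr1; apply: lerD.
  by rewrite sum_expterm_box; exact: box_error.
apply: le_trans tail; rewrite !sum_fsetB//; exact: nm_sum.
Qed.

Lemma nm_expterm_le X i : nm (expterm X i) <= expR (3 / 2 * nmsum X).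
Proof.
rewrite nm_prod mulr_sumr expR_sum; apply: ler_prod => k _; rewrite nm_ge0/= nmM nmX nmV nm_nat.
have x0 := nm_ge0 (X k).
by apply: le_trans (pow_exp_le (i k) x0) _; rewrite ler_expR; lra.
Qed.

Section exchange.
Context d (T : measurableType d) (m : {measure set T -> \bar R}).
Variables (G : T -> R[i]) (X : 'I_n -> T -> R[i]).
Hypothesis mG : measurable_fun setT G.
Hypothesis mX : forall k, measurable_fun setT (X k).
Hypothesis iG : m.-integrable setT
  (fun t => (nm (G t) * expR (3 / 2 * nmsum (fun k => X k t)))%:E).

Let mterm i : measurable_fun setT (fun t => expterm (fun k => X k t) i).
Proof.
by apply: cmeas_prod => k; apply: cmeasM; [exact: cmeasX|exact: cmeas_cst].
Qed.

Lemma cintble_expterm i : cintble m (fun t => G t * expterm (fun k => X k t) i).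
Proof.
apply: (cintble_dom _ _ iG); first exact: cmeasM.
by move=> t /=; rewrite nmM; apply: ler_wpM2l; [exact: nm_ge0|exact: nm_expterm_le].
Qed.

Lemma cintble_cexp_sum : cintble m (fun t => G t * cexp (\sum_k X k t)).
Proof.
apply: (cintble_dom _ _ iG).
  by apply: cmeasM => //; apply: cmeas_cexp; exact: cmeas_sum.
move=> t /=; rewrite nmM; apply: ler_wpM2l; first exact: nm_ge0.
apply: le_trans (nm_cexp_le _) _; rewrite ler_expR.
have H : nm (\sum_k X k t) <= nmsum (fun k => X k t) := nm_sum _ _ _.
have := nm_ge0 (\sum_k X k t); lra.
Qed.

(** Convergence is along finite sets of multi-indices rather than a sequence, so dominated
    convergence is replaced by a rate: the error is (2/3)^N times the integrable majorant [iG], for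
    all finite sets containing the cube of size N. *)
Lemma exp_exchange :
  partial_sum (fun i => cint m (fun t => G t * expterm (fun k => X k t) i)) @ totally -->
  cint m (fun t => G t * cexp (\sum_k X k t)).
Proof.
apply/cvg_totallyP => e e0.
pose J := \int[m]_t (nm (G t) * expR (3 / 2 * nmsum (fun k => X k t))).
have J0 : 0 <= J.
  by apply: Rintegral_ge0 => t _; rewrite mulr_ge0 ?nm_ge0 ?expR_ge0.
have [N NP] : exists N, (2 / 3) ^+ N * (4 * n%:R * J) < e
  by apply: geometric_small => //; rewrite divr_ge0//= ltr_pdivrMr// mul1r ltr_nat.
exists (idxbox N) => A NA.
rewrite -cint_sum; last by move=> i; exact: cintble_expterm.
rewrite -cintB; [|exact: cintble_cexp_sum|by apply: cintble_sum => i; exact: cintble_expterm].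
apply: le_lt_trans NP.
have c0 : 0 <= n%:R * (2 / 3) ^+ N * 2 :> R by rewrite !mulr_ge0.
apply: (@le_trans _ _ (2 * \int[m]_t (n%:R * (2 / 3) ^+ N * 2 *
    (nm (G t) * expR (3 / 2 * nmsum (fun k => X k t)))))).
  apply: nm_cint_le.
  - apply: cintbleB; first exact: cintble_cexp_sum.
    by apply: cintble_sum => i; exact: cintble_expterm.
  - move=> t; rewrite -mulr_sumr -mulrBr nmM mulrCA.
    by apply: ler_wpM2l; [exact: nm_ge0|exact: expterm_error].
  - by have := integrableZl measurableT (n%:R * (2 / 3) ^+ N * 2) iG; apply: eq_integrable.
rewrite RintegralZl// le_eqVlt; apply/orP; left; apply/eqP; rewrite /J; ring.
Qed.

End exchange.
End exp_exchange.

(** * Coefficients of power series *)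

Section absolute_convergence.
Variables (R : realType) (I : choiceType).

(** Split B according to the sign of u: on each part the sum of moduli is the modulus of the sum. *)
Let sum_norm_fset_le (u : I -> R) (B : {fset I}) (c : R) :
  (forall C : {fset I}, (C `<=` B)%fset -> `|\sum_(i <- C) u i| <= c) ->
  \sum_(i <- B) `|u i| <= 2 * c.
Proof.
move=> uc; rewrite (big_fsetID _ (fun i => 0 <= u i))/= mulr2n mulrDl mul1r.
have sub (p : pred I) : ([fset i in B | p i] `<=` B)%fset.
  by apply/fsubsetP => i; rewrite !inE => /andP[].
apply: lerD.
  apply: le_trans (uc _ (sub (fun i => 0 <= u i))).
  apply: le_trans (ler_norm _); rewrite le_eqVlt; apply/orP; left; apply/eqP.
  by apply: eq_fbigr => i; rewrite !inE => /andP[_ ui] _; rewrite ger0_norm.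
apply: le_trans (uc _ (sub (fun i => ~~ (0 <= u i)))).
rewrite -normrN; apply: le_trans (ler_norm _); rewrite -sumrN le_eqVlt; apply/orP; left; apply/eqP.
by apply: eq_fbigr => i; rewrite !inE => /andP[_ ui] _; rewrite ltr0_norm// ltNge.
Qed.

(** Unconditional convergence is absolute. Finite sums disjoint from a suitable A have modulus at
    most 2, so the real and the imaginary parts outside A have sums of moduli at most 2 * 2 each. *)
Lemma totally_cvg_abs_bounded (x : I -> R[i]) (l : R[i]) : partial_sum x @ totally --> l ->
  exists M : R, forall B : {fset I}, \sum_(i <- B) nm (x i) <= M.
Proof.
move=> /cvg_totallyP/(_ _ ltr01)[A AP].
exists (\sum_(i <- A) nm (x i) + (2 * 2 + 2 * 2)) => B.
have small (C : {fset I}) : (C `<=` [fset i in B | i \notin A])%fset ->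
    nm (\sum_(i <- C) x i) <= 2.
  move=> /fsubsetP CB.
  have -> : C = [fset i in A `|` C | i \notin A]%fset.
    apply/fsetP => i; rewrite !inE andbC; case: (boolP (i \in A)) => //= iA.
    by apply/negP => /CB; rewrite !inE iA andbF.
  rewrite -sum_fsetB ?fsubsetUl// (_ : _ - _ =
    (l - \sum_(i <- A) x i) - (l - \sum_(i <- (A `|` C)%fset) x i)); last by ring.
  apply: le_trans (nmB _ _) _; rewrite -[2]/(1 + 1).
  by apply: lerD; apply/ltW/AP; rewrite ?fsubset_refl ?fsubsetUl.
have sub : \sum_(i <- B) nm (x i) <=
    \sum_(i <- A) nm (x i) + \sum_(i <- [fset i in B | i \notin A]%fset) nm (x i).
  rewrite (big_fsetID _ (mem A) B)/= lerD2r; apply: ler_sum_fset.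
    by move=> i; exact: nm_ge0.
  by apply/fsubsetP => i; rewrite !inE/= => /andP[].
apply: le_trans sub _; rewrite lerD2l.
apply: (@le_trans _ _ (\sum_(i <- [fset i in B | i \notin A]%fset) (`|Re (x i)| + `|Im (x i)|))).
  by apply: ler_sum => i _; exact: nm_le.
rewrite big_split/=; apply: lerD; apply: sum_norm_fset_le => C /small H.
  by rewrite -Re_sum; apply: le_trans (Re_le_nm _) H.
by rewrite -Im_sum; apply: le_trans (Im_le_nm _) H.
Qed.

Lemma eq_totally_cvg (x y : I -> R[i]) (l : R[i]) : x =1 y ->
  partial_sum x @ totally --> l -> partial_sum y @ totally --> l.
Proof. by move=> /funext ->. Qed.

Lemma totally_cvgB (x y : I -> R[i]) (l k : R[i]) :
  partial_sum x @ totally --> l -> partial_sum y @ totally --> k ->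
  partial_sum (fun i => x i - y i) @ totally --> l - k.
Proof.
move=> /cvg_totallyP xl /cvg_totallyP yk; apply/cvg_totallyP => e e0.
have e20 : 0 < e / 2 by rewrite divr_gt0.
have [A AP] := xl _ e20; have [B BP] := yk _ e20.
exists (A `|` B)%fset => C; rewrite fsubUset => /andP[AC BC].
rewrite sumrB (_ : _ - _ = (l - \sum_(i <- C) x i) - (k - \sum_(i <- C) y i)); last by ring.
by apply: le_lt_trans (nmB _ _) _; rewrite [e]splitr; apply: ltrD; [exact: AP|exact: BP].
Qed.

End absolute_convergence.

Section power_series.
Variables (R : realType) (n : nat).
Local Notation idx := {ffun 'I_n -> nat}.

(** Strictly increasing primes, one for each variable; only their being distinct matters. *)
Let Fixpoint pr (k : nat) : nat := if k is k'.+1 then s2val (prime_above (pr k')) else 2.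

Let pr_prime k : prime (pr k).
Proof. by case: k => [//|k] /=; exact: (s2valP' (prime_above _)). Qed.

Let pr_lt j k : (j < k)%N -> (pr j < pr k)%N.
Proof.
have step i : (pr i < pr i.+1)%N by exact: (s2valP (prime_above _)).
elim: k => // k IH; rewrite ltnS leq_eqVlt => /orP[/eqP->//|/IH].
by move=> /ltn_trans; apply.
Qed.

Let pr_inj j k : (pr j == pr k) = (j == k).
Proof.
case: (ltngtP j k) => [/pr_lt|/pr_lt|->]; last by rewrite eqxx.
  by move=> /ltn_eqF.
by move=> /gtn_eqF.
Qed.

Let code (i : idx) : nat := \prod_(k < n) pr k ^ i k.

Let code_gt0 i : (0 < code i)%N.
Proof. by apply: prodn_gt0 => k; rewrite expn_gt0 prime_gt0. Qed.

Let logn_code i (k : 'I_n) : logn (pr k) (code i) = i k.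
Proof.
pose r x y := ((0 < x) && (logn (pr k) x == y))%N.
suff /andP[_ /eqP] : r (code i) (i k) by [].
rewrite (_ : i k = \sum_(j < n) (k == j) * i j)%N; last first.
  rewrite (bigD1 k)//= eqxx mul1n big1 ?addn0// => j jk.
  by rewrite eq_sym (negbTE jk).
rewrite /code; elim/big_ind2 : _ => [|x y x' y' /andP[x0 /eqP xy] /andP[x0' /eqP xy']|j _].
- by rewrite /r logn1.
- by rewrite /r muln_gt0 x0 x0' lognM// xy xy' eqxx.
- by rewrite /r expn_gt0 prime_gt0// lognX logn_prime// pr_inj mulnC eqxx.
Qed.

Let code_inj : injective code.
Proof. by move=> i j ij; apply/ffunP => k; rewrite -!logn_code ij. Qed.

Let mpow_code (s : nat) (i : idx) :
  mpow (\row_k ((pr k)%:R^-1 ^+ s : R[i])) i = (code i)%:R^-1 ^+ s.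
Proof.
rewrite /mpow /code natr_prod -prodfV -prodrXl; apply: eq_bigr => k _.
by rewrite mxE natrX -exprM -[in RHS]exprVn -exprM mulnC.
Qed.

(* The code of [i] is the integer whose prime factorization has exponents [i]: evaluating
   at the inverse powers of the primes turns the power series into a Dirichlet series,
   whose leading coefficient is isolated by letting [s] go to infinity. *)
Lemma power_series_eq0 (c : idx -> R[i]) :
  (forall z, partial_sum (fun i => c i * mpow z i) @ totally --> (0 : R[i])) ->
  forall i, c i = 0.
Proof.
move=> c0 i1; apply/eqP; apply: contrapT => /negP ci1.
pose P N := `[< exists i, code i = N /\ c i != 0 >].
have exP : exists N, P N by exists (code i1); apply/asboolP; exists i1.
(* [i0] has the least code among the indices with nonzero coefficient, so it dominates the series as
   s grows. *)
case: (ex_minnP exP) => N0 /asboolP[i0 [<- ci0]] minP {N0 exP ci1 i1}.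
have gtc i : i != i0 -> c i != 0 -> (code i0 < code i)%N.
  move=> ii0 ci; rewrite ltn_neqAle minP ?andbT; last by apply/asboolP; exists i.
  by apply: contra ii0 => /eqP/code_inj->.
(* At s = 0 the point is (1, ..., 1), so the coefficients themselves are absolutely summable, with
   bound M. *)
have [M MP] := totally_cvg_abs_bounded (c0 (\row_k ((pr k)%:R^-1 ^+ 0))).
have {}MP (B : {fset idx}) : \sum_(i <- B) nm (c i) <= M.
  by apply: le_trans (MP B); apply: ler_sum => i _; rewrite mpow_code expr0 mulr1.
set N := code i0 in gtc *.
have N0 : 0 < N%:R :> R by rewrite ltr0n code_gt0.
have N1 : 0 < N.+1%:R :> R by rewrite ltr0n.
have nc0 : 0 < nm (c i0).
  rewrite lt_neqAle nm_ge0 andbT; apply: contra ci0 => /eqP; move=> /esym.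
  by move=> /nm_eq0 ->.
have q01 : 0 <= (N%:R / N.+1%:R : R) < 1.
  by rewrite divr_ge0//= ltr_pdivrMr// mul1r ltr_nat.
(* All other terms together are at most M (N+1)^(-s), and the partial sum is taken within (N+1)^(-s)
   of 0. Hence |c i0| N^(-s) <= (1 + M)(N+1)^(-s), against this choice of s. *)
have [s Hs] := geometric_small (1 + M) q01 nc0.
have e0 : 0 < N.+1%:R^-1 ^+ s :> R by rewrite exprn_gt0// invr_gt0.
have [A AP] := (cvg_totallyP _ _).1 (c0 (\row_k ((pr k)%:R^-1 ^+ s))) _ e0.
have := AP (i0 |` A)%fset (fsubsetU1 _ _).
rewrite sub0r nmN (big_fsetD1 i0) ?fset1U1//= => H.
move: Hs; apply/negP; rewrite -leNgt.
have rest : nm (\sum_(i <- ((i0 |` A) `\ i0)%fset) c i * mpow (\row_k ((pr k)%:R^-1 ^+ s)) i) <=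
    N.+1%:R^-1 ^+ s * M.
  apply: le_trans (nm_sum _ _ _) _.
  apply: (@le_trans _ _ (\sum_(i <- ((i0 |` A) `\ i0)%fset) N.+1%:R^-1 ^+ s * nm (c i))); last first.
    by rewrite -mulr_sumr; apply: ler_wpM2l; [exact: ltW|exact: MP].
  rewrite big_seq [leRHS]big_seq; apply: ler_sum => i; rewrite !inE => /andP[ii0 _].
  rewrite nmM mulrC; have [->|ci] := eqVneq (c i) 0; first by rewrite nm0 !mulr0.
  apply: ler_wpM2r; first exact: nm_ge0.
  rewrite mpow_code nmX nmV nm_nat; apply: lerXn2r; rewrite ?nnegrE ?invr_ge0//.
  by rewrite lef_pV2 ?posrE ?ltr0n ?code_gt0// ler_nat gtc.
have H2 : nm (c i0 * mpow (\row_k ((pr k)%:R^-1 ^+ s)) i0) <= N.+1%:R^-1 ^+ s * (1 + M).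
  set u := c i0 * _ in H *; set v := \sum_(i <- _) _ in H rest.
  rewrite (_ : u = (u + v) - v); last by ring.
  by apply: le_trans (nmB _ _) _; rewrite mulrDr mulr1; apply: lerD => //; exact: ltW.
move: H2; rewrite nmM mpow_code nmX nmV nm_nat !exprVn ler_pdivrMr ?exprn_gt0// => H2.
by rewrite exprMn exprVn; apply: le_trans H2 _; rewrite le_eqVlt; apply/orP; left; apply/eqP; ring.
Qed.

Lemma coefs_unique (g : 'rV[R[i]]_n -> R[i]) (c : idx -> R[i]) :
  (forall z, partial_sum (fun i => c i * mpow z i) @ totally --> g z) -> coefs g = c.
Proof.
move=> cg; have ex : exists a : idx -> R[i],
    forall z, partial_sum (fun i => a i * mpow z i) @ totally --> g z by exists c.
have Pg := getPex ex; rewrite -/(coefs g) in Pg.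
apply/funext => i; apply/eqP; rewrite -subr_eq0; apply/eqP.
apply: (@power_series_eq0 (fun i => coefs g i - c i)) => z.
rewrite -(subrr (g z)) (_ : (fun i => _) = (fun i => coefs g i * mpow z i - c i * mpow z i)).
  exact: totally_cvgB (Pg z) (cg z).
by apply/funext => j; rewrite mulrBl.
Qed.

End power_series.

Section growth.
Variables (R : realType) (n : nat).
Local Open Scope complex_scope.
Implicit Types (h f g : 'rV[R[i]]_n -> R[i]) (z w : 'rV[R[i]]_n).

Definition subgaussian h := forall c : R, 0 < c ->
  exists K : R, 0 <= K /\ forall w, nm (h w) <= K * expR (c * sqnorm w).

Lemma integrable_subgaussian h z : measurable_fun setT h -> subgaussian h ->
  (dV_ R n).-integrable setT
    (fun w => (nm (h w * (gauss_density w)%:C) * expR (adot z w))%:E).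
Proof.
move=> mh gh.
have q0 : 0 < 4^-1 :> R by rewrite invr_gt0.
have [K [K0 hK]] := gh _ q0.
have i2 : 0 < 2^-1 :> R by rewrite invr_gt0.
have := integrableZl measurableT (K * expR (sqnorm z) * pi ^- n) (integrable_gauss_Cn n i2).
apply: le_integrable => //.
  apply/measurable_EFinP; apply: measurable_funM.
    apply: cmeas_nm; apply: cmeasM => //; apply: cmeas_real; apply: cmeas_gauss_density.
    exact: measurable_id.
  apply: (measurableT_comp (@measurable_expR R)).
  apply: measurable_sum => k; apply: measurable_funM; first exact: measurable_cst.
  by apply: cmeas_nm; apply: cmeas_coord; exact: measurable_id.
move=> w _; rewrite -EFinM !abse_EFin lee_fin ger0_norm ?mulr_ge0 ?nm_ge0 ?expR_ge0//.
apply: le_trans (ler_norm _).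
rewrite nmM nm_real ger0_norm ?gauss_density_ge0// /gauss_density.
have H : expR (adot z w) <= expR (4^-1 * sqnorm w + sqnorm z).
  rewrite ler_expR; apply: le_trans (adot_le z w q0) _.
  by rewrite mulfV// invr1 mul1r.
have e0 : 0 <= pi ^- n * expR (- sqnorm w) :> R.
  by rewrite mulr_ge0 ?expR_ge0// invr_ge0 exprn_ge0// pi_ge0.
have H2 := ler_pM (mulr_ge0 (nm_ge0 _) e0) (expR_ge0 _) (ler_wpM2r e0 (hK w)) H.
apply: le_trans H2 _; rewrite le_eqVlt; apply/orP; left; apply/eqP.
rewrite expRD.
have -> : expR (- 2^-1 * sqnorm w) =
   expR (4^-1 * sqnorm w) * expR (4^-1 * sqnorm w) * expR (- sqnorm w).
  by rewrite -!expRD; congr expR; lra.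
ring.
Qed.

Definition moment h (i : {ffun 'I_n -> nat}) : R[i] :=
  cint (dV_ R n) (fun w => h w * (gauss_density w)%:C * expterm (fun k => conjc (w 0 k)) i).

Lemma expterm_scale (a X : 'I_n -> R[i]) i :
  expterm (fun k => a k * X k) i = (\prod_k a k ^+ i k) * expterm X i.
Proof.
by rewrite /expterm -big_split; apply: eq_bigr => k _; apply: etrans _ (esym (mulrA _ _ _)); rewrite exprMn.
Qed.

Section moments.
Variable g : 'rV[R[i]]_n -> R[i].
Hypotheses (mg : measurable_fun setT g) (sg : subgaussian g).

Let mG : measurable_fun setT (fun w : 'rV[R[i]]_n => g w * (gauss_density w)%:C).
Proof.
apply: cmeasM => //; apply: cmeas_real; apply: cmeas_gauss_density; exact: measurable_id.
Qed.

Let mX (a : 'rV[R[i]]_n) k :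
  measurable_fun setT (fun w : 'rV[R[i]]_n => a 0 k * conjc (w 0 k)).
Proof.
apply: cmeasM; first exact: cmeas_cst.
by apply: cmeas_conj; apply: cmeas_coord; exact: measurable_id.
Qed.

Let iG (a : 'rV[R[i]]_n) : (dV_ R n).-integrable setT
  (fun w => (nm (g w * (gauss_density w)%:C) *
    expR (3 / 2 * nmsum (fun k => a 0 k * conjc (w 0 k))))%:E).
Proof.
(* The factor 3/2 in the exponent is absorbed by scaling the point, which is arbitrary. *)
have := integrable_subgaussian ((3 / 2)%:C *: a) mg sg.
apply: eq_integrable => // w _; congr (_ * expR _)%:E.
rewrite /nmsum mulr_sumr; apply: eq_bigr => k _.
by rewrite mxE 2!nmM nm_conj nm_real ger0_norm// mulrA.
Qed.

Lemma cintble_moment i : cintble (dV_ R n)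
  (fun w => g w * (gauss_density w)%:C * expterm (fun k => conjc (w 0 k)) i).
Proof.
have := cintble_expterm mG (mX (const_mx 1)) (iG (const_mx 1)) i.
by congr cintble; apply/funext => w; congr (_ * expterm _ i); apply/funext => k; rewrite mxE mul1r.
Qed.

(** Expand e^(z . \bar w) in the reproducing formula for g: z^i comes out of each term, which leaves
    the moment, and uniqueness identifies it with the family chosen by [coefs]. *)
Lemma coefsE : holo g -> coefs g = moment g.
Proof.
move=> hg; apply: coefs_unique => z.
have q0 : 0 < 4^-1 :> R by rewrite invr_gt0.
have [K [K0 gK]] := sg q0.
have := exp_exchange mG (mX z) (iG z).
rewrite (_ : cint _ _ = g z); last first.
  rewrite -(reproducing z mg hg gK); apply: eq_cint => w.
  rewrite /rep_integrand mulrAC; congr (_ * cexp _ * _).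
  by apply: eq_bigr => k _; rewrite conjvE.
apply: eq_totally_cvg => i.
under eq_cint do rewrite expterm_scale mulrCA.
rewrite cintZ; first by rewrite mulrC.
exact: cintble_moment.
Qed.

End moments.

End growth.

(** * Derivatives of Laplace integrals *)

(** Distributivity when the range of summation depends on the factor, as for the multi-indices l <=
    i in [creation]. *)
Lemma prod_sum_dffun (R : comPzSemiRingType) (I : finType) (T : I -> finType)
    (F : forall k, T k -> R) :
  \prod_k \sum_(j : T k) F k j = \sum_(l : {dffun forall k : I, T k}) \prod_k F k (l k).
Proof.
rewrite (reindex (@dffun_of_fprod I T)); last exact/onW_bij/dffun_of_fprod_bij.
pose P k : {ffun T k -> R} := [ffun j => F k j].
transitivity (\sum_(t : fprod T) \prod_k P k (t k)); last first.
  by apply: eq_bigr => t _; apply: eq_bigr => k _; rewrite !ffunE.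
rewrite big_fprod.
transitivity (\prod_k \sum_(j in tagged_with T k) untag 0 (P k) j); last first.
  exact: bigA_distr_big_dep.
apply: eq_bigr => k _.
transitivity (\sum_(j : T k) P k j); first by apply: eq_bigr => j _; rewrite ffunE.
exact: (big_tag (fun k j => P k j)).
Qed.

Section laplace.
Variables (R : realType) (n : nat).
Local Open Scope complex_scope.
Notation Cn := 'rV[R[i]]_n.
Implicit Types (u : Cn -> R[i]) (z w : Cn).

(** All exponential moments are finite. The class is stable under multiplication by \bar w_k, so
    differentiation under the integral can be iterated. *)
Definition expint u := measurable_fun setT u /\ forall z,
  (dV_ R n).-integrable setT (fun w => (nm (u w) * expR (adot z w))%:E).

(** By the reproducing formula, f is of this form with u equal to f times the Gaussian density. *)
Definition laplace u z := cint (dV_ R n) (fun w => u w * cexp (bdot z (conjv w))).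

Let mkernel z : measurable_fun setT (fun w : Cn => cexp (bdot z (conjv w))).
Proof.
apply: cmeas_cexp; apply: cmeas_bdot; first exact: measurable_cst.
by apply: cmeas_conjv; exact: measurable_id.
Qed.

Let nm_kernel z w : nm (cexp (bdot z (conjv w))) <= expR (adot z w).
Proof.
apply: le_trans (nm_cexp_le _) _; rewrite ler_expR.
by apply: le_trans (nm_bdot_le _ _) _; rewrite adot_conjv.
Qed.

Lemma cintble_laplace u z : expint u ->
  cintble (dV_ R n) (fun w => u w * cexp (bdot z (conjv w))).
Proof.
move=> [mu iu]; apply: (cintble_dom _ _ (iu z)) => [|w]; first exact: cmeasM.
by rewrite /= nmM; apply: ler_wpM2l; [exact: nm_ge0|exact: nm_kernel].
Qed.

Let adot_add1 z k : exists z', forall w, adot z' w = adot z w + nm (w 0 k).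
Proof.
exists (\row_j (nm (z 0 j) + (j == k)%:R)%:C) => w.
rewrite /adot (eq_bigr (fun j => nm (z 0 j) * nm (w 0 j) + (j == k)%:R * nm (w 0 j))).
  rewrite big_split/=; congr (_ + _); rewrite (bigD1 k)//= eqxx mul1r big1 ?addr0// => j jk.
  by rewrite (negbTE jk) mul0r.
by move=> j _; rewrite mxE nm_real ger0_norm ?addr_ge0 ?nm_ge0// mulrDl.
Qed.

Lemma expintM u k : expint u -> expint (fun w => u w * conjc (w 0 k)).
Proof.
move=> [mu iu].
have mk : measurable_fun setT (fun w : Cn => u w * conjc (w 0 k)).
  apply: cmeasM => //; apply: cmeas_conj; apply: cmeas_coord; exact: measurable_id.
split=> // z; have [z' zE] := adot_add1 z k.
have := iu z'; apply: le_integrable => //.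
  apply/measurable_EFinP; apply: measurable_funM; first exact: cmeas_nm.
  apply: (measurableT_comp (@measurable_expR R)).
  apply: measurable_sum => j; apply: measurable_funM; first exact: measurable_cst.
  by apply: cmeas_nm; apply: cmeas_coord; exact: measurable_id.
move=> w _; rewrite !abse_EFin lee_fin !ger0_norm ?mulr_ge0 ?nm_ge0 ?expR_ge0//.
rewrite zE addrC expRD nmM nm_conj -!mulrA; apply: ler_wpM2l; first exact: nm_ge0.
apply: ler_wpM2r; first exact: expR_ge0.
by apply: le_trans (expR_ge1Dx _); rewrite lerDr.
Qed.

(** Second-order Taylor bound at h \bar w_k. The constant 4 is the 2 of [expc_taylor2] times the 2
    of x^2 <= 2 e^x; the two factors e^|w_k| come from that inequality and from the Taylor bound. *)
Let quotient_error z w k (h : R[i]) : h != 0 -> nm h <= 1 ->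
  nm (conjc (w 0 k) * cexp (bdot z (conjv w)) -
      h^-1 * (cexp (bdot (h *: 'e_k + z) (conjv w)) - cexp (bdot z (conjv w)))) <=
  nm h * 4 * expR (adot z w + nm (w 0 k) + nm (w 0 k)).
Proof.
move=> h0 h1; set x := nm (w 0 k); set a := conjc (w 0 k); set E := cexp _.
have x0 : 0 <= x := nm_ge0 _.
have -> : bdot (h *: 'e_k + z) (conjv w) = h * a + bdot z (conjv w).
  rewrite bdotDl bdotZl; congr (h * _ + _).
  rewrite /bdot (bigD1 k)//= big1 ?addr0 => [|j jk]; first by rewrite mxE !eqxx mul1r conjvE.
  by rewrite mxE (negbTE jk) andbF mul0r.
rewrite cexpD -/E.
have -> : a * E - h^-1 * (cexp (h * a) * E - E) = - (h^-1 * E) * (cexp (h * a) - 1 - h * a).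
  by field.
rewrite nmM nmN nmM nmV.
have nh : 0 < nm h.
  by rewrite lt_neqAle nm_ge0 andbT; apply: contra h0 => /eqP/esym/nm_eq0 ->.
have H1 := expc_taylor2 (h * a).
have na : nm a = x by rewrite nm_conj.
rewrite nmM na in H1.
have H2 : 2 * (nm h * x) ^+ 2 * expR (nm h * x) <= nm h ^+ 2 * (4 * expR (x + x)).
  have e1 : expR (nm h * x) <= expR x by rewrite ler_expR; apply: ler_piMl.
  have e2 : x ^+ 2 <= 2 * expR x.
    have := expR_ge1Dxn 1 x0; rewrite (_ : 2`! = 2)%N// => H.
    have {}H : x ^+ 2 / 2 <= expR x by apply: le_trans H; rewrite lerDr.
    by move: H; lra.
  rewrite exprMn (_ : 2 * (nm h ^+ 2 * x ^+ 2) * _ = nm h ^+ 2 * (2 * (x ^+ 2 * expR (nm h * x)))); last by ring.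
  apply: ler_wpM2l; first by rewrite exprn_ge0// ltW.
  rewrite expRD (_ : 4 * _ = 2 * (2 * expR x * expR x)); last by ring.
  apply: ler_wpM2l => //; by apply: ler_pM => //; exact: exprn_ge0.
have H3 : nm E <= expR (adot z w) := nm_kernel z w.
have c0 : 0 <= (nm h)^-1 * nm E by rewrite mulr_ge0 ?invr_ge0 ?nm_ge0.
apply: le_trans (ler_wpM2l c0 (le_trans H1 H2)) _.
rewrite -addrA (expRD (adot z w)).
have -> : (nm h)^-1 * nm E * (nm h ^+ 2 * (4 * expR (x + x))) = nm h * 4 * (nm E * expR (x + x)).
  by field; rewrite gt_eqF.
apply: ler_wpM2l; first by rewrite mulr_ge0// ltW.
by apply: ler_wpM2r => //; exact: expR_ge0.
Qed.

Lemma pderiv_laplace u k : expint u ->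
  pderiv k (laplace u) = laplace (fun w => u w * conjc (w 0 k)).
Proof.
move=> eu; have [mu iu] := eu; apply/funext => z; rewrite /pderiv /derive.
(* Raising |z_k| by 2 in all absorbs the two factors e^|w_k| of [quotient_error]. *)
have [z1 z1E] := adot_add1 z k; have [z2 z2E] := adot_add1 z1 k.
pose J := \int[dV_ R n]_w (nm (u w) * expR (adot z2 w)).
have J0 : 0 <= J.
  by apply: Rintegral_ge0 => w _; rewrite mulr_ge0 ?nm_ge0 ?expR_ge0.
set l := laplace (fun w => u w * conjc (w 0 k)) z; apply: cvg_lim; first exact: norm_hausdorff.
apply/cvgrPdist_le => e /gt0_complexE[-> e0].
(* 8 is the 2 of [nm_cint_le] times the 4 of [quotient_error]. *)
pose r := Num.min 1 (Re e / (8 * J + 1)).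
have J1 : 0 < 8 * J + 1 by lra.
have r0 : 0 < r by rewrite lt_min ltr01 divr_gt0.
apply/nbhs_ballP; exists r%:C; first exact: gt0_real.
move=> h; rewrite /ball/= sub0r normrN nmE ltcR => hr h0.
have h1 : nm h <= 1 by apply: ltW; apply: lt_le_trans hr _; rewrite ge_min lexx.
have h2 : nm h <= Re e / (8 * J + 1) by apply: ltW; apply: lt_le_trans hr _; rewrite ge_min lexx orbT.
rewrite nmE lecR.
have E : l - h^-1 *: (laplace u (h *: 'e_k + z) - laplace u z) =
    cint (dV_ R n) (fun w => u w * (conjc (w 0 k) * cexp (bdot z (conjv w)) -
      h^-1 * (cexp (bdot (h *: 'e_k + z) (conjv w)) - cexp (bdot z (conjv w))))).
  rewrite /l /laplace.
  have i1 := cintble_laplace z (expintM k eu).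
  have i2 := cintble_laplace z eu; have i3 := cintble_laplace (h *: 'e_k + z) eu.
  rewrite -cintB// -[X in _ - X]cintZ; last exact: cintbleB.
  rewrite -cintB//; last by apply: cintbleZ; exact: cintbleB.
  by apply: eq_cint => w; ring.
rewrite [X in nm X]E.
have ib : (dV_ R n).-integrable setT (EFin \o (fun w => nm h * 4 * (nm (u w) * expR (adot z2 w)))).
  have := integrableZl measurableT (nm h * 4) (iu z2).
  by apply: eq_integrable => // w _.
apply: (@le_trans _ _ (2 * \int[dV_ R n]_w (nm h * 4 * (nm (u w) * expR (adot z2 w))))).
  apply: nm_cint_le => //; last first.
    move=> w; rewrite nmM [leRHS]mulrCA z2E z1E; apply: ler_wpM2l; first exact: nm_ge0.
    exact: quotient_error.
  have := cintbleB (cintble_laplace z (expintM k eu)) (cintbleZ h^-1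
    (cintbleB (cintble_laplace (h *: 'e_k + z) eu) (cintble_laplace z eu))).
  by congr cintble; apply/funext => w; ring.
rewrite RintegralZl -/J//; last exact: iu.
apply: (@le_trans _ _ (nm h * (8 * J + 1))).
  have := nm_ge0 h; set x := nm h => x0; nra.
by rewrite -ler_pdivlMr.
Qed.

Let iter_pderiv_laplace u k m : expint u ->
  expint (fun w => u w * conjc (w 0 k) ^+ m) /\
  iter m (pderiv k) (laplace u) = laplace (fun w => u w * conjc (w 0 k) ^+ m).
Proof.
move=> eu; elim: m => [|m [em IH]].
  by rewrite (_ : (fun w => _) = u)//; apply/funext => w; rewrite expr0 mulr1.
have E : (fun w : Cn => u w * conjc (w 0 k) ^+ m.+1) =
         (fun w => u w * conjc (w 0 k) ^+ m * conjc (w 0 k)).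
  by apply/funext => w; rewrite exprSr mulrA.
by rewrite E; split; [exact: expintM|rewrite iterS IH pderiv_laplace].
Qed.

Lemma mderiv_laplace u (j : 'I_n -> nat) : expint u ->
  expint (fun w => u w * mpow (conjv w) j) /\
  mderiv j (laplace u) = laplace (fun w => u w * mpow (conjv w) j).
Proof.
move=> eu; rewrite /mderiv.
suff H (s : seq 'I_n) : expint (fun w => u w * \prod_(k <- s) conjc (w 0 k) ^+ j k) /\
    foldr (fun k h => iter (j k) (pderiv k) h) (laplace u) s =
    laplace (fun w => u w * \prod_(k <- s) conjc (w 0 k) ^+ j k).
  rewrite (_ : (fun w => _) = (fun w => u w * \prod_(k <- enum 'I_n) conjc (w 0 k) ^+ j k))//.
  apply/funext => w; rewrite big_enum/=; congr (_ * _).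
  by apply: eq_bigr => k _; rewrite conjvE.
elim: s => [|k s [es IH]].
  by rewrite (_ : (fun w => _) = u)//; apply/funext => w; rewrite big_nil mulr1.
have [e1 E1] := iter_pderiv_laplace k (j k) es.
rewrite (_ : (fun w => _) = (fun w =>
  u w * \prod_(k <- s) conjc (w 0 k) ^+ j k * conjc (w 0 k) ^+ j k)).
  by split=> //=; rewrite IH.
by apply/funext => w; rewrite big_cons -mulrA [X in _ = _ * X]mulrC.
Qed.

Section creation_laplace.
Variables (u : Cn -> R[i]) (i : {ffun 'I_n -> nat}) (z : Cn).
Hypothesis eu : expint u.

Let c (l : {dffun forall k : 'I_n, 'I_(i k).+1}) : R[i] :=
  (\prod_(k < n) 'C(i k, l k))%:R * (-1) ^+ (\sum_(k < n) (i k - l k))%N *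
  mpow (conjv z) (fun k => l k).

Let em (l : {dffun forall k : 'I_n, 'I_(i k).+1}) :=
  mderiv_laplace (fun k => i k - l k)%N eu.

Let powE w : mpow (conjv z - conjv w) i =
  \sum_l c l * mpow (conjv w) (fun k => i k - l k)%N.
Proof.
rewrite /mpow (eq_bigr (fun k => \sum_(j < (i k).+1)
   ('C(i k, j)%:R * (-1) ^+ (i k - j) * (conjv z) 0 k ^+ j * (conjv w) 0 k ^+ (i k - j)))); last first.
  move=> k _; rewrite !mxE addrC exprDn; apply: eq_bigr => j _.
  by rewrite (exprNn (conjc (w 0 k))) -mulr_natl !mulrA mulrAC.
rewrite prod_sum_dffun; apply: eq_bigr => l _.
by rewrite !big_split/= /c natr_prod prodrXr.
Qed.

Let integrandE w : u w * mpow (conjv z - conjv w) i * cexp (bdot z (conjv w)) =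
  \sum_l c l * (u w * mpow (conjv w) (fun k => i k - l k)%N * cexp (bdot z (conjv w))).
Proof.
by rewrite powE mulr_sumr mulr_suml; apply: eq_bigr => l _; ring.
Qed.

Lemma cintble_creation : cintble (dV_ R n)
  (fun w => u w * mpow (conjv z - conjv w) i * cexp (bdot z (conjv w))).
Proof.
under eq_fun do rewrite integrandE.
by apply: cintble_sum => l; apply: cintbleZ; exact: cintble_laplace (em l).1.
Qed.

Lemma creation_laplace : creation i (laplace u) z =
  cint (dV_ R n) (fun w => u w * mpow (conjv z - conjv w) i * cexp (bdot z (conjv w))).
Proof.
under eq_cint do rewrite integrandE.
rewrite cint_sum; last by move=> l; apply: cintbleZ; exact: cintble_laplace (em l).1.
apply: eq_bigr => l _; rewrite (em l).2 cintZ//; exact: cintble_laplace (em l).1.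
Qed.

End creation_laplace.

End laplace.

(** * The symbol as an integral *)

Lemma conjM (R : realType) (a b : R[i]) : conjc (a * b) = conjc a * conjc b.
Proof. exact: rmorphM. Qed.

Section regular_functions.
Variables (R : realType) (n : nat).
Local Open Scope complex_scope.
Notation Cn := 'rV[R[i]]_n.
Implicit Types (h f g : Cn -> R[i]) (z w a : Cn).

(** What the integral formulas use of [Sym] and [entire]: stable under products and translations,
    and satisfied by the kernels. *)
Definition regular h := [/\ measurable_fun setT h, holo h & subgaussian h].

Lemma regular_Sym h : Sym h -> entire h -> regular h.
Proof.
by move=> Sh eh; split; [exact: Sh.1|exact: entire_holo|exact: Sym_growth].
Qed.

Lemma regularM f g : regular f -> regular g -> regular (fun w => f w * g w).
Proof.
move=> [mf hf sf] [mg hg sg]; split; [exact: cmeasM|exact: holoM|].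
move=> c c0; have c20 : 0 < c / 2 by rewrite divr_gt0.
have [K [K0 fK]] := sf _ c20; have [L [L0 gL]] := sg _ c20.
exists (K * L); split=> [|w]; first exact: mulr_ge0.
rewrite nmM; apply: le_trans (ler_pM (nm_ge0 _) (nm_ge0 _) (fK w) (gL w)) _.
rewrite (_ : c * sqnorm w = c / 2 * sqnorm w + c / 2 * sqnorm w); last by field.
by rewrite expRD le_eqVlt; apply/orP; left; apply/eqP; ring.
Qed.

Lemma regular_shift h a : regular h -> regular (fun w => h (w - a)).
Proof.
move=> [mh hh sh]; split; last 1 first.
- move=> c c0; have c20 : 0 < c / 2 by rewrite divr_gt0.
  have [K [K0 hK]] := sh _ c20.
  exists (K * expR (c * sqnorm a)); split=> [|w]; first by rewrite mulr_ge0 ?expR_ge0.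
  apply: le_trans (hK _) _; rewrite -[leRHS]mulrA -expRD; apply: ler_wpM2l => //.
  by rewrite ler_expR; have := sqnormB w a; have := c0; nra.
- apply: (measurableT_comp mh); apply: cmeas_rowB; first exact: measurable_id.
  exact: measurable_cst.
- exact: holo_shift.
Qed.

Lemma regular_cexp a : regular (fun w => cexp (bdot w a)).
Proof.
split; last 1 first.
- move=> c c0; exists (expR ((4 * c)^-1 * sqnorm a)); split=> [|w]; first exact: expR_ge0.
  apply: le_trans (nm_cexp_le _) _; rewrite -expRD ler_expR.
  apply: le_trans (nm_bdot_le _ _) _; rewrite adotC.
  by apply: le_trans (adot_le _ _ c0) _; rewrite addrC.
- by apply: cmeas_cexp; apply: cmeas_bdot; [exact: measurable_id|exact: measurable_cst].
- exact: holo_cexp_bdot.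
Qed.

Let quarter : 0 < 4^-1 :> R. Proof. by rewrite invr_gt0. Qed.

Lemma regular_reproducing h z : regular h -> cint (dV_ R n) (rep_integrand h z) = h z.
Proof.
by move=> [mh hh sh]; have [K [_ hK]] := sh _ quarter; exact: reproducing hK.
Qed.

Lemma regular_cintble_rep h z : regular h -> cintble (dV_ R n) (rep_integrand h z).
Proof.
by move=> [mh hh sh]; have [K [_ hK]] := sh _ quarter; exact: cintble_rep hK.
Qed.

Lemma regular_expint h : regular h -> expint (fun w => h w * (gauss_density w)%:C).
Proof.
move=> [mh hh sh]; split=> [|z]; last exact: integrable_subgaussian.
by apply: cmeasM => //; apply: cmeas_real; apply: cmeas_gauss_density; exact: measurable_id.
Qed.

Lemma regular_laplace h : regular h -> laplace (fun w => h w * (gauss_density w)%:C) = h.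
Proof.
move=> rh; apply/funext => z; rewrite -[RHS]regular_reproducing//.
by apply: eq_cint => w; rewrite /rep_integrand mulrAC.
Qed.

(** Conjugation turns e^(z . \bar w) into the kernel K_z(w), so that integrals of conjugates of
    holomorphic functions are also evaluated by the reproducing formula. *)
Lemma conj_rep h z w : conjc (rep_integrand h z w) =
  conjc (h w) * cexp (bdot w (conjv z)) * (gauss_density w)%:C.
Proof.
rewrite /rep_integrand 2!conjM conj_cexp conj_bdot conjvK bdotC; congr (_ * _).
by apply: complex_eqP; rewrite !ReImE ?oppr0.
Qed.

End regular_functions.

Section wick_integral.
Variables (R : realType) (n : nat).
Local Open Scope complex_scope.
Notation Cn := 'rV[R[i]]_n.
Variables f g : Cn -> R[i].
Hypotheses (rf : regular f) (rg : regular g).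
Implicit Types (z w v a : Cn).

Definition wick_integrand z w : R[i] := rep_integrand f z w * conjc (g (z - w)).

Definition wick_integral z : R[i] := cint (dV_ R n) (wick_integrand z).

Let mfst k : measurable_fun setT (fun p : Cn * Cn => p.1 0 k).
Proof. by apply: cmeas_coord; exact: measurable_fst. Qed.

Let msnd k : measurable_fun setT (fun p : Cn * Cn => p.2 0 k).
Proof. by apply: cmeas_coord; exact: measurable_snd. Qed.

(** In p = (v, w), v carries the moments of g and w the integral for f, and the [Xw] sum to v .
    (\bar z - \bar w). Expanding their exponential yields the terms of [wick_term]; integrating it
    whole in v yields the conjugate of g(z - w). *)
Let Gw z (p : Cn * Cn) : R[i] :=
  conjc (g p.1 * (gauss_density p.1)%:C) * rep_integrand f z p.2.

Let Xw z (k : 'I_n) (p : Cn * Cn) : R[i] := conjc (z 0 k - p.2 0 k) * p.1 0 k.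

Lemma integrable_gauss2_Cn (a K : R) : 0 < a -> (dV_ R n \x dV_ R n)%E.-integrable setT
  (fun p : Cn * Cn => (K * (expR (- a * sqnorm p.1) * expR (- a * sqnorm p.2)))%:E).
Proof.
move=> a0; have X := integrable_prod (integrable_gauss_Cn n a0) (integrable_gauss_Cn n a0).
by have := integrableZl measurableT K X; apply: eq_integrable => // p _.
Qed.

Let mrep d (T : measurableType d) (h : Cn -> R[i]) (x w : T -> Cn) : regular h ->
  measurable_fun setT x -> measurable_fun setT w ->
  measurable_fun setT (fun p => rep_integrand h (x p) (w p)).
Proof.
move=> [mh _ _] mx mw; apply: cmeasM; last first.
  by apply: cmeas_real; exact: cmeas_gauss_density.
apply: cmeasM; first exact: (measurableT_comp mh).
by apply: cmeas_cexp; apply: cmeas_bdot => //; exact: cmeas_conjv.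
Qed.

Let mGw z : measurable_fun setT (Gw z).
Proof.
have [mg _ _] := rg; apply: cmeasM.
  apply: cmeas_conj; apply: cmeasM; first by apply: (measurableT_comp mg); exact: measurable_fst.
  by apply: cmeas_real; apply: cmeas_gauss_density; exact: measurable_fst.
exact: (mrep rf (@measurable_cst _ _ _ _ _ z) (@measurable_snd _ _ _ _)).
Qed.

Let mXw z k : measurable_fun setT (Xw z k).
Proof.
apply: cmeasM; last exact: mfst.
by apply: cmeas_conj; apply: cmeasB; [exact: cmeas_cst|exact: msnd].
Qed.

Let nmsum_Xw z p : nmsum (fun k => Xw z k p) <= adot z p.1 + adot p.1 p.2.
Proof.
rewrite /nmsum /adot -big_split/=; apply: ler_sum => k _.
rewrite nmM nm_conj [nm (p.1 0 k) * _]mulrC -mulrDl; apply: ler_wpM2r; first exact: nm_ge0.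
exact: nmB.
Qed.

(** Since 3/2 |v||w| <= 3/4 |v|^2 + 3/4 |w|^2, a quarter of each Gaussian remains. In v, g and the
    pairing with z take 1/16 each; in w, f and e^(z . \bar w) do. This leaves 1/8 on both sides, and
    the terms in z are collected in e^(20|z|^2). *)
Let iGw z : (dV_ R n \x dV_ R n)%E.-integrable setT
  (fun p => (nm (Gw z p) * expR (3 / 2 * nmsum (fun k => Xw z k p)))%:E).
Proof.
have [_ _ sf] := rf; have [_ _ sg] := rg.
have c0 : 0 < 1 / 16 :> R by rewrite divr_gt0.
have [K [K0 fK]] := sf _ c0; have [L [L0 gL]] := sg _ c0.
have c8 : 0 < 1 / 8 :> R by rewrite divr_gt0.
have := integrable_gauss2_Cn (L * K * (pi ^- n) ^+ 2 * expR (20 * sqnorm z)) c8.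
apply: le_integrable => //.
  apply/measurable_EFinP; apply: measurable_funM; first exact: cmeas_nm.
  apply: (measurableT_comp (@measurable_expR R)); apply: measurable_funM => //.
  by apply: measurable_sum => k; apply: cmeas_nm.
move=> [v w] _; rewrite !abse_EFin lee_fin ger0_norm ?mulr_ge0 ?nm_ge0 ?expR_ge0//.
apply: le_trans (ler_norm _); rewrite /Gw /rep_integrand /=.
have rho (x : Cn) : nm ((gauss_density x)%:C : R[i]) = pi ^- n * expR (- sqnorm x).
  by rewrite nm_real ger0_norm ?gauss_density_ge0.
rewrite nmM nm_conj nmM rho nmM nmM rho.
have P0 : 0 <= pi ^- n :> R by rewrite invr_ge0 exprn_ge0// pi_ge0.
have E1 : nm (cexp (bdot z (conjv w))) <= expR (1 / 16 * sqnorm w + 4 * sqnorm z).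
  apply: le_trans (nm_cexp_le _) _; rewrite ler_expR.
  apply: le_trans (nm_bdot_le _ _) _; rewrite adot_conjv.
  by apply: le_trans (adot_le _ _ c0) _; rewrite lerD2l; have := sqnorm_ge0 z; lra.
have E2 : expR (3 / 2 * nmsum (fun k => Xw z k (v, w))) <=
    expR (1 / 16 * sqnorm v + 16 * sqnorm z + 3 / 4 * sqnorm v + 3 / 4 * sqnorm w).
  have h2 : 0 < 1 / 2 :> R by rewrite divr_gt0.
  (* Multiplied by 3/2, this weight becomes the 1/16 allotted to the pairing of z with v. *)
  have c24 : 0 < 1 / 24 :> R by rewrite divr_gt0.
  rewrite ler_expR; have /= := nmsum_Xw z (v, w).
  have := adot_le z v c24; have := adot_le v w h2.
  rewrite (_ : (4 * (1 / 2))^-1 = 1 / 2 :> R); last by lra.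
  rewrite (_ : (4 * (1 / 24))^-1 = 6 :> R); last by lra.
  have := sqnorm_ge0 z; lra.
have A1 := ler_pM (nm_ge0 _) (nm_ge0 _) (fK w) E1.
have B1 : 0 <= pi ^- n * expR (- sqnorm w) by rewrite mulr_ge0 ?expR_ge0.
have B2 : 0 <= pi ^- n * expR (- sqnorm v) by rewrite mulr_ge0 ?expR_ge0.
have A2 := ler_wpM2r B1 A1; have A3 := ler_wpM2r B2 (gL v).
have A4 := ler_pM (mulr_ge0 (nm_ge0 _) B2) (mulr_ge0 (mulr_ge0 (nm_ge0 _) (nm_ge0 _)) B1) A3 A2.
have A5 := ler_pM (mulr_ge0 (mulr_ge0 (nm_ge0 _) B2) (mulr_ge0 (mulr_ge0 (nm_ge0 _) (nm_ge0 _)) B1))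
  (expR_ge0 _) A4 E2.
apply: le_trans A5 _; rewrite !expRD le_eqVlt; apply/orP; left; apply/eqP.
set P := pi ^- n.
transitivity (L * K * P ^+ 2 * (expR (4 * sqnorm z) * expR (16 * sqnorm z)) *
  ((expR (1 / 16 * sqnorm v) * expR (1 / 16 * sqnorm v) * expR (3 / 4 * sqnorm v) * expR (- sqnorm v)) *
   (expR (1 / 16 * sqnorm w) * expR (1 / 16 * sqnorm w) * expR (3 / 4 * sqnorm w) * expR (- sqnorm w))));
  first by ring.
have e (x : R) : expR (1 / 16 * x) * expR (1 / 16 * x) * expR (3 / 4 * x) * expR (- x) =
    expR (- (1 / 8) * x) by rewrite -!expRD; congr expR; lra.
by rewrite !e -expRD; congr (_ * expR _ * _); lra.
Qed.

Let GwX z p i : Gw z p * expterm (fun k => Xw z k p) i =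
  conjc (g p.1 * (gauss_density p.1)%:C * expterm (fun k => conjc (p.1 0 k)) i) *
  (f p.2 * (gauss_density p.2)%:C * mpow (conjv z - conjv p.2) i * cexp (bdot z (conjv p.2))).
Proof.
rewrite expterm_scale (_ : \prod_k _ = mpow (conjv z - conjv p.2) i); last first.
  by apply: eq_bigr => k _; rewrite !mxE rmorphB.
rewrite /Gw [in RHS]conjM (_ : conjc (expterm _ i) = expterm (fun k => p.1 0 k) i).
  rewrite /rep_integrand; ring.
rewrite /expterm; apply: etrans (rmorph_prod _ _ _ _) _; apply: eq_bigr => k _.
by rewrite rmorphM rmorphXn fmorphV rmorph_nat; congr (_ ^+ _ / _); exact: conjcK.
Qed.

Let GwXsum z p : Gw z p * cexp (\sum_k Xw z k p) =
  rep_integrand f z p.2 * conjc (rep_integrand g (z - p.2) p.1).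
Proof.
rewrite conj_rep /Gw conjM (_ : \sum_k _ = bdot p.1 (conjv (z - p.2))).
  rewrite [conjc (_%:C)](_ : _ = (gauss_density p.1)%:C); first by ring.
  by apply: complex_eqP; rewrite !ReImE ?oppr0.
by apply: eq_bigr => k _; rewrite /Xw conjvE !mxE mulrC.
Qed.

Lemma cint_prodM (u v : Cn -> R[i]) : cintble (dV_ R n) u -> cintble (dV_ R n) v ->
  cintble (dV_ R n \x dV_ R n)%E (fun p => u p.1 * v p.2) ->
  cint (dV_ R n \x dV_ R n)%E (fun p => u p.1 * v p.2) = cint (dV_ R n) u * cint (dV_ R n) v.
Proof.
move=> iu iv iuv; rewrite (cfubini1 iuv); last by move=> x; exact: (cintbleZ (u x) iv).
rewrite [RHS]mulrC -(cintZ (cint (dV_ R n) v) iu); apply: eq_cint => x.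
by rewrite [RHS]mulrC; exact: (cintZ (u x) iv).
Qed.

Lemma cintble_wick z : cintble (dV_ R n) (wick_integrand z).
Proof.
have [mf _ sf] := rf; have [mg _ sg] := rg.
(* By |z - w|^2 <= 2|z|^2 + 2|w|^2, f and g together take 1/16 + 2/16 of |w|^2, below the quarter
   that [cintble_rep] allows. *)
have c0 : 0 < 1 / 16 :> R by rewrite divr_gt0.
have [K [K0 fK]] := sf _ c0; have [L [L0 gL]] := sg _ c0.
have : cintble (dV_ R n) (rep_integrand (fun w => f w * conjc (g (z - w))) z).
  apply: (@cintble_rep _ _ _ (K * (L * expR (1 / 8 * sqnorm z)))) => [|w].
    apply: cmeasM => //; apply: cmeas_conj; apply: (measurableT_comp mg).
    by apply: cmeas_rowB; [exact: measurable_cst|exact: measurable_id].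
  rewrite nmM nm_conj; apply: le_trans (ler_pM (nm_ge0 _) (nm_ge0 _) (fK w) (gL _)) _.
  rewrite -!mulrA; apply: ler_wpM2l => //; rewrite mulrCA; apply: ler_wpM2l => //.
  by rewrite -!expRD ler_expR; have := sqnormB z w; have := sqnorm_ge0 w; lra.
by congr cintble; apply/funext => w; rewrite /rep_integrand /wick_integrand /rep_integrand; ring.
Qed.

Lemma wick_cvg z :
  partial_sum (wick_term g f z) @ totally --> wick_integral z.
Proof.
have [mg hg sg] := rg; have gE := coefsE mg sg hg.
have H := exp_exchange (mGw z) (mXw z) (iGw z).
have -> : wick_integral z = cint (dV_ R n \x dV_ R n)%E
    (fun p => Gw z p * cexp (\sum_k Xw z k p)).
  have i := cintble_cexp_sum (mGw z) (mXw z) (iGw z).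
  (* Integration in v first: this is the conjugated reproducing formula for g at z - w. *)
  have sec (w : Cn) : cintble (dV_ R n) (fun v => Gw z (v, w) * cexp (\sum_k Xw z k (v, w))).
    have := cintbleZ (rep_integrand f z w) (cintble_conj (regular_cintble_rep (z - w) rg)).
    by congr cintble; apply/funext => v; rewrite (GwXsum z (v, w)).
  rewrite (cfubini2 i sec); apply: eq_cint => w.
  apply: etrans (eq_cint _ (fun v => esym (GwXsum z (v, w)))).
  have ir := regular_cintble_rep (z - w) rg.
  apply: etrans (esym (cintZ (rep_integrand f z w) (cintble_conj ir))).
  by rewrite cint_conj// regular_reproducing.
apply: eq_totally_cvg H => i.
have eu := regular_expint rf.
(* The term of index i is a moment integral in v times an integral in w, which is the double
   integral of one term of the expansion. *)
rewrite /wick_term gE -{1}(regular_laplace rf) creation_laplace//.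
have ig : cintble (dV_ R n) (fun w => g w * (gauss_density w)%:C * expterm (fun k => conjc (w 0 k)) i).
  exact: cintble_moment.
have iF : cintble (dV_ R n) (fun w => f w * (gauss_density w)%:C *
   mpow (conjv z - conjv w) i * cexp (bdot z (conjv w))).
  exact: cintble_creation.
rewrite /moment -(cint_conj ig) -(cint_prodM (cintble_conj ig) iF).
  by apply: eq_cint => p; rewrite GwX.
have := cintble_expterm (mGw z) (mXw z) (iGw z) i.
by congr cintble; apply/funext => p; rewrite GwX.
Qed.

End wick_integral.

(** * Toeplitz operators on kernels *)

Section toeplitz_kernels.
Variables (R : realType) (n : nat).
Local Open Scope complex_scope.
Notation Cn := 'rV[R[i]]_n.
Implicit Types (z w a : Cn).

(** Linearity reduces a Toeplitz operator on the span to single kernels, where T_phi K_a is the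
    integral of [rep_integrand] for phi K_a. *)
Lemma toeplitz_span (phi : Cn -> R[i]) (v : Cn -> Cn -> R[i]) :
  (forall a z, cintble (dV_ R n) (rep_integrand (fun w => phi w * fock_kernel a w) z)) ->
  (forall a z, cint (dV_ R n) (rep_integrand (fun w => phi w * fock_kernel a w) z) = v a z) ->
  forall m (c : 'I_m -> R[i]) (a : 'I_m -> Cn),
    toeplitz_converges phi (fun w => \sum_(j < m) c j * fock_kernel (a j) w) /\
    toeplitz phi (fun w => \sum_(j < m) c j * fock_kernel (a j) w) =
    (fun z => \sum_(j < m) c j * v (a j) z).
Proof.
move=> iphi phiv m c a.
have E z : toeplitz_integrand phi (fun w => \sum_(j < m) c j * fock_kernel (a j) w) z =
    (fun w => \sum_(j < m) c j * rep_integrand (fun w => phi w * fock_kernel (a j) w) z w).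
  apply/funext => w; rewrite /toeplitz_integrand mulr_sumr !mulr_suml.
  by apply: eq_bigr => j _; rewrite /rep_integrand; ring.
have ij z j : cintble (dV_ R n) (fun w => c j * rep_integrand (fun w => phi w * fock_kernel (a j) w) z w).
  exact: cintbleZ.
split=> [z|]; first by rewrite dV_integrableE E; exact: cintble_sum.
apply/funext => z; rewrite /toeplitz dV_integralE E cint_sum//.
by apply: eq_bigr => j _; rewrite cintZ// phiv.
Qed.

Variables f g : Cn -> R[i].
Hypotheses (rf : regular f) (rg : regular g).

Let rkernel a : regular (fock_kernel a).
Proof. exact: regular_cexp. Qed.

(** Under conjugation K_a and e^(z . \bar w) exchange roles. The reproducing formula for g K_z at a
    then shows that K_a is an eigenvector of the operator with symbol \bar g. *)
Let conj_repE a z : rep_integrand (fun w => conjc (g w) * fock_kernel a w) z =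
  (fun w => conjc (rep_integrand (fun w => g w * fock_kernel z w) a w)).
Proof.
apply/funext => w; rewrite conj_rep conjM conj_cexp conj_bdot conjvK.
by rewrite /rep_integrand /fock_kernel [bdot (conjv w) z]bdotC; ring.
Qed.

Lemma cintble_conj_kernel a z :
  cintble (dV_ R n) (rep_integrand (fun w => conjf g w * fock_kernel a w) z).
Proof.
by rewrite conj_repE; apply/cintble_conj/regular_cintble_rep/regularM.
Qed.

Lemma cint_conj_kernel a z :
  cint (dV_ R n) (rep_integrand (fun w => conjf g w * fock_kernel a w) z) = conjc (g a) * fock_kernel a z.
Proof.
have rgk := regularM rg (rkernel z).
rewrite conj_repE cint_conj; last exact: regular_cintble_rep.
rewrite regular_reproducing// conjM; congr (_ * _).
by rewrite /fock_kernel conj_cexp conj_bdot conjvK bdotC.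
Qed.

Let psi_factor a z w : R[i] :=
  fock_kernel a w * cexp (bdot z (conjv w)) * (gauss_density w)%:C.

(** The double integrand of T_s K_a at z: the first variable belongs to the operator, the second to
    the integral formula for s. *)
Let psi a z (p : Cn * Cn) : R[i] := psi_factor a z p.1 * wick_integrand f g p.1 p.2.

Let nmM_exp (u v : R[i]) (A B s t : R) : nm u <= A * expR s -> nm v <= B * expR t ->
  nm (u * v) <= A * B * expR (s + t).
Proof.
move=> uA vB; rewrite nmM expRD mulrACA; exact: ler_pM (nm_ge0 _) (nm_ge0 _) uA vB.
Qed.

Let nm_cexp_bdot (e : R) z w : 0 < e ->
  nm (cexp (bdot z w)) <= 1 * expR (e * sqnorm w + (4 * e)^-1 * sqnorm z).
Proof.
move=> e0; rewrite mul1r; apply: le_trans (nm_cexp_le _) _; rewrite ler_expR.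
exact: le_trans (nm_bdot_le _ _) (adot_le _ _ e0).
Qed.

Let sqnorm_conj z : sqnorm (conjv z) = sqnorm z.
Proof. by rewrite !sqnormE; apply: eq_bigr => k _; rewrite conjvE nm_conj. Qed.

Let nm_rho w : nm ((gauss_density w)%:C : R[i]) <= pi ^- n * expR (- sqnorm w).
Proof. by rewrite nm_real ger0_norm ?gauss_density_ge0. Qed.

Let mpsi a z : measurable_fun setT (psi a z).
Proof.
have [mf _ _] := rf; have [mg _ _] := rg.
have m1 : measurable_fun setT (fst : Cn * Cn -> Cn) := measurable_fst.
have m2 : measurable_fun setT (snd : Cn * Cn -> Cn) := measurable_snd.
have mc (v : Cn) : measurable_fun setT (fun _ : Cn * Cn => v) := measurable_cst v.
apply: cmeasM; first apply: cmeasM; first apply: cmeasM.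
- by apply: cmeas_cexp; apply: cmeas_bdot.
- by apply: cmeas_cexp; apply: cmeas_bdot => //; exact: cmeas_conjv.
- by apply: cmeas_real; exact: cmeas_gauss_density.
apply: cmeasM; last first.
  by apply: cmeas_conj; apply: (measurableT_comp mg); exact: cmeas_rowB.
apply: cmeasM; last by apply: cmeas_real; exact: cmeas_gauss_density.
apply: cmeasM; first exact: (measurableT_comp mf).
by apply: cmeas_cexp; apply: cmeas_bdot => //; exact: cmeas_conjv.
Qed.

(** The kernel between x and w takes half of each Gaussian, and g(x - w) takes 1/8 of each. In x,
    K_a and e^(z . \bar x) take 1/16 each, leaving exactly 1/4; in w, f takes 1/16, leaving 5/16. *)
Let cintble_psi a z : cintble (dV_ R n \x dV_ R n)%E (psi a z).
Proof.
have [_ _ sf] := rf; have [_ _ sg] := rg.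
have c0 : 0 < 1 / 16 :> R by rewrite divr_gt0.
have h0 : 0 < 1 / 2 :> R by rewrite divr_gt0.
have q0 : 0 < 1 / 4 :> R by rewrite divr_gt0.
have [K [K0 fK]] := sf _ c0; have [L [L0 gL]] := sg _ c0.
pose P : R := pi ^- n.
have P0 : 0 <= P by rewrite invr_ge0 exprn_ge0// pi_ge0.
apply: (cintble_dom (mpsi a z) _
  (integrable_gauss2_Cn n (P * (K * P * L) * expR (4 * sqnorm a + 4 * sqnorm z)) q0)).
move=> [x w] /=.
have gL' : nm (conjc (g (x - w))) <= L * expR (1 / 16 * sqnorm (x - w)) by rewrite nm_conj.
have B1 := nm_cexp_bdot (conjv a) x c0; rewrite bdotC in B1.
have B2 := nm_cexp_bdot z (conjv x) c0; have B3 := nm_cexp_bdot x (conjv w) h0.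
have := nmM_exp (nmM_exp (nmM_exp B1 B2) (nm_rho x))
  (nmM_exp (nmM_exp (nmM_exp (fK w) B3) (nm_rho w)) gL').
rewrite -/(fock_kernel a x) -/(rep_integrand f x w) !sqnorm_conj => H; apply: le_trans H _.
rewrite -/P !mul1r mulr1 -[leRHS]mulrA -!expRD.
apply: ler_wpM2l; first by rewrite !mulr_ge0.
rewrite ler_expR (_ : (4 / 16)^-1 = 4 :> R); last by lra.
rewrite (_ : (4 / 2)^-1 = 1 / 2 :> R); last by lra.
have := sqnormB x w; have := sqnorm_ge0 w; lra.
Qed.

Let rep_wickE a z : rep_integrand (fun x => wick_integral f g x * fock_kernel a x) z =
  (fun x => cint (dV_ R n) (fun w => psi a z (x, w))).
Proof.
apply/funext => x; apply: etrans (esym (cintZ (psi_factor a z x) (cintble_wick rf rg x))).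
rewrite /rep_integrand /wick_integral /psi_factor; ring.
Qed.

Let psi1 a z x : cintble (dV_ R n) (fun w => psi a z (x, w)).
Proof. exact: (cintbleZ (psi_factor a z x) (cintble_wick rf rg x)). Qed.

Lemma cintble_wick_kernel a z :
  cintble (dV_ R n) (rep_integrand (fun x => wick_integral f g x * fock_kernel a x) z).
Proof.
by rewrite rep_wickE; exact: (cintble_fubini1 (cintble_psi a z) (psi1 a z)).
Qed.

(** In x this is the conjugate of a reproducing integrand at w + a. Its value there, g(w + a - w)
    K_z(w + a), frees g of w, and the conjugate of K_z(w + a) splits into K_a(z) e^(z . \bar w); the
    integral in w then reproduces f(z). *)
Let psiE a z w x : psi a z (x, w) = f w * (gauss_density w)%:C *
  conjc (rep_integrand (fun y => g (y - w) * fock_kernel z y) (w + a) x).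
Proof.
rewrite conj_rep conjM conj_cexp conj_bdot conjvK [bdot (conjv x) z]bdotC conjvD bdotDr cexpD.
by rewrite /psi /psi_factor /wick_integrand /rep_integrand /fock_kernel /=; ring.
Qed.

Lemma cint_wick_kernel a z :
  cint (dV_ R n) (rep_integrand (fun x => wick_integral f g x * fock_kernel a x) z) =
  conjc (g a) * (f z * fock_kernel a z).
Proof.
have rH w : regular (fun y => g (y - w) * fock_kernel z y).
  exact: regularM (regular_shift w rg) (rkernel z).
have iH w := cintble_conj (regular_cintble_rep (w + a) (rH w)).
have psi2 w : cintble (dV_ R n) (fun x => psi a z (x, w)).
  have := cintbleZ (f w * (gauss_density w)%:C) (iH w).
  by congr cintble; apply/funext => x; rewrite psiE.
rewrite rep_wickE -(cfubini1 (cintble_psi a z) (psi1 a z)) (cfubini2 (cintble_psi a z) psi2).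
transitivity (cint (dV_ R n) (fun w => conjc (g a) * fock_kernel a z * rep_integrand f z w)).
  apply: eq_cint => w; apply: etrans (eq_cint _ (psiE a z w)) _.
  apply: etrans (cintZ _ (iH w)) _; rewrite cint_conj; last exact: regular_cintble_rep.
  rewrite regular_reproducing// (_ : w + a - w = a) ?[w + a]addrC ?addrK//.
  rewrite conjM conj_cexp conj_bdot conjvK.
  rewrite conjvD bdotC bdotDr cexpD /rep_integrand /fock_kernel; ring.
rewrite cintZ; last exact: regular_cintble_rep.
by rewrite regular_reproducing//; ring.
Qed.

End toeplitz_kernels.

Theorem corollary4 (R : realType) (n N : nat)
    (f g : 'I_N -> 'rV[R[i]]_n -> R[i])
    (n_ge1 : (1 <= n)%N) (N_ge1 : (1 <= N)%N)
    (f_Sym : forall l, Sym (f l)) (f_entire : forall l, entire (f l))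
    (g_Sym : forall l, Sym (g l)) (g_entire : forall l, entire (g l)) :
  let s l := wick (g l) (f l) in
  (forall l, wick_converges (g l) (f l)) /\
  forall F : 'rV[R[i]]_n -> R[i], kernel_span F ->
    (forall l,
      [/\ toeplitz_converges (conjf (g l)) F,
          toeplitz_converges (f l) (toeplitz (conjf (g l)) F) &
          toeplitz_converges (s l) F]) /\
    (forall z : 'rV[R[i]]_n,
      \sum_(l < N) toeplitz (f l) (toeplitz (conjf (g l)) F) z =
      \sum_(l < N) toeplitz (s l) F z).
Proof.
move=> s.
have rf l := regular_Sym (f_Sym l) (f_entire l).
have rg l := regular_Sym (g_Sym l) (g_entire l).
have sE l : s l = wick_integral (f l) (g l).
  apply/funext => z; apply: cvg_lim; first exact: norm_hausdorff.
    exact: totally_filter.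
  exact: wick_cvg.
split=> [l z|F [m [c [a ->]]]].
  by apply/cvg_ex; exists (wick_integral (f l) (g l) z); exact: wick_cvg.
have Tg l := toeplitz_span (cintble_conj_kernel (rg l)) (cint_conj_kernel (rg l)) c a.
(* By [E] below, the first operator maps the span to itself, with new coefficients, so
   [toeplitz_span] applies again to the second one. *)
have Tf l := toeplitz_span (fun b z => regular_cintble_rep z (regularM (rf l) (regular_cexp (conjv b))))
  (fun b z => regular_reproducing z (regularM (rf l) (regular_cexp (conjv b))))
  (fun j => c j * conjc (g l (a j))) a.
have Ts l := toeplitz_span (cintble_wick_kernel (rf l) (rg l)) (cint_wick_kernel (rf l) (rg l)) c a.
have E l : toeplitz (conjf (g l)) (fun w => \sum_(j < m) c j * fock_kernel (a j) w) =
    (fun w => \sum_(j < m) c j * conjc (g l (a j)) * fock_kernel (a j) w).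
  by rewrite (Tg l).2; apply/funext => z; apply: eq_bigr => j _; rewrite mulrA.
split=> [l|z].
  by rewrite E sE; split; [exact: (Tg l).1|exact: (Tf l).1|exact: (Ts l).1].
apply: eq_bigr => l _; rewrite E sE (Tf l).2 (Ts l).2.
by apply: eq_bigr => j _; exact/esym/mulrA.
Qed.
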